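(* If $\sigma(\phi)\neq 0$ (that is, $\alpha$ is nowhere differentiable), then for every $y\in\mathbb{R}$ $$\lim_{h\to 0}\mu\left\{x\in\mathbb{S}^1:\frac{\alpha(x+h)-\alpha(x)}{\sigma(\phi)\,\ell\, h\sqrt{-\log|h|}}\le y\right\}=\frac{1}{\sqrt{2\pi}}\int_{-\infty}^{y}e^{-\frac{t^2}{2}}\,dt.$$
   Context: Identify $\mathbb{S}^1$ with $\mathbb{R}/\mathbb{Z}$ via $t\mapsto(\cos 2\pi t,\sin 2\pi t)$; functions on $\mathbb{S}^1$ are identified with $1$-periodic functions on $\mathbb{R}$, so $x+h$ makes sense for $x\in\mathbb{S}^1$, $h\in\mathbb{R}$. Fix $\epsilon\in(0,1)$; $C^{k+\epsilon}$ means $C^k$ with $\epsilon$-Hölder $k$-th derivative. Let $f:\mathbb{S}^1\to\mathbb{S}^1$ be a $C^{2+\epsilon}$ expanding map, i.e. there is $\lambda>1$ with $|Df(x)|>\lambda$ for every $x$, and let $v:\mathbb{S}^1\to\mathbb{R}$ be a $C^{1+\epsilon}$ function. The generalized Weierstrass function $\alpha:\mathbb{S}^1\to\mathbb{R}$ is $$\alpha(y)=-\sum_{n=1}^{\infty}\frac{v(f^{n-1}(y))}{Df^n(y)},$$ where $f^n$ is the $n$-th iterate of $f$; it is the unique bounded solution of $v(x)=\alpha(f(x))-Df(x)\alpha(x)$. Let $$\phi(x)=-\left(\frac{v'(x)+\alpha(x)D^2f(x)}{Df(x)}\right),$$ let $\mu$ be the unique $f$-invariant Borel probability absolutely continuous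 with respect to Lebesgue measure, and let $\sigma(\phi)\ge 0$ be given by $$\sigma^2(\phi)=\lim_{n\to\infty}\int\left(\frac{\sum_{j=0}^{n}\phi\circ f^j}{\sqrt n}\right)^2 d\mu.$$ Let $L=\int\log|Df|\,d\mu>0$ and $\ell=1/\sqrt{L}$. *)

(* Defs.v *)
From HB Require Import structures.
From mathcomp Require Import all_boot all_order all_algebra.
From mathcomp Require Import all_classical all_reals all_analysis.

Set Implicit Arguments.
Unset Strict Implicit.
Unset Printing Implicit Defensive.

Import Order.TTheory GRing.Theory Num.Theory.
Import numFieldNormedType.Exports.

Local Open Scope ring_scope.
Local Open Scope classical_set_scope.

(* The circle is R/Z.  Functions on the circle are 1-periodic functions on R;
   a (continuous) self-map of the circle is represented by one of its lifts
   f : R -> R, so that f^n is [iter n f], Df is [f^`()], and v o f does not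
   depend on the lift when v is 1-periodic.  The integer d is the degree. *)
Definition circle_lift (R : realType) (f : R -> R) : Prop :=
  exists d : int, forall x, f (x + 1) = f x + d%:~R.

Definition holder (R : realType) (eps : R) (g : R -> R) : Prop :=
  exists C : R, forall x y, `|g x - g y| <= C * `|x - y| `^ eps.

(* The Hölder condition uses the distance of R: for a 1-periodic k-th
   derivative this is the same as using the distance of R/Z. *)
Definition C_holder (R : realType) (k : nat) (eps : R) (g : R -> R) : Prop :=
  [/\ forall j x, (j < k)%N -> derivable g^`(j)%classic x 1,
      continuous g^`(k)%classic & holder eps g^`(k)%classic].

Definition expanding (R : realType) (f : R -> R) : Prop :=
  exists2 lambda : R, 1 < lambda & forall x, lambda < `|f^`()%classic x|.

Section weierstrass.
Variables (R : realType) (f v : R -> R).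

Definition gen_weierstrass (y : R) : R :=
  - \big[+%R/0]_(1 <= n <oo) (v (iter n.-1 f y) / (iter n f)^`()%classic y).

Definition phi (x : R) : R :=
  - ((v^`()%classic x + gen_weierstrass x * f^`(2)%classic x) / f^`()%classic x).

End weierstrass.

(* A Borel probability measure on R/Z is represented by the Borel probability
   measure on R carried by the fundamental domain [0, 1[; Borel subsets of R/Z
   are the 1-periodic Borel subsets of R. *)
Definition circle_probability (R : realType)
    (mu : probability (measurableTypeR R) R) : Prop :=
  mu `[0, 1[ = 1%E.

Definition circle_invariant (R : realType) (f : R -> R)
    (mu : probability (measurableTypeR R) R) : Prop :=
  forall A : set (measurableTypeR R), measurable A ->
    (forall x : R, A (x + 1) <-> A x) -> mu (f @^-1` A) = mu A.

Section statistics.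
Variables (R : realType) (mu : probability (measurableTypeR R) R).

Definition sigma (f g : R -> R) : R :=
  Num.sqrt (limn (fun n : nat =>
    \int[mu]_x (((\sum_(0 <= j < n.+1) g (iter j f x))
                 / Num.sqrt n%:R) ^+ 2))).

Definition lyapunov (f : R -> R) : R := \int[mu]_x ln `|f^`()%classic x|.

Definition ell (f : R -> R) : R := (Num.sqrt (lyapunov f))^-1.

End statistics.

(* Main.v *)
Require Import Defs.
From HB Require Import structures.
From mathcomp Require Import all_boot all_order all_algebra.
From mathcomp Require Import all_classical all_reals all_analysis.
From mathcomp Require Import measurable_realfun.
From mathcomp Require Import ring lra zify.

Set Implicit Arguments.
Unset Strict Implicit.
Unset Printing Implicit Defensive.

Import Order.TTheory GRing.Theory Num.Theory.
Import numFieldNormedType.Exports.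

Local Open Scope ring_scope.
Local Open Scope classical_set_scope.

(** Differentiating the equation [v = alpha \o f - Df * alpha] formally gives
    [alpha' = phi + alpha' \o f], so that [alpha'] would be the divergent sum of
    the [phi \o f^j].  For difference quotients this is rigorous: one step of
    [f] turns the quotient between [x] and [x + h] into [phi x] plus the quotient
    between [f x] and [f (x + h)], with an error [O(|h|^eps)]
    ([quotient_step]).  Iterating until the two orbits are more than 1 apart, the
    difference quotient is, up to a bounded error, the Birkhoff sum of [phi] over
    the number of steps after which the Birkhoff sum of [ln |Df|] is about
    [- ln |h|] ([quotient_birkhoff]).

    It remains to prove the central limit theorem for these randomly stopped
    sums.  Distortion bounds make the transfer operator of [f] map a cone of
    positive functions with Hölder logarithm into a narrower one, and a coupling
    argument yields an invariant density and exponential contraction on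
    functions of mean zero ([exists_mixing_density]; the inverse branches and
    the change of variables are those of [expanding_mixing_density]).  Summing
    the iterates of the operator writes a centred Hölder function as a reverse
    martingale difference plus a coboundary.  A Lindeberg argument, trading one
    martingale increment at a time for heat flow, then gives the central limit
    theorem for the martingale sums, tested against the solution [heat] of the
    heat equation whose initial data is a step ([martingale_clt]).

    The invariant probability [mu] integrates Hölder functions like that density,
    since it is absolutely continuous and Birkhoff averages converge in Lebesgue
    measure ([mu_meanE]); in particular [sigma] is the standard deviation of the
    martingale increments ([sigma_gordin]).  The random number of steps is within
    [O(sqrt n)] of [n = - ln |h| / L], and over such a window the Birkhoff sum of
    [phi] moves by [o(sqrt n)] with large probability ([random_time]).  Hence
    the normalized quotient has the same limit law as the martingale sum
    ([quotient_heat]).  Running the heat flow for a short time only, the smoothed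
    steps sandwich the indicator of a half-line, which turns convergence of
    smooth test functions into that of distribution functions
    ([distribution_cvg]). *)

(** * Mean value and Taylor estimates *)

Section calculus.
Variable R : realType.
Implicit Types (g dg : R -> R) (x y h M : R).

Lemma is_derive_continuous g x (l : R) : is_derive x 1 g l -> {for x, continuous g}.
Proof. by case=> dg _; exact/differentiable_continuous/derivable1_diffP. Qed.

Lemma MVT_between g dg x y :
    (forall t : R, is_derive t 1 g (dg t)) ->
  exists2 c, `|c - x| <= `|y - x| & g y - g x = dg c * (y - x).
Proof.
move=> Dg.
have cg a b : {within `[a, b], continuous g}.
  by apply: continuous_subspaceT => t; exact: is_derive_continuous.
have [xy|/ltW yx] := leP x y.
  have [c /itvP cxy E] := MVT_segment xy (fun t _ => Dg t) (cg x y).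
  exists c => //; rewrite !ger0_norm ?subr_ge0 ?cxy// lerD2r ?cxy//.
have [c /itvP cxy E] := MVT_segment yx (fun t _ => Dg t) (cg y x).
exists c; first by rewrite !ler0_norm ?subr_le0 ?cxy// !opprB lerB ?cxy.
by rewrite -opprB E -mulrN opprB.
Qed.

Lemma derive_bound_lipschitz g dg M x y :
    (forall t : R, is_derive t 1 g (dg t)) -> (forall t, `|dg t| <= M) ->
  `|g y - g x| <= M * `|y - x|.
Proof.
move=> Dg dgM; have [c _ ->] := MVT_between x y Dg.
by rewrite normrM ler_wpM2r.
Qed.

Lemma taylor2 g dg M x h :
    (forall t : R, is_derive t 1 g (dg t)) ->
    (forall s t, `|dg s - dg t| <= M * `|s - t|) ->
  `|g (x + h) - g x - dg x * h| <= M * h ^+ 2.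
Proof.
move=> Dg dgM; have [c cx ->] := MVT_between x (x + h) Dg.
move: cx; rewrite [x + h]addrC !addrK => cx.
rewrite -mulrBl normrM -(real_normK (num_real h)) expr2 mulrA ler_wpM2r//.
apply: (le_trans (dgM _ _)).
have M0 : 0 <= M by have := dgM 1 0; rewrite subr0 normr1 mulr1; exact: le_trans.
by rewrite ler_wpM2l.
Qed.

Lemma taylor3 g dg ddg M x h :
    (forall t : R, is_derive t 1 g (dg t)) -> (forall t : R, is_derive t 1 dg (ddg t)) ->
    (forall s t, `|ddg s - ddg t| <= M * `|s - t|) ->
  `|g (x + h) - g x - dg x * h - ddg x * h ^+ 2 / 2| <= M * `|h| ^+ 3.
Proof.
move=> Dg Ddg ddgM.
pose k t := g (x + t) - dg x * t - ddg x / 2 * t ^+ 2.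
pose k' t := dg (x + t) - dg x - ddg x * t.
have Dk (t : R) : is_derive t 1 k (k' t).
  have Dgx : is_derive t 1 (fun t => g (x + t)) (dg (x + t)).
    rewrite -[dg _]mulr1.
    have D1 : is_derive t 1 (fun t => x + t) 1 by apply: is_derive_eq; rewrite add0r mulr1.
    exact: (is_derive1_comp (Dg _) D1).
  rewrite /k; apply: is_derive_eq.
  by rewrite /k' /GRing.scale/=; field.
have [c ch E] := MVT_between 0 h Dk.
have -> : g (x + h) - g x - dg x * h - ddg x * h ^+ 2 / 2 = k h - k 0.
  by rewrite /k addr0; field.
rewrite E subr0 normrM exprSr mulrA ler_wpM2r//.
have M0 : 0 <= M by have := ddgM 1 0; rewrite subr0 normr1 mulr1; exact: le_trans.
apply: (le_trans (taylor2 _ _ Ddg ddgM)).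
rewrite ler_wpM2l// -(real_normK (num_real c)) lerXn2r ?nnegrE//.
by move: ch; rewrite !subr0.
Qed.

End calculus.

(** * The Gaussian distribution function and the heat equation *)

Section gaussian.
Variable R : realType.
Implicit Types (x y z s t c h : R).

Definition gauss z : R := (Num.sqrt (2 * pi))^-1 * expR (- (z ^+ 2 / 2)).

Definition Phi y : R :=
  (Num.sqrt (2 * pi))^-1
    * \int[@lebesgue_measure R]_(t in `]-oo, y]) expR (- (t ^+ 2 / 2)).

Lemma gaussE z : gauss z = normal_pdf 0 1 z.
Proof.
rewrite normal_pdfE ?oner_neq0// /gauss /normal_peak /normal_fun.
rewrite expr1n mul1r subr0 (_ : 1 *+ 2 = 2 :> R)// mulNr.
by rewrite (_ : pi *+ 2 = 2 * pi :> R)// mulr_natl.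
Qed.

Lemma gauss_gt0 z : 0 < gauss z.
Proof. by rewrite /gauss mulr_gt0 ?expR_gt0// invr_gt0 sqrtr_gt0 mulr_gt0 ?pi_gt0. Qed.

Lemma gauss_int (A : set R) : measurable A ->
  (@lebesgue_measure R).-integrable A (EFin \o gauss).
Proof.
move=> mA; apply: (@integrableS _ _ _ _ setT) => //.
by rewrite (_ : _ \o _ = fun x => (normal_pdf 0 1 x)%:E);
  [exact: integrable_normal_pdf|apply/funext => x/=; rewrite gaussE].
Qed.

Lemma Phi_int y : Phi y = \int[@lebesgue_measure R]_(t in `]-oo, y]) gauss t.
Proof.
have s0 : Num.sqrt (2 * pi) != 0 :> R by rewrite gt_eqF// sqrtr_gt0 mulr_gt0// pi_gt0.
rewrite /Phi -RintegralZl//.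
have mI : measurable (`]-oo, y] : set (measurableTypeR R)) by exact: measurable_itv.
apply: (eq_integrable mI _ _ _ (integrableZl mI (Num.sqrt (2 * pi)) (gauss_int mI))) => t _ /=.
by rewrite -EFinM /gauss mulrA divff// mul1r.
Qed.

Lemma Phi_prob y : (Phi y)%:E = normal_prob 0 1 `]-oo, y].
Proof.
rewrite Phi_int /Rintegral fineK; last exact/integrable_fin_num/gauss_int.
by apply: eq_integral => t _; rewrite gaussE.
Qed.

Lemma Phi_ge0 y : 0 <= Phi y.
Proof. by rewrite -lee_fin Phi_prob. Qed.

Lemma Phi_le1 y : Phi y <= 1.
Proof. by rewrite -lee_fin Phi_prob probability_le1. Qed.

Lemma Phi_homo : {homo Phi : x y / x <= y}.
Proof.
move=> x y xy; rewrite -lee_fin !Phi_prob le_measure ?inE//=.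
exact: subset_itvl.
Qed.

Lemma gauss_derive z : is_derive z 1 gauss (- z * gauss z).
Proof.
have D : is_derive z 1 (fun z => - (z ^+ 2 / 2)) (- z).
  by apply: is_derive_eq; rewrite /GRing.scale/=; field.
have De := is_derive1_comp (is_derive_expR _) D.
rewrite (_ : gauss = (Num.sqrt (2 * pi))^-1 *: (expR \o (fun z => - (z ^+ 2 / 2))))//.
by apply: (is_derive_eq (is_deriveZ _ De)); do 2 rewrite /GRing.scale/=; ring.
Qed.

Lemma gauss_continuous : continuous gauss.
Proof. by move=> z; exact: is_derive_continuous (gauss_derive z). Qed.

Lemma Phi_derive y : is_derive y 1 Phi (gauss y).
Proof.
rewrite (_ : Phi = fun y => \int[@lebesgue_measure R]_(t in `]-oo, y]) gauss t).
  have yy : y < y + 1 by rewrite ltrDl.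
  have [] := @continuous_FTC1 R gauss -oo%O y (y + 1) yy
    (gauss_int (measurable_itv _)) (ltNyr y) (@gauss_continuous y).
  by move=> dP PE; split; [exact: dP|rewrite -derive1E; exact: PE].
by apply/funext => ?; rewrite Phi_int.
Qed.

Lemma Phi_near1 (e : R) : 0 < e ->
  exists2 A, 0 < A & 1 - e <= Phi A /\ Phi (- A) <= e.
Proof.
move=> e0.
pose F n : set (measurableTypeR R) := `]-oo, n%:R].
pose F' n : set (measurableTypeR R) := `]-oo, - n%:R].
have mF n : measurable (F n) by exact: measurable_itv.
have mF' n : measurable (F' n) by exact: measurable_itv.
have F1 : normal_prob 0 1 (F n) @[n --> \oo] --> (1%E : \bar R).
  rewrite -(probability_setT (@normal_prob R 0 1)).
  have <- : \bigcup_n F n = setT.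
    rewrite -subTset => t _/=.
    by exists (Num.truncn t).+1; rewrite //= /F/= in_itv/= ltW// truncnS_gt.
  apply: nondecreasing_cvg_mu => //; first exact: bigcup_measurable.
  move=> n m nm; apply/subsetPset => x/=; rewrite /F/= !in_itv/= => /le_trans.
  by apply; rewrite ler_nat.
have F0 : normal_prob 0 1 (F' n) @[n --> \oo] --> (0%E : \bar R).
  rewrite -(measure0 (@normal_prob R 0 1)).
  have <- : \bigcap_n F' n = set0.
    rewrite -subset0 => t /(_ (Num.bound t) I).
    by rewrite /F'/= in_itv/= leNgt => /negP; apply; rewrite ltrNl unstable.ltrNbound.
  apply: nonincreasing_cvg_mu => //=.
  + by rewrite (le_lt_trans (probability_le1 _ _)) ?ltry.
  + exact: bigcap_measurable.
  + move=> m n mn; apply/subsetPset => x/=; rewrite /F'/= !in_itv/= => /le_trans; apply.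
    by rewrite lerN2 ler_nat.
have P1 : Phi n%:R @[n --> \oo] --> (1 : R).
  have /fine_cvg := F1; apply: cvg_trans; apply: near_eq_cvg.
  by apply: nearW => n /=; rewrite -[normal_prob _ _ _]Phi_prob.
have P0 : Phi (- n%:R) @[n --> \oo] --> (0 : R).
  have /fine_cvg := F0; apply: cvg_trans; apply: near_eq_cvg.
  by apply: nearW => n /=; rewrite -[normal_prob _ _ _]Phi_prob.
near \oo => n; exists n%:R.
  by rewrite ltr0n; near: n; exact: nbhs_infty_gt.
split.
  by near: n; apply: (cvgr_ge _ P1); rewrite gtrBl.
by near: n; exact: (cvgr_le _ P0).
Unshelve. all: by end_near. Qed.

Lemma gauss_le z : gauss z <= expR (- (z ^+ 2 / 2)).
Proof.
rewrite /gauss ler_piMl ?expR_ge0// invf_le1 ?sqrtr_gt0 ?mulr_gt0 ?pi_gt0//.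
rewrite -[leLHS]sqrtr1 ler_wsqrtr//.
by have := @pi_ge2 R; lra.
Qed.

(** All four bounds follow from [(1 + z ^+ 2 / 4) ^+ 2 <= expR (z ^+ 2 / 2)]. *)
Lemma gauss_moments z :
  [/\ gauss z <= 1, `|z| * gauss z <= 1, z ^+ 2 * gauss z <= 2
    & `|z| ^+ 3 * gauss z <= 4].
Proof.
have E1 : (1 + z ^+ 2 / 4) ^+ 2 * gauss z <= 1.
  apply: (@le_trans _ _ (expR (z ^+ 2 / 4) ^+ 2 * gauss z)).
    rewrite ler_pM2r ?gauss_gt0// lerXn2r ?nnegrE ?expR_ge0 ?expR_ge1Dx//.
    by rewrite addr_ge0// divr_ge0// sqr_ge0.
  rewrite -expRM_natl (_ : 2%:R * _ = z ^+ 2 / 2); last by field.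
  apply: (le_trans (ler_wpM2l (expR_ge0 _) (gauss_le z))).
  by rewrite -expRD subrr expR0.
have g0 := gauss_gt0 z.
have a0 : 0 <= `|z| by [].
rewrite -[z ^+ 2](real_normK (num_real z)) in E1 *.
move: E1; move: `|z| (gauss z) a0 g0 => a g a0 g0 E1.
have H k C : k <= C * (1 + a ^+ 2 / 4) ^+ 2 -> 0 <= C -> k * g <= C.
  move=> kC C0; apply: (le_trans (ler_wpM2r (ltW g0) kC)).
  by rewrite -mulrA ler_piMr.
split; first (rewrite -[leLHS]mul1r); apply: H => //.
- by rewrite mul1r; have := sqr_ge0 a; nra.
- by have := sqr_ge0 (a - 1); have := sqr_ge0 (a ^+ 2); nra.
- by have := sqr_ge0 (a ^+ 2); nra.
- have := mulr_ge0 (sqr_ge0 a) (sqr_ge0 (a / 2 - 1)); have := sqr_ge0 a.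
  by nra.
Qed.

(** The probability that [x] plus a centred Gaussian of variance [s] is at most
    [y].  The suffixes name partial derivatives; that in the time [s] is
    [heat_xx / 2], which is why heat flow during time [t] imitates one centred
    increment of variance [t]. *)
Definition heat y s x := Phi ((y - x) / Num.sqrt s).
Definition heat_x y s x := - gauss ((y - x) / Num.sqrt s) / Num.sqrt s.
Definition heat_xx y s x :=
  - ((y - x) / Num.sqrt s) * gauss ((y - x) / Num.sqrt s) / s.
Definition heat_xxx y s x :=
  (1 - ((y - x) / Num.sqrt s) ^+ 2) * gauss ((y - x) / Num.sqrt s)
  / (s * Num.sqrt s).
Definition heat_sxx y s x :=
  ((y - x) / Num.sqrt s) * (3 - ((y - x) / Num.sqrt s) ^+ 2)
    * gauss ((y - x) / Num.sqrt s) / (2 * s ^+ 2).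

Lemma is_derive_shape s y x :
  is_derive x 1 (fun x => (y - x) / Num.sqrt s) (- (Num.sqrt s)^-1).
Proof. by apply: is_derive_eq; rewrite /GRing.scale/=; ring. Qed.

Lemma heat_derive_x y s x : is_derive x 1 (heat y s) (heat_x y s x).
Proof.
apply: (is_derive_eq (is_derive1_comp (Phi_derive _) (is_derive_shape s y x))).
by rewrite /heat_x mulrN mulNr.
Qed.

Lemma heat_derive_xx y s x : 0 < s -> is_derive x 1 (heat_x y s) (heat_xx y s x).
Proof.
move=> s0.
have D := is_derive1_comp (gauss_derive _) (is_derive_shape s y x).
rewrite (_ : heat_x y s =
  (- (Num.sqrt s)^-1) *: (gauss \o (fun x => (y - x) / Num.sqrt s))); last first.
  by apply/funext => t; rewrite /heat_x !fctE /GRing.scale/=; ring.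
apply: (is_derive_eq (is_deriveZ _ D)).
have E : s^-1 = (Num.sqrt s)^-1 * (Num.sqrt s)^-1.
  by rewrite -invfM -expr2 sqr_sqrtr// ltW.
by rewrite /heat_xx E /GRing.scale/=; ring.
Qed.

Lemma heat_derive_xxx y s x : 0 < s -> is_derive x 1 (heat_xx y s) (heat_xxx y s x).
Proof.
move=> s0.
have D := is_derive1_comp (gauss_derive _) (is_derive_shape s y x).
have D2 := is_deriveM (is_derive_shape s y x) D.
rewrite (_ : heat_xx y s =
  (- s^-1) *: ((fun x => (y - x) / Num.sqrt s) *
               (gauss \o (fun x => (y - x) / Num.sqrt s)))); last first.
  by apply/funext => t; rewrite /heat_xx !fctE /GRing.scale/=; ring.
apply: (is_derive_eq (is_deriveZ _ D2)).
rewrite /heat_xxx /GRing.scale/= invfM.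
by ring.
Qed.

Lemma is_derive_shape_s s y x : 0 < s ->
  is_derive s 1 (fun s => (y - x) / Num.sqrt s) (- ((y - x) / Num.sqrt s) / (2 * s)).
Proof.
move=> s0; have q0 : Num.sqrt s != 0 by rewrite gt_eqF// sqrtr_gt0.
have D := is_deriveZ (y - x) (is_deriveV q0 (is_derive1_sqrt s0)).
have E : s^-1 = (Num.sqrt s)^-1 * (Num.sqrt s)^-1.
  by rewrite -invfM -expr2 sqr_sqrtr// ltW.
by apply: (is_derive_eq D); rewrite /GRing.scale/= !invfM E; field.
Qed.

Lemma heat_derive_s y s x : 0 < s ->
  is_derive s 1 (fun s => heat y s x) (heat_xx y s x / 2).
Proof.
move=> s0.
apply: (is_derive_eq (is_derive1_comp (Phi_derive _) (is_derive_shape_s y x s0))).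
by rewrite /heat_xx; field; rewrite !gt_eqF ?sqrtr_gt0.
Qed.

Lemma heat_derive_sxx y s x : 0 < s ->
  is_derive s 1 (fun s => heat_xx y s x / 2) (heat_sxx y s x / 2).
Proof.
move=> s0.
have D1 := is_derive_shape_s y x s0.
have D := is_derive1_comp (gauss_derive _) D1.
have D2 := is_deriveM D1 D.
have D3 := is_deriveM D2 (is_deriveV (lt0r_neq0 s0) (is_derive_id s 1)).
rewrite (_ : (fun s => _) =
  (- 2^-1) *: (((fun s => (y - x) / Num.sqrt s) *
               (gauss \o (fun s => (y - x) / Num.sqrt s))) * (fun s => s^-1)));
  last first.
  by apply/funext => t; rewrite /heat_xx !fctE /GRing.scale/=; ring.
apply: (is_derive_eq (is_deriveZ _ D3)).
rewrite /heat_sxx /GRing.scale/= /GRing.scale/= fctE/=.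
set z := (y - x) / Num.sqrt s.
by move: (gauss z) => g; field; rewrite gt_eqF.
Qed.

Lemma heat_bounds y s x : 0 < s ->
  [/\ `|heat_x y s x| <= (Num.sqrt s)^-1, `|heat_xx y s x| <= s^-1,
      `|heat_xxx y s x| <= 3 / (s * Num.sqrt s) & `|heat_sxx y s x| <= 8 / s ^+ 2].
Proof.
move=> s0; have q0 : 0 < Num.sqrt s by rewrite sqrtr_gt0.
rewrite /heat_x /heat_xx /heat_xxx /heat_sxx.
move: ((y - x) / _) => z; have [m0 m1 m2 m3] := gauss_moments z.
move: (gauss z) (gauss_gt0 z) m0 m1 m2 m3 => g g0 m0 m1 m2 m3; do 3 rewrite ?normrM ?normfV ?normrN ?normrX.
rewrite !(gtr0_norm g0) !(gtr0_norm q0) !(gtr0_norm s0) (@ger0_norm _ 2)//.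
split.
- by rewrite ler_pdivrMr// mulVf// gt_eqF.
- by rewrite ler_pdivrMr// mulVf// gt_eqF.
- rewrite ler_pM2r ?invr_gt0 ?mulr_gt0//.
  apply: (@le_trans _ _ ((1 + z ^+ 2) * g)); last by lra.
  rewrite ler_pM2r//; apply: (le_trans (ler_normB _ _)).
  by rewrite normr1 ger0_norm// sqr_ge0.
- have H : `|3 - z ^+ 2| <= 3 + z ^+ 2.
    by apply: (le_trans (ler_normB _ _)); rewrite !ger0_norm ?sqr_ge0.
  rewrite -expr2 invfM mulrA ler_pM2r ?invr_gt0 ?exprn_gt0//.
  apply: (@le_trans _ _ (`|z| * (3 + `|z| ^+ 2) * g / 2)).
    by rewrite !ler_pM2r// ler_wpM2l// real_normK ?num_real.
  rewrite (_ : _ * g = 3 * (`|z| * g) + `|z| ^+ 3 * g); last by ring.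
  by lra.
Qed.

(** Uniform control of the heat flow away from time [0]: this is all that a
    Lindeberg replacement argument needs to know about the Gaussian law. *)
Lemma heat_step y c : 0 < c -> exists2 M : R, 0 <= M & (forall s, c <= s ->
  [/\ forall x, `|heat_xx y s x| <= M,
      forall x x', `|heat y s x - heat y s x'| <= M * `|x - x'|,
      forall x x', `|heat_x y s x - heat_x y s x'| <= M * `|x - x'|,
      forall x x', `|heat_xx y s x - heat_xx y s x'| <= M * `|x - x'|
    & forall x h, `|heat y s (x + h) - heat y s x - heat_x y s x * h
                    - heat_xx y s x * h ^+ 2 / 2| <= M * `|h| ^+ 3] /\
      forall x t, 0 <= t ->
        `|heat y (s + t) x - heat y s x - t * (heat_xx y s x / 2)| <= M * t ^+ 2).
Proof.
move=> c0; have q0 : 0 < Num.sqrt c by rewrite sqrtr_gt0.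
have i0 : 0 < c^-1 by rewrite invr_gt0.
have iq0 : 0 < (Num.sqrt c)^-1 by rewrite invr_gt0.
pose M := (Num.sqrt c)^-1 + c^-1 + 3 * (c^-1 * (Num.sqrt c)^-1) + 8 * c^-1 ^+ 2.
have A1 : 0 < 3 * (c^-1 * (Num.sqrt c)^-1) by rewrite !mulr_gt0.
have A2 : 0 < 8 * c^-1 ^+ 2 by rewrite mulr_gt0// exprn_gt0.
exists M; first by rewrite /M; lra.
move=> s cs; have s0 : 0 < s := lt_le_trans c0 cs.
have cs' : Num.sqrt c <= Num.sqrt s by rewrite ler_wsqrtr.
have B1 u : c <= u -> (Num.sqrt u)^-1 <= M.
  move=> cu; apply: (@le_trans _ _ (Num.sqrt c)^-1); last by rewrite /M; lra.
  by rewrite lef_pV2 ?posrE ?sqrtr_gt0 ?ler_wsqrtr// (lt_le_trans c0).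
have B2 u : c <= u -> u^-1 <= M.
  move=> cu; apply: (@le_trans _ _ c^-1); last by rewrite /M; lra.
  by rewrite lef_pV2 ?posrE// (lt_le_trans c0).
have B3 : 3 / (s * Num.sqrt s) <= M.
  apply: (@le_trans _ _ (3 * (c^-1 * (Num.sqrt c)^-1))); last by rewrite /M; lra.
  have sc : s^-1 <= c^-1 by rewrite lef_pV2 ?posrE.
  have sc' : (Num.sqrt s)^-1 <= (Num.sqrt c)^-1 by rewrite lef_pV2 ?posrE ?sqrtr_gt0.
  by rewrite invfM ler_pM2l// ler_pM// invr_ge0 ?sqrtr_ge0// ltW.
have B4 u : c <= u -> 8 / u ^+ 2 <= M.
  move=> cu; have u0 := lt_le_trans c0 cu.
  apply: (@le_trans _ _ (8 * c^-1 ^+ 2)); last by rewrite /M; lra.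
  have uc : u^-1 <= c^-1 by rewrite lef_pV2 ?posrE.
  by rewrite -exprVn ler_pM2l// lerXn2r ?nnegrE// ltW// invr_gt0.
have bd x := heat_bounds y x s0.
have L3 x x' : `|heat_xx y s x - heat_xx y s x'| <= M * `|x - x'|.
  apply: (@derive_bound_lipschitz _ _ (heat_xxx y s)) => t.
    exact: heat_derive_xxx.
  by case: (bd t) => _ _ H _; exact: le_trans H B3.
split; first split => //.
- by move=> x; case: (bd x) => _ H _ _; exact: le_trans H (B2 _ cs).
- move=> x x'; apply: (@derive_bound_lipschitz _ _ (heat_x y s)) => t.
    exact: heat_derive_x.
  by case: (bd t) => H _ _ _; exact: le_trans H (B1 _ cs).
- move=> x x'; apply: (@derive_bound_lipschitz _ _ (heat_xx y s)) => t.
    exact: heat_derive_xx.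
  by case: (bd t) => _ H _ _; exact: le_trans H (B2 _ cs).
- move=> x h; apply: taylor3 => t; [exact: heat_derive_x|exact: heat_derive_xx|].
  exact: L3.
move=> x t t0; have st : s <= s + t by rewrite lerDl.
have pos u : u \in `]s, (s + t)[%R -> 0 < u.
  by rewrite in_itv/= => /andP[su _]; exact: lt_trans su.
have wc (F G : R -> R) : (forall u : R, 0 < u -> is_derive u 1 F (G u)) ->
    forall a b, 0 < a -> {within `[a, b], continuous F}.
  move=> DF a b a0; apply: continuous_in_subspaceT => u.
  rewrite inE/= in_itv/= => /andP[au _].
  exact: is_derive_continuous (DF _ (lt_le_trans a0 au)).
have [k /itvP kst E] := MVT_segment st
  (fun u us => heat_derive_s y x (pos u us)) (wc _ _ (fun u => @heat_derive_s y u x) _ _ s0).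
rewrite E [s + t]addrC addrK mulrC -mulrBr normrM (ger0_norm t0).
have sk : s <= k by rewrite kst.
have pos' u : u \in `]s, k[%R -> 0 < u.
  by rewrite in_itv/= => /andP[su _]; exact: lt_trans su.
have [j /itvP jsk ->] := MVT_segment sk
  (fun u us => heat_derive_sxx y x (pos' u us)) (wc _ _ (fun u => @heat_derive_sxx y u x) _ _ s0).
have ks : `|k - s| <= t by rewrite ger0_norm ?subr_ge0// lerBlDl kst.
have cj : c <= j by rewrite (le_trans cs)// jsk.
have [_ _ _ H] := heat_bounds y x (lt_le_trans c0 cj).
rewrite expr2 mulrCA ler_wpM2l// normrM ler_pM//.
rewrite normrM (@ger0_norm _ 2^-1)// ler_pdivrMr//.
apply: (le_trans H); apply: (le_trans (B4 _ cj)); rewrite ler_peMr//.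
  by rewrite (le_trans _ (B2 _ cs))// invr_ge0 ltW.
by lra.
Qed.

End gaussian.

(** * Hölder functions on the circle *)

Section holder_circle.
Variables (R : realType) (eps : R).
Hypotheses (eps_gt0 : 0 < eps) (eps_lt1 : eps < 1).
Implicit Types (f g w u : R -> R) (x y C : R).

Definition hol g := periodic g 1 /\ holder eps g.

Lemma holP g : hol g ->
  exists2 C, 0 <= C & forall x y, `|g x - g y| <= C * `|x - y| `^ eps.
Proof.
move=> [_ [C HC]]; exists (Num.max C 0) => [|x y]; first by rewrite le_max lexx orbT.
by apply: (le_trans (HC x y)); rewrite ler_wpM2r ?powR_ge0// le_max lexx.
Qed.

Lemma periodic_nat g : periodic g 1 -> forall x (n : nat), g (x + n%:R) = g x.
Proof. by move=> pg x n; exact: periodicn. Qed.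

Lemma periodic_int g : periodic g 1 -> forall x (d : int), g (x + d%:~R) = g x.
Proof.
move=> pg x [n|n]; first exact: periodic_nat.
by rewrite NegzE mulrNz -[LHS](periodic_nat pg _ n.+1) -addrA addNr addr0.
Qed.

(** By periodicity an oscillation bound for points at distance at most 1 is
    enough, and there [`|x - y| <= `|x - y| `^ eps]. *)
Lemma periodic_close g x y : periodic g 1 ->
  exists y', [/\ g y' = g y, `|x - y'| <= 1 & `|x - y'| <= `|x - y|].
Proof.
move=> pg; have [le1|gt1] := leP `|x - y| 1; first by exists y.
exists (y + (Num.floor (x - y))%:~R); rewrite periodic_int//.
have /andP[fl fg] := real_floor_itv (num_real (x - y)).
move: fg; rewrite intrD => fg.
rewrite opprD addrA ger0_norm; last by rewrite subr_ge0.
have lt1 : x - y - (Num.floor (x - y))%:~R <= 1 by lra.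
by split => //; exact: le_trans lt1 (ltW gt1).
Qed.

Lemma powR_le1 x : 0 <= x <= 1 -> x <= x `^ eps.
Proof.
move=> /andP[]; rewrite le_eqVlt => /predU1P[<- _|x0 x1]; first exact: powR_ge0.
by rewrite ger1_powR ?x0//= ltW.
Qed.

Lemma powR_ler x y : 0 <= x -> x <= y -> x `^ eps <= y `^ eps.
Proof.
by move=> x0 xy; rewrite ge0_ler_powR ?nnegrE ?(ltW eps_gt0)// (le_trans x0).
Qed.

Lemma powR1r p : 1 `^ p = 1 :> R. Proof. by rewrite powR1. Qed.

Lemma powR_exprn x p n : 0 <= x -> (x ^+ n) `^ p = (x `^ p) ^+ n.
Proof.
move=> x0; elim: n => [|n IH]; first by rewrite !expr0 powR1r.
by rewrite !exprS powRM ?exprn_ge0// IH.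
Qed.

Lemma powR_exp_le1 x : 0 <= x <= 1 -> x `^ eps <= 1.
Proof. by move=> /andP[x0 x1]; rewrite -(powR1r eps) powR_ler. Qed.

Lemma hol_periodic g : hol g -> periodic g 1. Proof. by case. Qed.

Lemma hol_bounded g : hol g -> exists2 B, 0 <= B & forall x, `|g x| <= B.
Proof.
move=> hg; have [C C0 HC] := holP hg.
exists (`|g 0| + C) => [|x]; first by rewrite addr_ge0.
have [x' [<- x1 _]] := periodic_close 0 x (hol_periodic hg).
rewrite -lerBlDl (le_trans (lerB_dist _ _))// distrC (le_trans (HC _ _))//.
by rewrite ler_piMr// powR_exp_le1// x1 andbT.
Qed.

(** Anything that varies no more than a Hölder function does is Hölder; the
    closure properties of the class are instances. *)
Lemma hol_dominated g w M : hol g ->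
  (forall x y, `|w x - w y| <= M * `|g x - g y|) -> hol w.
Proof.
move=> hg wg; have [C C0 HC] := holP hg; split.
  move=> x; apply/eqP; rewrite -subr_eq0 -normr_le0 (le_trans (wg _ _))//.
  by rewrite (hol_periodic hg) subrr normr0 mulr0.
exists (`|M| * C) => x y; apply: (le_trans (wg x y)).
rewrite (@le_trans _ _ (`|M| * `|g x - g y|)) ?ler_wpM2r ?ler_norm//.
by rewrite -mulrA ler_wpM2l.
Qed.

Lemma hol_lip_comp u g M : (forall x y, `|u x - u y| <= M * `|x - y|) ->
  hol g -> hol (u \o g).
Proof. by move=> uM hg; apply: (hol_dominated hg) => x y; exact: uM. Qed.

Lemma hol_lipschitz g M : periodic g 1 ->
  (forall x y, `|g x - g y| <= M * `|x - y|) -> hol g.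
Proof.
move=> pg gM; split=> //; exists `|M| => x y.
have [y' [<- y1 yy]] := periodic_close x y pg.
apply: (le_trans (gM _ _)).
rewrite (@le_trans _ _ (`|M| * `|x - y'|)) ?ler_wpM2r ?ler_norm//.
rewrite ler_wpM2l// (@le_trans _ _ (`|x - y'| `^ eps)) ?powR_ler//.
by rewrite powR_le1// y1 andbT.
Qed.

Lemma hol_cst c : hol (fun=> c).
Proof. by apply: (@hol_lipschitz _ 0) => // x y; rewrite subrr normr0 mul0r. Qed.

Lemma hol_add g w : hol g -> hol w -> hol (fun x => g x + w x).
Proof.
move=> hg hw; have [C C0 HC] := holP hg; have [D D0 HD] := holP hw; split.
  by move=> x; rewrite (hol_periodic hg) (hol_periodic hw).
exists (C + D) => x y; rewrite mulrDl opprD addrACA.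
by apply: (le_trans (ler_normD _ _)); rewrite lerD.
Qed.

Lemma hol_mul g w : hol g -> hol w -> hol (fun x => g x * w x).
Proof.
move=> hg hw; have [C C0 HC] := holP hg; have [D D0 HD] := holP hw; split.
  by move=> x; rewrite (hol_periodic hg) (hol_periodic hw).
have [B B0 HB] := hol_bounded hg; have [B' B'0 HB'] := hol_bounded hw.
exists (B * D + B' * C) => x y.
rewrite (_ : _ - _ = g x * (w x - w y) + w y * (g x - g y)); last by ring.
rewrite (le_trans (ler_normD _ _))// !normrM mulrDl -!mulrA.
by rewrite lerD// ler_pM.
Qed.

Lemma hol_scale c g : hol g -> hol (fun x => c * g x).
Proof. by move=> hg; apply: hol_mul => //; exact: hol_cst. Qed.

Lemma hol_opp g : hol g -> hol (fun x => - g x).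
Proof.
move=> hg; rewrite (_ : (fun _ => _) = fun x => -1 * g x); first exact: hol_scale.
by apply/funext => x; rewrite mulN1r.
Qed.

Lemma hol_sub g w : hol g -> hol w -> hol (fun x => g x - w x).
Proof. by move=> hg hw; apply: hol_add => //; exact: hol_opp. Qed.

Lemma hol_sqr g : hol g -> hol (fun x => g x ^+ 2).
Proof.
move=> hg; rewrite (_ : (fun _ => _) = fun x => g x * g x); first exact: hol_mul.
by apply/funext => x; rewrite expr2.
Qed.

Lemma hol_sum (I : Type) (r : seq I) (P : pred I) (F : I -> R -> R) :
  (forall i, hol (F i)) -> hol (fun x => \sum_(i <- r | P i) F i x).
Proof.
move=> hF; elim: r => [|i r IH].
  rewrite (_ : (fun _ => _) = fun=> 0); first exact: hol_cst.
  by apply/funext => x; rewrite big_nil.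
rewrite (_ : (fun _ => _) = if P i then fun x => F i x + \sum_(i <- r | P i) F i x
  else fun x => \sum_(i <- r | P i) F i x).
  by case: (P i) => //; exact: hol_add.
by apply/funext => x; rewrite big_cons; case: ifP.
Qed.

Lemma hol_inv g c : 0 < c -> (forall x, c <= g x) -> hol g -> hol (fun x => (g x)^-1).
Proof.
move=> c0 cg hg; apply: (@hol_dominated g _ (c ^- 2) hg) => x y.
have gx := lt_le_trans c0 (cg x); have gy := lt_le_trans c0 (cg y).
rewrite (_ : _ - _ = (g y - g x) / (g x * g y)); last first.
  by field; rewrite !gt_eqF.
rewrite normrM distrC mulrC ler_wpM2r// normfV gtr0_norm ?mulr_gt0//.
by rewrite lef_pV2 ?posrE ?exprn_gt0 ?mulr_gt0// expr2 ler_pM// ltW.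
Qed.

Lemma hol_continuous g : hol g -> continuous g.
Proof.
move=> hg x; have [C C0 HC] := holP hg.
apply/cvgrPdist_le => e e0.
have C1 : 0 < C + 1 by rewrite ltr_wpDl.
have r0 : 0 < (e / (C + 1)) `^ eps^-1 by rewrite powR_gt0// divr_gt0.
near=> y; apply: (le_trans (HC _ _)).
apply: (@le_trans _ _ ((C + 1) * (e / (C + 1)))); last first.
  by rewrite mulrCA divff ?mulr1// gt_eqF.
apply: ler_pM; rewrite ?powR_ge0// ?lerDl//.
rewrite (@le_trans _ _ (((e / (C + 1)) `^ eps^-1) `^ eps))//; last first.
  rewrite -powRrM mulVf ?gt_eqF// powRr1//.
  by rewrite divr_ge0 ?(ltW e0) ?(ltW C1).
apply: powR_ler; first exact: normr_ge0.
near: y.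
exact: (@cvgr_dist_le _ _ _ _ _ id x (@cvg_id _ (nbhs x)) _ r0).
Unshelve. all: by end_near. Qed.

(** Geometric decay of both the sup and the Hölder norms. *)
Definition hol_decays (r : R) (F : nat -> R -> R) := exists2 M : R, 0 <= M &
  (forall n, periodic (F n) 1 /\
    forall x y, `|F n x| <= M * r ^+ n /\
    `|F n x - F n y| <= M * r ^+ n * `|x - y| `^ eps).

Definition fun_series (F : nat -> R -> R) x : R :=
  limn (fun n => \sum_(0 <= k < n) F k x).

Lemma geometric_partial_sum (r : R) n : 0 <= r < 1 ->
  \sum_(0 <= k < n) r ^+ k <= (1 - r)^-1.
Proof.
move=> /andP[r0 r1]; rewrite -[leRHS]mul1r ler_pdivlMr ?subr_gt0//.
have -> : (\sum_(0 <= k < n) r ^+ k) * (1 - r) = 1 - r ^+ n.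
  elim: n => [|n IH]; first by rewrite big_geq// mul0r expr0 subrr.
  by rewrite big_nat_recr//= mulrDl IH exprSr; ring.
by rewrite gerBl exprn_ge0.
Qed.

Lemma hol_series r F : 0 <= r < 1 -> hol_decays r F ->
  hol (fun_series F) /\
  forall x, \sum_(0 <= k < n) F k x @[n --> \oo] --> fun_series F x.
Proof.
move=> r01 [M M0 HF]; have /andP[r0 r1] := r01.
have cF x : \sum_(0 <= k < n) F k x @[n --> \oo] --> fun_series F x.
  have : cvgn [normed (series (F ^~ x))].
    apply: (@series_le_cvg _ _ (geometric M r)) => [n|n|n|//=].
    - exact: normr_ge0.
    - by rewrite /geometric/= mulr_ge0// exprn_ge0.
    - by rewrite /geometric/=; have [_ /(_ x x)[]] := HF n.
    by apply: is_cvg_geometric_series; rewrite ger0_norm.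
  by move/normed_cvg.
split=> //; split.
  move=> x; rewrite /fun_series; congr (limn _); apply/funext => n.
  by apply: eq_bigr => k _; have [p _] := HF k; rewrite p.
exists (M * (1 - r)^-1) => x y.
have cd : `|\sum_(0 <= k < n) F k x - \sum_(0 <= k < n) F k y| @[n --> \oo]
    --> `|fun_series F x - fun_series F y|.
  by apply: cvg_norm; apply: cvgB; exact: cF.
rewrite -(cvg_lim _ cd)//; apply: limr_le; first exact: cvgP cd.
apply: nearW => n; rewrite -sumrB (le_trans (ler_norm_sum _ _ _))//.
apply: (@le_trans _ _ (\sum_(0 <= k < n) M * r ^+ k * `|x - y| `^ eps)).
  by apply: ler_sum => k _; have [_ /(_ x y)[]] := HF k.
rewrite -mulr_suml -mulr_sumr ler_wpM2r ?powR_ge0// ler_wpM2l//.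
exact: geometric_partial_sum.
Qed.

Variables (f : R -> R) (L : R).
Hypothesis f_lift : circle_lift f.
Hypothesis f_lip : forall x y, `|f x - f y| <= L * `|x - y|.

Lemma lip_ge0 : 0 <= L.
Proof. by have := f_lip 1 0; rewrite subr0 normr1 mulr1; exact: le_trans. Qed.

Lemma hol_lift g : hol g -> hol (g \o f).
Proof.
move=> hg; have [C C0 HC] := holP hg; have L0 := lip_ge0; split.
  by case: f_lift => d fd x /=; rewrite fd periodic_int//; exact: hol_periodic.
exists (C * L `^ eps) => x y; apply: (le_trans (HC _ _)).
by rewrite -mulrA -powRM// ler_wpM2l// powR_ler.
Qed.

Lemma hol_iter n g : hol g -> hol (fun x => g (iter n f x)).
Proof.
move=> hg; elim: n => [//|n IH]; rewrite (_ : (fun _ => _) =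
  (fun x => g (iter n f x)) \o f); first exact: hol_lift.
by apply/funext => x /=; rewrite -iterSr.
Qed.

End holder_circle.

(** * Central limit theorem for reverse martingale differences *)

Section birkhoff_sums.
Variables (R : realType) (f : R -> R).
Implicit Types (g : R -> R).

Definition birkhoff g n x : R := \sum_(0 <= j < n) g (iter j f x).

Lemma birkhoff0 g x : birkhoff g 0 x = 0.
Proof. by rewrite /birkhoff big_geq. Qed.

Lemma birkhoffSl g n x : birkhoff g n.+1 x = g x + birkhoff g n (f x).
Proof.
rewrite /birkhoff big_nat_recl//=; congr (_ + _).
by apply: eq_bigr => i _; rewrite -iterSr.
Qed.

Lemma birkhoffD g k m x :
  birkhoff g (k + m) x = birkhoff g k x + birkhoff g m (iter k f x).
Proof.
elim: k x => [|k IH] x; first by rewrite birkhoff0 add0r.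
by rewrite addSn !birkhoffSl IH addrA iterSr.
Qed.

Lemma birkhoff_bound g B n x : (forall x, `|g x| <= B) -> `|birkhoff g n x| <= n%:R * B.
Proof.
move=> gB; elim: n x => [|n IH] x; first by rewrite birkhoff0 normr0 mul0r.
rewrite birkhoffSl (le_trans (ler_normD _ _))// -natr1 mulrDl mul1r addrC.
by rewrite lerD.
Qed.

Lemma birkhoff_linear g h a n x :
  birkhoff (fun x => g x + a * h x) n x = birkhoff g n x + a * birkhoff h n x.
Proof. by rewrite /birkhoff big_split/= mulr_sumr. Qed.

Lemma birkhoff_cst c n x : birkhoff (fun=> c) n x = n%:R * c.
Proof. by rewrite /birkhoff sumr_const_nat subn0 mulr_natl. Qed.

Lemma birkhoff_coboundary g n x :
  birkhoff (fun x => g x - g (f x)) n x = g x - g (iter n f x).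
Proof.
elim: n x => [|n IH] x; first by rewrite birkhoff0 subrr.
by rewrite birkhoffSl IH iterSr addrA subrK.
Qed.

End birkhoff_sums.

(** The limit theorem speaks of a positive invariant functional on Hölder
    functions rather than of a measure: the functional is first obtained from a
    density fixed by the transfer operator, and identified with the integral
    against the given measure afterwards. *)
Record invariant_mean (R : realType) (eps : R) (f : R -> R)
    (E : (R -> R) -> R) : Prop := InvariantMean {
  meanD : forall g w, hol eps g -> hol eps w -> E (fun x => g x + w x) = E g + E w;
  meanZ : forall c g, hol eps g -> E (fun x => c * g x) = c * E g;
  mean_le : forall g w, hol eps g -> hol eps w -> (forall x, g x <= w x) -> E g <= E w;
  mean1 : E (fun=> 1) = 1;
  mean_inv : forall g, hol eps g -> E (fun x => g (f x)) = E g }.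

Section mean_theory.
Variables (R : realType) (eps : R) (f : R -> R) (Lf : R).
Hypotheses (eps_gt0 : 0 < eps) (eps_lt1 : eps < 1).
Hypotheses (f_lift : circle_lift f).
Hypothesis f_lip : forall x y, `|f x - f y| <= Lf * `|x - y|.
Variable E : (R -> R) -> R.
Hypothesis hE : invariant_mean eps f E.
Implicit Types (g w G psi : R -> R).

Local Notation hol := (hol eps).
Local Notation S := (birkhoff f).

Lemma mean_cst c : E (fun=> c) = c.
Proof.
have := meanZ hE c (hol_cst eps_gt0 eps_lt1 1); rewrite (mean1 hE) mulr1 => H; rewrite -[RHS]H.
by congr E; apply/funext => x /=; rewrite mulr1.
Qed.

Lemma meanB g w : hol g -> hol w -> E (fun x => g x - w x) = E g - E w.
Proof.
move=> hg hw; rewrite -mulN1r -(meanZ hE)// -(meanD hE)//; last exact: hol_scale.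
by congr E; apply/funext => x; rewrite mulN1r.
Qed.

Lemma mean_norm_le g D : hol g -> (forall x, `|g x| <= D) -> `|E g| <= D.
Proof.
move=> hg gD; have hc c := @hol_cst _ eps eps_gt0 eps_lt1 c.
have h1 : E g <= E (fun=> D).
  by apply: (mean_le hE) => // x; have := gD x; rewrite ler_norml => /andP[].
have h2 : E (fun=> - D) <= E g.
  by apply: (mean_le hE) => // x; have := gD x; rewrite ler_norml => /andP[].
by rewrite ler_norml; move: h1 h2; rewrite !mean_cst => -> ->.
Qed.

Lemma mean_dist_le g w b : hol g -> hol w -> hol b ->
  (forall x, `|g x - w x| <= b x) -> `|E g - E w| <= E b.
Proof.
move=> hg hw hb gw; rewrite ler_norml lerBlDr lerNl opprB lerBlDr.
rewrite -(meanD hE hb hg) -(meanD hE hb hw).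
by apply/andP; split; apply: (mean_le hE) => //; try exact: hol_add;
  move=> x; have := gw x; rewrite ler_norml; lra.
Qed.

Lemma hol_birkhoff g n : hol g -> hol (S g n).
Proof.
move=> hg; rewrite /birkhoff; apply: hol_sum => // i.
exact: hol_iter hg.
Qed.

Lemma mean_iter g n : hol g -> E (fun x => g (iter n f x)) = E g.
Proof.
move=> hg; elim: n => [//|n IH]; rewrite -IH -[RHS](mean_inv hE); last exact: hol_iter hg.
by congr E; apply/funext => x; rewrite iterSr.
Qed.

(** [psi] has conditional expectation zero given the future [f x, f (f x), ...]:
    read backwards in time, [psi \o iter j f] is a martingale difference. *)
Definition reverse_martingale psi :=
  forall G, hol G -> E (fun x => psi x * G (f x)) = 0.

Lemma martingale_variance psi n : hol psi -> reverse_martingale psi ->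
  E (fun x => S psi n x ^+ 2) = n%:R * E (fun x => psi x ^+ 2).
Proof.
move=> hp mp; elim: n => [|n IH].
  rewrite mul0r -[RHS](mean_cst 0); congr E.
  by apply/funext => x; rewrite birkhoff0 expr0n.
have hS := hol_birkhoff n hp.
have hSf := hol_iter eps_gt0 f_lift f_lip 1 hS.
have -> : (fun x => S psi n.+1 x ^+ 2) = fun x =>
    (psi x ^+ 2 + S psi n (f x) ^+ 2) + 2 * (psi x * S psi n (f x)).
  by apply/funext => x; rewrite birkhoffSl; ring.
have h1 := hol_sqr eps_gt0 hp.
have h2 : hol (fun x => S psi n (f x) ^+ 2) := hol_sqr eps_gt0 hSf.
have h3 : hol (fun x => psi x * S psi n (f x)) := hol_mul eps_gt0 hp hSf.
rewrite (meanD hE (hol_add h1 h2) (hol_scale eps_gt0 eps_lt1 2 h3)).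
rewrite (meanD hE h1 h2) (meanZ hE _ h3) mp// mulr0 addr0.
rewrite (mean_inv hE (hol_sqr eps_gt0 hS)) IH.
by rewrite -natr1; ring.
Qed.

(** Decorrelation of [w] from the far future, uniformly over test functions. *)
Definition decorrelated w := forall eta : R, 0 < eta -> exists k : nat,
  forall G D, hol G -> (forall x, `|G x| <= D) ->
  `|E (fun x => w x * G (iter k.+1 f x))| <= eta * D.

Section lindeberg.
Variable psi : R -> R.
Hypotheses (hp : hol psi) (mp : reverse_martingale psi).
Hypothesis psi_mixing : decorrelated (fun x => psi x ^+ 2 - 1).
Variables (y c M B : R).
Hypotheses (c0 : 0 < c) (M0 : 0 <= M) (B0 : 0 <= B) (psiB : forall x, `|psi x| <= B).
Hypothesis heatM : forall s, c <= s ->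
  [/\ forall x, `|heat_xx y s x| <= M,
      forall x x', `|heat y s x - heat y s x'| <= M * `|x - x'|,
      forall x x', `|heat_x y s x - heat_x y s x'| <= M * `|x - x'|,
      forall x x', `|heat_xx y s x - heat_xx y s x'| <= M * `|x - x'|
    & forall x h, `|heat y s (x + h) - heat y s x - heat_x y s x * h
                    - heat_xx y s x * h ^+ 2 / 2| <= M * `|h| ^+ 3] /\
      forall x t, 0 <= t ->
        `|heat y (s + t) x - heat y s x - t * (heat_xx y s x / 2)| <= M * t ^+ 2.

Lemma hol_heat u g s r : c <= s -> hol g ->
  u \in [:: heat y s; heat_x y s; heat_xx y s] -> hol (fun x => u (g x / r)).
Proof.
move=> cs hg; have [[_ L1 L2 L3 _] _] := heatM cs.
have hgr : hol (fun x => g x / r).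
  by apply: hol_mul => //; exact: hol_cst.
by rewrite !inE => /or3P[] /eqP ->; apply: hol_lip_comp hgr.
Qed.

(** One step of the replacement: a martingale increment of variance [1/n]
    moves the expectation as much as heat flow during time [1/n], up to errors
    that sum to [o(1)].  With [U = S psi m \o f / sqrt n] for the later sum, the
    first-order Taylor term vanishes by the martingale property.  The
    second-order term and the heat flow combine to
    [(psi ^+ 2 - 1) * heat_xx U / (2 * n)], which is small in mean by
    decorrelation, once the first [k] summands are dropped from [U]. *)
Lemma lindeberg_step k eta n m s (r := Num.sqrt n%:R) :
    0 <= eta ->
    (forall G D, hol G -> (forall x, `|G x| <= D) ->
      `|E (fun x => (psi x ^+ 2 - 1) * G (iter k.+1 f x))| <= eta * D) ->
    (0 < n)%N -> c <= s ->
  `|E (fun x => heat y s (S psi m.+1 x / r))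
    - E (fun x => heat y (s + n%:R^-1) (S psi m x / r))|
  <= n%:R^-1 * (eta * M + (M * B ^+ 3 + M + (B ^+ 2 + 1) * (M * (k%:R * B))) / r).
Proof.
move=> eta0 mix n0 cs.
have n1 : 1 <= n%:R :> R by rewrite ler1n.
have r2 : r ^+ 2 = n%:R by rewrite sqr_sqrtr.
have r0 : 0 < r by rewrite sqrtr_gt0 ltr0n.
have r1 : 1 <= r by rewrite -[leLHS]sqrtr1 ler_wsqrtr.
have [[b3 L1 L2 L3 T3] T2] := heatM cs.
pose U x := S psi m (f x) / r.
pose a x := psi x / r.
have hS j : hol (S psi j) by exact: hol_birkhoff.
have hSf j i : hol (fun x => S psi j (iter i f x)) by exact: hol_iter.
have hV u s' j i : c <= s' -> u \in [:: heat y s'; heat_x y s'; heat_xx y s'] ->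
    hol (fun x => u (S psi j (iter i f x) / r)).
  by move=> cs' uin; exact: hol_heat cs' (hSf j i) uin.
have cs1 : c <= s + n%:R^-1 by rewrite (le_trans cs)// lerDl.
pose X x := heat y s (S psi m.+1 x / r) - heat y (s + n%:R^-1) (U x).
pose Y x := r^-1 * (psi x * heat_x y s (U x)).
pose k' := (m - k)%N.
pose V x := S psi k' (iter k.+1 f x) / r.
pose Z x := (2^-1 * n%:R^-1) * ((psi x ^+ 2 - 1) * heat_xx y s (V x)).
have XE x : `|X x - Y x - Z x| <=
    n%:R^-1 * ((M * B ^+ 3 + M + (B ^+ 2 + 1) * (M * (k%:R * B))) / r).
  have e1 := T3 (U x) (a x).
  have e2 := T2 (U x) n%:R^-1; have {}e2 := e2 (eqbRL (invr_ge0 _) (ler0n _ _)).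
  have e3 := L3 (U x) (V x).
  have UV : `|U x - V x| <= k%:R * B / r.
    rewrite /U /V -mulrBl normrM normfV (gtr0_norm r0) ler_pM2r ?invr_gt0//.
    rewrite iterSr; have [km|mk] := leqP k m.
      have mE : m = (k + k')%N by rewrite /k' subnKC.
      by rewrite [X in birkhoff f psi X _ - _]mE birkhoffD addrK birkhoff_bound.
    rewrite /k' (eqP (ltnW mk)) birkhoff0 subr0.
    apply: (le_trans (birkhoff_bound f m (f x) psiB)).
    by rewrite ler_wpM2r// ler_nat ltnW.
  have psi2 : `|psi x ^+ 2 - 1| <= B ^+ 2 + 1.
    rewrite (le_trans (ler_normB _ _))// normr1 lerD2r normrX.
    by rewrite lerXn2r ?nnegrE.
  have aB : `|a x| ^+ 3 <= B ^+ 3 / (n%:R * r).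
    rewrite /a normrM normfV (gtr0_norm r0) exprMn exprVn -r2 -exprSr.
    by rewrite ler_pM2r ?invr_gt0 ?exprn_gt0// lerXn2r ?nnegrE.
  have E1 : X x - Y x - Z x =
    (heat y s (U x + a x) - heat y s (U x) - heat_x y s (U x) * a x
      - heat_xx y s (U x) * a x ^+ 2 / 2)
    - (heat y (s + n%:R^-1) (U x) - heat y s (U x) - n%:R^-1 * (heat_xx y s (U x) / 2))
    + (2^-1 * n%:R^-1) * ((psi x ^+ 2 - 1) * (heat_xx y s (U x) - heat_xx y s (V x))).
    have -> : a x ^+ 2 = psi x ^+ 2 * n%:R^-1 by rewrite /a exprMn exprVn r2.
    have -> : X x = heat y s (U x + a x) - heat y (s + n%:R^-1) (U x).
      by rewrite /X birkhoffSl /U /a -mulrDl [psi x + _]addrC.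
    by rewrite /Y /Z /a; ring.
  rewrite E1 (le_trans (ler_normD _ _))// [leRHS](_ : _ = n%:R^-1 * (M * B ^+ 3 / r)
    + n%:R^-1 * (M / r) + n%:R^-1 * ((B ^+ 2 + 1) * (M * (k%:R * B)) / r));
    last by rewrite !mulrDl !mulrDr.
  rewrite lerD//.
    rewrite (le_trans (ler_normB _ _))// lerD//.
      rewrite [leRHS](_ : _ = M * (B ^+ 3 / (n%:R * r))); last by rewrite invfM; ring.
      by apply: (le_trans e1); rewrite ler_wpM2l.
    rewrite [leRHS](_ : _ = M * (n%:R^-1 * r^-1)); last by ring.
    apply: (le_trans e2); rewrite ler_wpM2l// expr2 ler_wpM2l ?invr_ge0//.
    by rewrite lef_pV2 ?posrE ?ltr0n// -r2 expr2 ler_peMr// ltW.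
  rewrite !normrM (@ger0_norm _ 2^-1)// (@ger0_norm _ n%:R^-1) ?invr_ge0//.
  have e4 : `|psi x ^+ 2 - 1| * `|heat_xx y s (U x) - heat_xx y s (V x)| <=
      (B ^+ 2 + 1) * (M * (k%:R * B / r)).
    by rewrite ler_pM// (le_trans e3)// ler_wpM2l.
  rewrite [leRHS](_ : _ = n%:R^-1 * ((B ^+ 2 + 1) * (M * (k%:R * B / r))));
    last by ring.
  rewrite ler_pM ?mulr_ge0 ?invr_ge0// ler_piMl ?invr_ge0// invf_le1//.
  by rewrite ler1n.
have hX : hol X.
  apply: hol_sub => //; first by apply: (hV _ _ _ 0%N cs); rewrite !inE eqxx.
  by apply: (hV _ _ _ 1%N cs1); rewrite !inE eqxx.
have hYG : hol (fun x => heat_x y s (S psi m x / r)).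
  by apply: (hV _ _ _ 0%N cs); rewrite !inE eqxx orbT.
have hY : hol (fun x => psi x * heat_x y s (U x)).
  by apply: hol_mul => //; apply: (hV _ _ _ 1%N cs); rewrite !inE eqxx orbT.
have hZG : hol (fun x => heat_xx y s (S psi k' x / r)).
  by apply: (hV _ _ _ 0%N cs); rewrite !inE eqxx !orbT.
have hZ : hol (fun x => (psi x ^+ 2 - 1) * heat_xx y s (V x)).
  apply: hol_mul => //; last by apply: (hV _ _ _ k.+1 cs); rewrite !inE eqxx !orbT.
  by apply: hol_sub => //; [exact: hol_sqr|exact: hol_cst].
have EX : E X = E (fun x => heat y s (S psi m.+1 x / r))
    - E (fun x => heat y (s + n%:R^-1) (S psi m x / r)).
  have h1 : hol (fun x => heat y s (S psi m.+1 x / r)).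
    by apply: (hV _ _ _ 0%N cs); rewrite !inE eqxx.
  have h2 : hol (fun x => heat y (s + n%:R^-1) (S psi m x / r)).
    by apply: (hV _ _ _ 0%N cs1); rewrite !inE eqxx.
  have h3 : hol (fun x => heat y (s + n%:R^-1) (S psi m (f x) / r)).
    by apply: (hV _ _ _ 1%N cs1); rewrite !inE eqxx.
  by rewrite -(mean_inv hE h2) -meanB.
have EY : E Y = 0 by rewrite /Y (meanZ hE)// (mp hYG) mulr0.
have EZ : `|E Z| <= n%:R^-1 * (eta * M).
  rewrite /Z (meanZ hE)// normrM ger0_norm ?mulr_ge0 ?invr_ge0//.
  rewrite [2^-1 * _]mulrC -mulrA ler_wpM2l ?invr_ge0//.
  by apply: le_trans (mix _ M hZG (fun x => b3 _)); rewrite ler_piMl// invf_le1// ler1n.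
have hY' : hol Y by exact: hol_scale.
have hZ' : hol Z by exact: hol_scale.
have hXY : hol (fun x => X x - Y x) by exact: hol_sub.
rewrite -EX (_ : E X = E (fun x => X x - Y x - Z x) + E Z); last first.
  by rewrite (meanB hXY hZ') (meanB hX hY') EY subr0 subrK.
rewrite (le_trans (ler_normD _ _))// addrC mulrDr lerD// mean_norm_le//.
exact: hol_sub.
Qed.

End lindeberg.

(** Lindeberg's method.  The mean of [heat y (c + (n - m) / n)] at the [m]-step
    sum interpolates between a constant ([m = 0]) and the mean to be computed
    ([m = n]); each of the [n] steps costs [o(1/n)]. *)
Theorem martingale_clt psi y c : hol psi -> reverse_martingale psi ->
    decorrelated (fun x => psi x ^+ 2 - 1) -> 0 < c ->
  E (fun x => heat y c (S psi n x / Num.sqrt n%:R)) @[n --> \oo]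
    --> heat y (c + 1) 0.
Proof.
move=> hp mp mix c0; have [M M0 heatM] := heat_step y c0.
have [B B0 psiB] := hol_bounded eps_gt0 hp.
apply/cvgrPdist_le => e e0.
have M1 : 0 < M + 1 by rewrite ltr_wpDl.
pose eta := e / 2 / (M + 1).
have eta0 : 0 < eta by rewrite !divr_gt0.
have [k mixk] := mix eta eta0.
pose K := M * B ^+ 3 + M + (B ^+ 2 + 1) * (M * (k%:R * B)).
have K0 : 0 <= K.
  by rewrite /K !addr_ge0// !mulr_ge0// ?exprn_ge0// addr_ge0// sqr_ge0.
near=> n.
have n0 : (0 < n)%N by near: n; exact: nbhs_infty_gt.
have nz : n%:R != 0 :> R by rewrite pnatr_eq0 -lt0n.
have nK : (2 * K / e) ^+ 2 <= n%:R by near: n; exact: nbhs_infty_ger.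
pose A m := E (fun x => heat y (c + (n - m)%:R / n%:R) (S psi m x / Num.sqrt n%:R)).
have -> : heat y (c + 1) 0 = A 0%N.
  rewrite /A subn0 divff// -[LHS](mean_cst); congr E; apply/funext => x.
  by rewrite birkhoff0 mul0r.
have -> : E (fun x => heat y c (S psi n x / Num.sqrt n%:R)) = A n.
  by rewrite /A subnn mul0r addr0.
pose b := n%:R^-1 * (eta * M + K / Num.sqrt n%:R).
have step m : (m < n)%N -> `|A m.+1 - A m| <= b.
  move=> mn; have cs : c <= c + (n - m.+1)%:R / n%:R by rewrite lerDl divr_ge0.
  have := lindeberg_step hp mp M0 B0 psiB heatM m (ltW eta0) mixk n0 cs.
  rewrite /A (_ : c + (n - m)%:R / n%:R = c + (n - m.+1)%:R / n%:R + n%:R^-1)//.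
  by rewrite -addrA -[X in _ + (_ + X)]mul1r -mulrDl natr1 -subSn.
have tele m : (m <= n)%N -> `|A 0%N - A m| <= m%:R * b.
  elim: m => [|m IH] mn; first by rewrite subrr normr0 mul0r.
  rewrite -natr1 mulrDl mul1r (le_trans (ler_distD (A m) _ _))// lerD//.
    exact/IH/ltnW.
  by rewrite distrC step.
apply: (le_trans (tele n (leqnn n))).
rewrite /b mulrA mulfV// mul1r [e]splitr lerD//.
  rewrite /eta mulrAC ler_pdivrMr// ler_pM2l ?lerDl//.
  by rewrite divr_gt0.
have r0 : 0 < Num.sqrt n%:R :> R by rewrite sqrtr_gt0 ltr0n.
rewrite ler_pdivrMr// -ler_pdivrMl ?divr_gt0//.
apply: (@le_trans _ _ (2 * K / e)).
  by rewrite le_eqVlt; apply/orP; left; apply/eqP; field; rewrite gt_eqF.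
rewrite -(@ler_pXn2r _ 2) ?nnegrE ?sqrtr_ge0 ?sqr_sqrtr//.
by rewrite divr_ge0 ?mulr_ge0// ltW.
Unshelve. all: by end_near. Qed.

(** The Birkhoff sums of a coboundary are bounded, and the cross term is
    absorbed by [2 * a * b <= d * a ^+ 2 + b ^+ 2 / d]. *)
Lemma mean_sqr_coboundary phi chi psi : hol phi -> hol chi -> hol psi ->
    reverse_martingale psi ->
    (forall x, phi x = psi x - (chi x - chi (f x))) ->
  exists2 K : R, 0 <= K & (forall n (d : R), 0 < d ->
    `|E (fun x => S phi n x ^+ 2) - n%:R * E (fun x => psi x ^+ 2)|
      <= d * (n%:R * E (fun x => psi x ^+ 2)) + (1 + d^-1) * K).
Proof.
move=> hphi hchi hp mp cob; have [C C0 chiC] := hol_bounded eps_gt0 hchi.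
exists ((C + C) ^+ 2); first exact: sqr_ge0.
move=> n d d0; have hS g : hol g -> hol (S g n) by exact: hol_birkhoff.
have hSp := hol_sqr eps_gt0 (hS _ hp); have hSf := hol_sqr eps_gt0 (hS _ hphi).
rewrite -(martingale_variance n hp mp) -(meanB hSf hSp) -(meanZ hE d hSp).
rewrite -(mean_cst ((1 + d^-1) * _)) -(meanD hE); last 2 first.
- exact: hol_scale.
- exact: hol_cst.
have H x : `|S phi n x ^+ 2 - S psi n x ^+ 2| <=
    d * S psi n x ^+ 2 + (1 + d^-1) * (C + C) ^+ 2.
  have -> : S phi n x = S psi n x - (chi x - chi (iter n f x)).
    rewrite -birkhoff_coboundary -mulN1r -birkhoff_linear.
    by apply: eq_bigr => i _; rewrite cob mulN1r.
  set a := S psi n x; set b := chi x - _.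
  have bC : `|b| <= C + C by rewrite (le_trans (ler_normB _ _))// lerD.
  have bC2 : b ^+ 2 <= (C + C) ^+ 2.
    by rewrite -(real_normK (num_real b)) lerXn2r ?nnegrE// addr_ge0.
  have d1 : 0 < d^-1 by rewrite invr_gt0.
  rewrite (_ : _ - _ = b ^+ 2 - 2 * a * b); last by ring.
  apply: (@le_trans _ _ (d * a ^+ 2 + (1 + d^-1) * b ^+ 2)); last first.
    by rewrite lerD2l ler_pM2l// ltr_wpDl.
  have P1 : 0 <= d^-1 * (d * a - b) ^+ 2 by rewrite mulr_ge0 ?sqr_ge0// ltW.
  have P2 : 0 <= d^-1 * (d * a + b) ^+ 2 by rewrite mulr_ge0 ?sqr_ge0// ltW.
  have E1 : d^-1 * (d * a - b) ^+ 2 = d * a ^+ 2 - 2 * a * b + d^-1 * b ^+ 2.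
    by field; rewrite gt_eqF.
  have E2 : d^-1 * (d * a + b) ^+ 2 = d * a ^+ 2 + 2 * a * b + d^-1 * b ^+ 2.
    by field; rewrite gt_eqF.
  have := sqr_ge0 b; rewrite ler_norml; move: P1 P2; rewrite E1 E2.
  move: (b ^+ 2) (2 * a * b) (a ^+ 2) (d^-1) => b2 ab a2 dV *.
  by apply/andP; split; lra.
have hD : hol (fun x => S phi n x ^+ 2 - S psi n x ^+ 2) by exact: hol_sub.
have hT : hol (fun x => d * S psi n x ^+ 2 + (1 + d^-1) * (C + C) ^+ 2).
  by apply: hol_add; [exact: hol_scale|exact: hol_cst].
rewrite ler_norml; apply/andP; split; last first.
  by apply: (mean_le hE) => // x; have := H x; rewrite ler_norml => /andP[].
rewrite -mulN1r -(meanZ hE)//; apply: (mean_le hE) => //; first exact: hol_scale.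
by move=> x; have := H x; rewrite ler_norml mulN1r => /andP[].
Qed.

End mean_theory.

(** * Integration over a period *)

Section circle_integral.
Variable R : realType.
Implicit Types (g h : R -> R).

Definition cint g : R := \int[@lebesgue_measure R]_(x in `[0, 1]) g x.

Lemma continuous_integrable g : continuous g ->
  (@lebesgue_measure R).-integrable `[0, 1] (EFin \o g).
Proof.
move=> cg; apply: continuous_compact_integrable; first exact: segment_compact.
exact: continuous_subspaceT.
Qed.

Lemma cintD g h : continuous g -> continuous h ->
  cint (fun x => g x + h x) = cint g + cint h.
Proof. by move=> cg ch; apply: RintegralD => //; exact: continuous_integrable. Qed.

Lemma cintZ c g : continuous g -> cint (fun x => c * g x) = c * cint g.
Proof. by move=> cg; apply: RintegralZl => //; exact: continuous_integrable. Qed.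

Lemma cint_le g h : continuous g -> continuous h -> (forall x, g x <= h x) ->
  cint g <= cint h.
Proof. by move=> cg ch gh; apply: le_Rintegral => //; exact: continuous_integrable. Qed.

Lemma cint_cst c : cint (fun=> c) = c.
Proof.
rewrite /cint Rintegral_cst//= lebesgue_measure_itv/= lte_fin ltr01.
by rewrite -EFinB subr0 /= mulr1.
Qed.

End circle_integral.

(** * The transfer operator *)

Definition rho_mean (R : realType) (rho g : R -> R) : R := cint (fun x => g x * rho x).

(** What the transfer operator is used for: an invariant density whose
    correlations decay, and with respect to which every centred Hölder function
    is cohomologous to a reverse martingale difference. *)
Record mixing_density (R : realType) (eps : R) (f rho : R -> R) : Prop := MixingDensity {
  md_hol : hol eps rho;
  md_gt0 : exists2 r, 0 < r & forall x, r <= rho x;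
  md_mean : invariant_mean eps f (rho_mean rho);
  md_decorrelated : forall g, hol eps g -> rho_mean rho g = 0 ->
    decorrelated eps f (rho_mean rho) g;
  md_gordin : forall g, hol eps g -> rho_mean rho g = 0 -> exists chi, hol eps chi /\
    reverse_martingale eps f (rho_mean rho) (fun x => g x + (chi x - chi (f x))) }.

(** The inverse branches [b k] contract and their Jacobians [J k] have bounded
    distortion; [L] is the dual of composition with [f].  The circle map enters
    only through this data. *)
Section transfer.
Variables (R : realType) (eps : R) (f : R -> R) (Lf : R).
Hypotheses (eps_gt0 : 0 < eps) (eps_lt1 : eps < 1).
Hypotheses (f_lift : circle_lift f).
Hypothesis f_lip : forall x y, `|f x - f y| <= Lf * `|x - y|.
Variables (q : nat) (b J : nat -> R -> R) (theta C : R).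
Hypotheses (q_gt0 : (0 < q)%N) (theta_gt0 : 0 < theta) (theta_lt1 : theta < 1).
Hypothesis C_ge0 : 0 <= C.
Hypothesis b_contract : forall k x y, `|b k x - b k y| <= theta * `|x - y|.
Hypothesis J_gt0 : forall k x, 0 < J k x.
Hypothesis J_distortion : forall k x y, `|x - y| <= 1 ->
  J k x <= expR (C * `|x - y| `^ eps) * J k y.

Definition transfer (g : R -> R) (x : R) : R := \sum_(k < q) g (b k x) * J k x.

Hypothesis transfer_periodic : forall g : R -> R,
  periodic g 1 -> periodic (transfer g) 1.
Hypothesis transfer_dual : forall g h : R -> R, continuous g -> continuous h ->
  periodic g 1 -> periodic h 1 ->
  cint (fun x => g x * h (f x)) = cint (fun x => transfer g x * h x).

Implicit Types (g h w : R -> R) (K t : R).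
Local Notation hol := (hol eps).
Local Notation L := transfer.

(** Positive functions whose logarithm is [K]-Hölder below distance 1.  The
    operator maps the cone of width [K] into that of width
    [theta `^ eps * K + C], which is narrower when [K] is large. *)
Definition cone K g := [/\ periodic g 1, forall x, 0 < g x &
  forall x y, `|x - y| <= 1 -> g x <= expR (K * `|x - y| `^ eps) * g y].

Lemma cone_ratio K g : 0 <= K -> cone K g -> forall x y, g x <= expR K * g y.
Proof.
move=> K0 [pg g0 gK] x y; have [y' [<- y1 _]] := periodic_close x y pg.
rewrite (le_trans (gK _ _ y1))// ler_pM2r// ler_expR ler_piMr//.
by rewrite powR_exp_le1// y1 andbT.
Qed.

Lemma expR_sub1_le t : 0 <= t -> expR t - 1 <= t * expR t.
Proof.
move=> t0; have := ler_wpM2r (expR_ge0 t) (expR_ge1Dx (- t)).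
by rewrite -expRD addNr expR0 mulrDl mul1r; lra.
Qed.

Lemma cone_holder K g : 0 <= K -> cone K g -> forall x y,
  `|g x - g y| <= K * expR K * (expR K * g 0) * `|x - y| `^ eps.
Proof.
move=> K0 cg x y; have [pg g0 gK] := cg.
have [y' [<- y1 yy]] := periodic_close x y pg.
have C0 : 0 <= K * expR K * (expR K * g 0) by rewrite !mulr_ge0 ?expR_ge0// ltW.
apply: (@le_trans _ _ (K * expR K * (expR K * g 0) * `|x - y'| `^ eps));
  last by rewrite ler_wpM2l// powR_ler.
have H u v : `|u - v| <= 1 ->
    g u - g v <= K * expR K * (expR K * g 0) * `|u - v| `^ eps.
  move=> uv; set t := _ `^ eps; have t0 : 0 <= t by exact: powR_ge0.
  have t1 : t <= 1 by rewrite powR_exp_le1// uv andbT.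
  apply: (@le_trans _ _ ((expR (K * t) - 1) * g v)).
    by rewrite mulrBl mul1r lerD2r gK.
  apply: (@le_trans _ _ ((K * t * expR (K * t)) * (expR K * g 0))).
    apply: ler_pM.
    - by rewrite subr_ge0 -expR0 ler_expR mulr_ge0.
    - exact: ltW.
    - by apply: expR_sub1_le; rewrite mulr_ge0.
    - exact: cone_ratio.
  rewrite [leRHS]mulrAC ler_pM2r ?mulr_gt0 ?expR_gt0//.
  rewrite mulrAC ler_wpM2r// ler_wpM2l// ler_expR.
  by rewrite ler_piMr.
by rewrite ler_norml H// lerNl opprB (distrC x) H// distrC.
Qed.

Lemma cone_hol K g : 0 <= K -> cone K g -> hol g.
Proof.
move=> K0 cg; split; first by case: cg.
by exists (K * expR K * (expR K * g 0)); exact: cone_holder.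
Qed.

Lemma cone_mean K g : 0 <= K -> cone K g -> cint g = 1 ->
  forall x, g x <= expR K /\ expR (- K) <= g x.
Proof.
move=> K0 cg g1 x; have cog := hol_continuous eps_gt0 (cone_hol K0 cg).
have cc (c : R) : continuous (fun _ : R => c) by exact: cst_continuous.
have cK c : continuous (fun x => c * g x).
  by move=> z; apply: cvgM; [exact: cvg_cst|exact: cog].
have h1 : cint (fun=> g x) <= cint (fun y => expR K * g y).
  by apply: (cint_le (cc _) (cK _)) => y; exact: (cone_ratio K0 cg).
have h2 : cint g <= cint (fun=> expR K * g x).
  by apply: (cint_le cog (cc _)) => y; exact: (cone_ratio K0 cg).
move: h1 h2; rewrite (cintZ _ cog) !cint_cst g1 mulr1 => h1 h2; split=> //.
by rewrite expRN -[leLHS]mul1r ler_pdivrMr ?expR_gt0// mulrC.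
Qed.

Lemma transfer_cone K g : 0 <= K -> cone K g -> cone (theta `^ eps * K + C) (L g).
Proof.
move=> K0 [pg g0 gK]; split; first exact: transfer_periodic.
  move=> x; rewrite /transfer; case: q q_gt0 => // n _.
  rewrite big_ord_recl ltr_pwDl ?mulr_gt0//.
  by apply: sumr_ge0 => i _; rewrite mulr_ge0 ?ltW.
move=> x y xy; rewrite /transfer mulr_sumr; apply: ler_sum => k _.
pose t := `|x - y|.
have bb : `|b k x - b k y| <= 1.
  by rewrite (le_trans (b_contract _ _ _))// mulr_ile1 ?(ltW theta_gt0)// ltW.
have h1 : g (b k x) <= expR (theta `^ eps * K * t `^ eps) * g (b k y).
  apply: (le_trans (gK _ _ bb)); rewrite ler_pM2r// ler_expR [_ * K]mulrC -mulrA.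
  rewrite ler_wpM2l// -powRM ?(ltW theta_gt0) ?normr_ge0//.
  exact: (powR_ler eps_gt0).
rewrite mulrDl expRD mulrACA ler_pM ?(ltW (g0 _)) ?(ltW (J_gt0 _ _))//.
exact: J_distortion.
Qed.

(** The width for which one application of the operator gains exactly 1. *)
Definition cone_width : R := (C + 1) / (1 - theta `^ eps).
Local Notation K0 := cone_width.

Lemma theta_eps : 0 < 1 - theta `^ eps.
Proof.
by rewrite subr_gt0 -[ltRHS](powR1r eps) gt0_ltr_powR ?nnegrE ?(ltW theta_gt0).
Qed.

Lemma cone_widthE : theta `^ eps * K0 + C = K0 - 1.
Proof. by rewrite /cone_width; have := theta_eps; move: (_ `^ _) => s ?; field; lra. Qed.

Lemma cone_width_ge1 : 1 <= K0.
Proof.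
rewrite /cone_width ler_pdivlMr ?theta_eps// mul1r.
by have := powR_ge0 theta eps; have := C_ge0; move: (_ `^ _) => s; lra.
Qed.

Lemma cone_width_ge0 : 0 <= K0. Proof. exact: le_trans ler01 cone_width_ge1. Qed.

Lemma coneW K K' g : K <= K' -> cone K g -> cone K' g.
Proof.
move=> KK [pg g0 gK]; split=> // x y xy; rewrite (le_trans (gK _ _ xy))//.
by rewrite ler_pM2r// ler_expR ler_wpM2r// powR_ge0.
Qed.

(** A constant small enough that subtracting it from a function of mean 1 in
    the cone of width [K0 - 1] costs at most the gain of 1 in the width. *)
Definition overlap : R := expR (- K0 - K0) / (2 * K0).
Local Notation c := overlap.

Lemma overlap_gt0 : 0 < c.
Proof. by rewrite divr_gt0 ?expR_gt0// mulr_gt0// (lt_le_trans ltr01 cone_width_ge1). Qed.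

Lemma overlap_lt1 : c < 1.
Proof.
rewrite /overlap; have K1 := cone_width_ge1.
rewrite ltr_pdivrMr ?mul1r; last by lra.
by apply: (@le_lt_trans _ _ 1); [rewrite -expR0 ler_expR; lra|lra].
Qed.

Lemma cone_scale K s g : 0 < s -> cone K g -> cone K (fun x => s * g x).
Proof.
move=> s0 [pg g0 gK]; split=> [x|x|x y xy]; first by rewrite pg.
  by rewrite mulr_gt0.
by rewrite mulrCA ler_pM2l// gK.
Qed.

(** One application of the operator improves the cone strictly, so that the
    constant [c] can be split off without leaving the cone. *)
Lemma cone_split g : cone (K0 - 1) g -> cint g = 1 ->
  cone K0 (fun x => (1 - c)^-1 * (g x - c)).
Proof.
move=> cg g1; have K1 := cone_width_ge1; have c0 := overlap_gt0.
have Kp : 0 < K0 by lra.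
have Kp' : 0 <= K0 by lra.
have g_lb x : expR (- K0) <= g x.
  have K10 : 0 <= K0 - 1 by lra.
  have [_] := cone_mean K10 cg g1 x; apply: le_trans.
  by rewrite ler_expR; lra.
have cE : 2 * c * (K0 * expR K0) = expR (- K0).
  rewrite /overlap expRD !expRN; field.
  by rewrite !gt_eqF ?expR_gt0.
have [pg g0 gK] := cg.
apply: cone_scale; first by rewrite invr_gt0 subr_gt0 overlap_lt1.
split=> [x|x|x y xy]; first by rewrite pg.
  rewrite subr_gt0 (lt_le_trans _ (g_lb x))// -cE.
  have e1 : 1 <= expR K0 by rewrite -[leLHS]expR0 ler_expR ltW.
  apply: (@lt_le_trans _ _ (2 * c)); first by lra.
  have e2 := mulr_ege1 K1 e1.
  by rewrite ler_peMr// mulr_ge0// ltW.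
have := g_lb y; rewrite -cE; set t := _ `^ eps => gy.
have t0 : 0 <= t by exact: powR_ge0.
have t1 : t <= 1 by rewrite powR_exp_le1// xy andbT.
have := gK _ _ xy; rewrite -/t => gxy; rewrite lerBlDr (le_trans gxy)// -lerBlDr.
have e1 : expR (K0 * t) - 1 <= K0 * t * expR K0.
  apply: (le_trans (expR_sub1_le _)); first by rewrite mulr_ge0 ?Kp'.
  have Kt : 0 <= K0 * t by exact: mulr_ge0.
  by rewrite ler_wpM2l// ler_expR ler_piMr.
have e2 : t <= expR (K0 * t) - expR ((K0 - 1) * t).
  have -> : K0 * t = (K0 - 1) * t + t by ring.
  rewrite expRD -[X in _ * expR t - X]mulr1 -mulrBr.
  have h1 : 1 <= expR ((K0 - 1) * t).
    by rewrite -[leLHS]expR0 ler_expR mulr_ge0// subr_ge0.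
  have h2 : t <= expR t - 1 by have := expR_ge1Dx t; lra.
  by rewrite -[leLHS]mul1r ler_pM.
have e3 : c * (expR (K0 * t) - 1) <= t * g y.
  apply: (@le_trans _ _ (c * (K0 * t * expR K0))); first by rewrite ler_pM2l.
  rewrite (_ : c * _ = t * (c * (K0 * expR K0))); last by ring.
  rewrite ler_wpM2l// (le_trans _ gy)// -mulrA ler_peMl//; last by lra.
  exact: mulr_ge0 (ltW c0) (mulr_ge0 Kp' (expR_ge0 _)).
have e4 : t * g y <= (expR (K0 * t) - expR ((K0 - 1) * t)) * g y.
  by rewrite ler_wpM2r// ltW.
by move: e3 e4; rewrite mulrBl mulrBr mulrBr mulr1; lra.
Qed.

Lemma transfer_lin a c g h x :
  L (fun x => a * g x + c * h x) x = a * L g x + c * L h x.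
Proof.
rewrite /transfer !mulr_sumr -big_split/=; apply: eq_bigr => k _.
by ring.
Qed.

Lemma iter_transfer_lin n a c g h x :
  iter n L (fun x => a * g x + c * h x) x = a * iter n L g x + c * iter n L h x.
Proof.
elim: n x => [//|n IH] x; rewrite !iterS -transfer_lin.
by congr transfer; apply/funext.
Qed.

Lemma cone1 : cone K0 (fun=> 1).
Proof.
split=> // x y _; rewrite mulr1 -[leLHS]expR0 ler_expR.
by rewrite mulr_ge0 ?powR_ge0// cone_width_ge0.
Qed.

(** Every Hölder function is the difference of a function in the cone and a
    constant, so that contraction on the cone extends to all of them. *)
Lemma cone_shift w : hol w -> exists2 A, 0 < A & cone K0 (fun x => w x + A).
Proof.
move=> hw; have [B B0 wB] := hol_bounded eps_gt0 hw; have [H H0 wH] := holP hw.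
have K1 := cone_width_ge1.
have wb x : 1 + H <= w x + (B + H + 1).
  by have := wB x; rewrite ler_norml => /andP[+ _]; lra.
exists (B + H + 1); first by rewrite ltr_wpDl// addr_ge0.
split=> [x|x|x y xy]; first by rewrite (hol_periodic hw).
  by apply: lt_le_trans (wb x); rewrite ltr_wpDr.
set t := _ `^ eps; have t0 : 0 <= t by exact: powR_ge0.
apply: (@le_trans _ _ ((1 + K0 * t) * (w y + (B + H + 1)))); last first.
  rewrite ler_wpM2r ?expR_ge1Dx//; apply: le_trans (wb y).
  by rewrite addr_ge0.
have h1 : w x - w y <= H * t by apply: (le_trans (ler_norm _)); exact: wH.
have h2 : H * t <= K0 * t * (w y + (B + H + 1)).
  rewrite mulrC -mulrA mulrCA ler_wpM2l//.
  apply: (@le_trans _ _ (w y + (B + H + 1))); first by have := wb y; lra.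
  rewrite ler_peMl//; apply: le_trans (wb y).
  by rewrite addr_ge0.
by rewrite mulrDl mul1r; lra.
Qed.

Lemma hol_transfer g : hol g -> hol (L g).
Proof.
move=> hg; have [A A0 cA] := cone_shift hg; have K00 := cone_width_ge0.
rewrite (_ : L g = fun x => L (fun x => g x + A) x - A * L (fun=> 1) x).
  have Kp : 0 <= theta `^ eps * K0 + C by rewrite addr_ge0// mulr_ge0// powR_ge0.
  apply: hol_sub => //; first exact: cone_hol (transfer_cone _ cA).
  by apply: hol_scale => //; exact: cone_hol (transfer_cone _ cone1).
apply/funext => x.
rewrite [in LHS](_ : g = fun x => 1 * (g x + A) + (- A) * 1).
  by rewrite transfer_lin mul1r mulNr.
by apply/funext => z; ring.
Qed.

Lemma hol_iter_transfer n g : hol g -> hol (iter n L g).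
Proof. by move=> hg; elim: n => [//|n IH]; rewrite iterS; exact: hol_transfer. Qed.

Lemma transfer_dual_hol g h : hol g -> hol h ->
  cint (fun x => g x * h (f x)) = cint (fun x => L g x * h x).
Proof.
move=> hg hh; apply: transfer_dual;
  [exact: (hol_continuous eps_gt0)|exact: (hol_continuous eps_gt0)|by case: hg|by case: hh].
Qed.

Lemma iter_transfer_dual n g h : hol g -> hol h ->
  cint (fun x => g x * h (iter n f x)) = cint (fun x => iter n L g x * h x).
Proof.
move=> hg hh; elim: n g hg => [//|n IH] g hg.
rewrite iterSr -IH; last exact: hol_transfer.
rewrite -(transfer_dual_hol hg (hol_iter eps_gt0 f_lift f_lip n hh)).
by congr cint; apply/funext => x; rewrite -iterSr.
Qed.

Lemma cint_transfer g : hol g -> cint (L g) = cint g.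
Proof.
move=> hg; have := transfer_dual_hol hg (hol_cst eps_gt0 eps_lt1 1).
by under eq_fun do rewrite mulr1; under [in RHS]eq_fun do rewrite mulr1.
Qed.

Lemma cintB g h : hol g -> hol h -> cint (fun x => g x - h x) = cint g - cint h.
Proof.
move=> hg hh; have cg := hol_continuous eps_gt0 hg.
have ch := hol_continuous eps_gt0 hh.
have chN := hol_continuous eps_gt0 (hol_scale eps_gt0 eps_lt1 (-1) hh).
rewrite -mulN1r -(cintZ _ ch) -(cintD cg chN).
by congr cint; apply/funext => x; rewrite mulN1r.
Qed.

(** At each step both densities shed the same constant [c], which cancels in
    the difference; what remains, renormalized, is again a pair of densities in
    the cone. *)
Lemma coupling n g1 g2 : cone K0 g1 -> cone K0 g2 -> cint g1 = 1 -> cint g2 = 1 ->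
  exists u1 u2, [/\ cone K0 u1 /\ cint u1 = 1, cone K0 u2 /\ cint u2 = 1 &
    forall x, iter n L g1 x - iter n L g2 x = (1 - c) ^+ n * (u1 x - u2 x)].
Proof.
have c1 : 1 - c != 0 by rewrite subr_eq0 gt_eqF// overlap_lt1.
have split1 g : cone K0 g -> cint g = 1 -> exists v,
    [/\ cone K0 v, cint v = 1 & forall x, L g x = c * 1 + (1 - c) * v x].
  move=> cg ig; have K00 := cone_width_ge0.
  have hg := cone_hol K00 cg; have hL := hol_transfer hg.
  have cL := transfer_cone K00 cg; rewrite cone_widthE in cL.
  have L1 : cint (L g) = 1 by rewrite cint_transfer.
  exists (fun x => (1 - c)^-1 * (L g x - c)); split; first exact: cone_split.
    rewrite cintZ; last by apply/(hol_continuous eps_gt0)/hol_sub => //; exact: hol_cst.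
    by rewrite cintB ?cint_cst ?L1 ?mulVf//; exact: hol_cst.
  by move=> x; rewrite mulrA mulfV// mul1r mulr1 addrC subrK.
elim: n g1 g2 => [|n IH] g1 g2 cg1 cg2 i1 i2.
  by exists g1, g2; split => // x; rewrite expr0 mul1r.
have [v1 [cv1 iv1 E1]] := split1 _ cg1 i1.
have [v2 [cv2 iv2 E2]] := split1 _ cg2 i2.
have [u1 [u2 [hu1 hu2 E]]] := IH _ _ cv1 cv2 iv1 iv2.
exists u1, u2; split=> // x; rewrite !iterSr.
rewrite (_ : L g1 = fun x => c * 1 + (1 - c) * v1 x); last exact/funext.
rewrite (_ : L g2 = fun x => c * 1 + (1 - c) * v2 x); last exact/funext.
by rewrite !iter_transfer_lin opprD addrACA subrr add0r -mulrBr E exprS mulrA.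
Qed.

Lemma transfer_decays w : hol w -> cint w = 0 -> hol_decays eps (1 - c) (fun n => iter n L w).
Proof.
move=> hw w0; have [A A0 cA] := cone_shift hw; have K00 := cone_width_ge0.
have An : A != 0 by rewrite gt_eqF.
have hA : hol (fun x => w x + A) by apply: hol_add => //; exact: hol_cst.
have cg : cone K0 (fun x => A^-1 * (w x + A)) by apply: cone_scale => //; rewrite invr_gt0.
have g1 : cint (fun x => A^-1 * (w x + A)) = 1.
  rewrite cintZ; last exact: (hol_continuous eps_gt0).
  rewrite cintD ?cint_cst ?w0 ?add0r ?mulVf//.
    exact: (hol_continuous eps_gt0).
  exact: cst_continuous.
pose k := K0 * expR K0 * (expR K0 * expR K0).
have e0 : 0 < expR K0 := expR_gt0 _.
have e0' : 0 <= expR K0 := ltW e0.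
have k0 : 0 <= k by exact: (mulr_ge0 (mulr_ge0 K00 e0') (mulr_ge0 e0' e0')).
exists (2 * A * (expR K0 + k)).
  by apply: mulr_ge0; [apply: mulr_ge0|apply: addr_ge0] => //; exact: ltW.
move=> n; have := coupling n cg cone1 g1 (cint_cst 1).
move=> [u1 [u2 [[cu1 iu1] [cu2 iu2] E]]].
have F x : iter n L w x = (1 - c) ^+ n * (A * (u1 x - u2 x)).
  rewrite mulrCA -E mulrBr.
  rewrite [in LHS](_ : w = fun x => A * (A^-1 * (w x + A)) + (- A) * 1).
    by rewrite iter_transfer_lin mulNr.
  by apply/funext => z; field.
have c1 : 0 <= (1 - c) ^+ n by rewrite exprn_ge0// subr_ge0 ltW// overlap_lt1.
split; first by have [] := hol_iter_transfer n hw.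
have bu u : cone K0 u -> cint u = 1 -> forall x, `|u x| <= expR K0.
  move=> cu iu x; have [+ _] := cone_mean K00 cu iu x.
  by rewrite gtr0_norm//; case: cu.
have lu u : cone K0 u -> cint u = 1 -> forall x y,
    `|u x - u y| <= k * `|x - y| `^ eps.
  move=> cu iu x y; apply: (le_trans (cone_holder K00 cu x y)).
  apply: ler_wpM2r; first exact: powR_ge0.
  apply: ler_wpM2l; first exact: (mulr_ge0 K00 e0').
  rewrite ler_pM2l//.
  by have [] := cone_mean K00 cu iu 0.
move=> x y; rewrite !F -!mulrBr !normrM (ger0_norm c1) (gtr0_norm A0).
have b1 := bu _ cu1 iu1 x; have b2 := bu _ cu2 iu2 x.
have l1 := lu _ cu1 iu1 x y; have l2 := lu _ cu2 iu2 x y.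
split.
  rewrite [leRHS](_ : _ = (1 - c) ^+ n * (A * (2 * (expR K0 + k)))); last by ring.
  rewrite ler_wpM2l// ler_pM2l// (le_trans (ler_normB _ _))//.
  by move: b1 b2 k0; lra.
rewrite (_ : u1 x - u2 x - (u1 y - u2 y) = (u1 x - u1 y) - (u2 x - u2 y));
  last by ring.
rewrite [leRHS](_ : _ = (1 - c) ^+ n * (A * (2 * (expR K0 + k) * `|x - y| `^ eps)));
  last by ring.
rewrite ler_wpM2l// ler_pM2l//.
apply: (le_trans (ler_normB _ _)); move: l1 l2.
have := powR_ge0 `|x - y| eps; move: (_ `^ eps) => t t0 l1 l2.
by have := mulr_ge0 (ltW e0) t0; nra.
Qed.

Lemma overlap_itv : 0 <= 1 - c < 1.
Proof. by rewrite subr_ge0 gtrBl overlap_gt0 ltW// overlap_lt1. Qed.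

(** The Neumann series solves the Poisson equation for [L]. *)
Lemma transfer_poisson w (X := fun_series (fun n => iter n L w)) :
    hol w -> cint w = 0 ->
  [/\ hol X, forall x, L X x = X x - w x &
   forall x, \sum_(0 <= k < n) iter k L w x @[n --> \oo] --> X x].
Proof.
move=> hw w0; have D := transfer_decays hw w0.
have [hX cX] := hol_series overlap_itv D.
split=> // x.
have c1 : \sum_(0 <= k < n.+1) iter k L w x @[n --> \oo] --> X x.
  by have := cX x; rewrite -cvg_shiftS.
have c2 : L (fun z => \sum_(0 <= k < n) iter k L w z) x @[n --> \oo] --> L X x.
  apply: cvg_big => [|k _]; first exact: add_continuous.
  by apply: cvgM; [exact: cX|exact: cvg_cst].
have E n : L (fun z => \sum_(0 <= k < n) iter k L w z) x =
    \sum_(0 <= k < n.+1) iter k L w x - w x.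
  rewrite big_nat_recl//= addrC addKr /transfer/=.
  rewrite exchange_big/=; apply: eq_bigr => k _.
  by rewrite mulr_suml.
have c3 : \sum_(0 <= k < n.+1) iter k L w x - w x @[n --> \oo] --> X x - w x.
  by apply: cvgB; [exact: c1|exact: cvg_cst].
move: c2; rewrite (funext E) => c2.
exact: (cvg_unique _ c2 c3).
Qed.

(** The density is the limit of the iterates of the constant 1, written as the
    sum of the increments [iter k L (L 1 - 1)], which have mean zero. *)
Lemma invariant_density : exists rho r, [/\ hol rho, 0 < r, forall x, r <= rho x,
  cint rho = 1 & forall x, L rho x = rho x].
Proof.
have K00 := cone_width_ge0; have h1 := hol_cst eps_gt0 eps_lt1 (1 : R).
have hL1 := hol_transfer h1.
have hw : hol (fun x => L (fun=> 1) x - 1) by exact: hol_sub.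
have w0 : cint (fun x => L (fun=> 1) x - 1) = 0.
  by rewrite cintB// cint_transfer// cint_cst subrr.
have [] := transfer_poisson hw w0; set X := fun_series _ => hX LX cX.
have hX1 : hol (fun x => 1 + X x) by exact: hol_add.
have cone_iter n : cone K0 (iter n L (fun=> 1)).
  elim: n => [|n IH]; first exact: cone1.
  rewrite iterS; apply: (@coneW (K0 - 1)); first by rewrite gerBl.
  by rewrite -cone_widthE; exact: transfer_cone.
have int_iter n : cint (iter n L (fun=> 1)) = 1.
  elim: n => [|n IH]; first by rewrite cint_cst.
  by rewrite iterS cint_transfer//; exact: hol_iter_transfer.
have sumE n x : 1 + \sum_(0 <= k < n) iter k L (fun x => L (fun=> 1) x - 1) x =
    iter n L (fun=> 1) x.
  elim: n => [|n IH]; first by rewrite big_geq// addr0.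
  rewrite big_nat_recr//= addrA IH.
  rewrite (_ : (fun x => L (fun=> 1) x - 1) = fun x => 1 * L (fun=> 1) x + (- 1) * 1).
    by rewrite iter_transfer_lin mul1r mulN1r -iterSr iterS addrC subrK.
  by apply/funext => z; rewrite mul1r mulr1.
have X1 x : expR (- K0) <= 1 + X x.
  have c1 : 1 + \sum_(0 <= k < n) iter k L (fun x => L (fun=> 1) x - 1) x
      @[n --> \oo] --> 1 + X x by apply: cvgD; [exact: cvg_cst|exact: cX].
  rewrite -(cvg_lim _ c1)//; apply: limr_ge; first exact: cvgP c1.
  apply: nearW => n; rewrite sumE.
  by have [] := cone_mean K00 (cone_iter n) (int_iter n) x.
pose s := cint (fun x => 1 + X x).
have s0 : 0 < s.
  apply: (@lt_le_trans _ _ (expR (- K0))); first exact: expR_gt0.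
  rewrite -(cint_cst (expR (- K0))); apply: cint_le => //.
  - exact: cst_continuous.
  - exact: (hol_continuous eps_gt0).
exists (fun x => s^-1 * (1 + X x)), (s^-1 * expR (- K0)); split.
- exact: hol_scale.
- by rewrite mulr_gt0 ?expR_gt0// invr_gt0.
- by move=> x; rewrite ler_pM2l// invr_gt0.
- by rewrite cintZ ?mulVf ?gt_eqF//; exact: (hol_continuous eps_gt0).
move=> x; rewrite [in LHS](_ : (fun x => _) = fun x => s^-1 * 1 + s^-1 * X x).
  by rewrite transfer_lin LX; ring.
by apply/funext => z; ring.
Qed.

Section invariant_state.
Variables (rho : R -> R) (r : R).
Hypotheses (hrho : hol rho) (r_gt0 : 0 < r) (rho_ge : forall x, r <= rho x).
Hypotheses (int_rho : cint rho = 1) (L_rho : forall x, L rho x = rho x).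

Lemma rho_mean_invariant : invariant_mean eps f (rho_mean rho).
Proof.
have hm g : hol g -> hol (fun x => g x * rho x) by move=> hg; exact: hol_mul.
have cm g : hol g -> continuous (fun x => g x * rho x).
  by move=> hg; exact: (hol_continuous eps_gt0 (hm g hg)).
split.
- move=> g h hg hh; rewrite /rho_mean -(cintD (cm g hg) (cm h hh)).
  by congr cint; apply/funext => x; rewrite mulrDl.
- move=> a g hg; rewrite /rho_mean -(cintZ _ (cm g hg)).
  by congr cint; apply/funext => x; rewrite mulrA.
- move=> g h hg hh gh; apply: (cint_le (cm g hg) (cm h hh)) => x.
  by rewrite ler_wpM2r// (le_trans (ltW r_gt0)).
- by rewrite /rho_mean -[RHS]int_rho; congr cint; apply/funext => x; rewrite mul1r.
- move=> g hg; rewrite /rho_mean.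
  under eq_fun do rewrite mulrC.
  rewrite (transfer_dual_hol hrho hg); congr cint; apply/funext => x.
  by rewrite L_rho mulrC.
Qed.

Lemma rho_mean_decorrelated g : hol g -> rho_mean rho g = 0 ->
  decorrelated eps f (rho_mean rho) g.
Proof.
move=> hg g0 eta eta0.
have hw : hol (fun x => g x * rho x) by exact: hol_mul.
have [M M0 HM] := transfer_decays hw g0.
have /andP[c0 c1] := overlap_itv.
have : M * (1 - c) ^+ n.+1 @[n --> \oo] --> M * 0.
  apply: cvgM; first exact: cvg_cst.
  by have := @cvg_expr R (1 - c); rewrite cvg_shiftS; apply; rewrite ger0_norm.
rewrite mulr0 => cM.
have [k _ Hk] : \forall n \near \oo, M * (1 - c) ^+ n.+1 <= eta.
  exact: (cvgr_le _ cM).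
exists k => G D hG GD; rewrite /rho_mean.
under eq_fun do rewrite mulrAC.
rewrite (iter_transfer_dual k.+1 hw hG).
have hF : hol (fun x => iter k.+1 L (fun x => g x * rho x) x * G x).
  by apply: hol_mul => //; exact: hol_iter_transfer.
have B x : `|iter k.+1 L (fun x => g x * rho x) x * G x| <= eta * D.
  rewrite normrM ler_pM//; have [_ /(_ x x)[+ _]] := HM k.+1.
  by move/le_trans; apply; apply: Hk => /=.
have cc (a : R) : continuous (fun _ : R => a) by exact: cst_continuous.
have cF := hol_continuous eps_gt0 hF.
have h1 : cint (fun=> - (eta * D)) <= cint (fun x => iter k.+1 L
    (fun x => g x * rho x) x * G x).
  by apply: cint_le => // x; have := B x; rewrite ler_norml => /andP[].
have h2 : cint (fun x => iter k.+1 L (fun x => g x * rho x) x * G x) <=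
    cint (fun=> eta * D).
  by apply: cint_le => // x; have := B x; rewrite ler_norml => /andP[].
by rewrite ler_norml; move: h1 h2; rewrite !cint_cst => -> ->.
Qed.

(** Gordin's decomposition.  If [X] is the sum of [iter k L (g * rho)] over
    [1 <= k], then [chi = X / rho] satisfies
    [L ((g + chi - chi \o f) * rho) = 0], which by duality is the martingale
    property. *)
Lemma rho_mean_gordin g : hol g -> rho_mean rho g = 0 -> exists chi, hol chi /\
  reverse_martingale eps f (rho_mean rho) (fun x => g x + (chi x - chi (f x))).
Proof.
move=> hg g0.
have hw : hol (fun x => g x * rho x) by exact: hol_mul.
have hLw := hol_transfer hw.
have [hX LX _] := transfer_poisson hLw (etrans (cint_transfer hw) g0).
set X := fun_series _ in hX LX.
have rho0 x : rho x != 0 by rewrite gt_eqF// (lt_le_trans r_gt0).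
have hchi : hol (fun x => X x / rho x).
  by apply: hol_mul => //; exact: (hol_inv r_gt0).
exists (fun x => X x / rho x); split=> // G hG.
have hG' := hol_lift eps_gt0 f_lift f_lip hG.
pose A x := g x * rho x * G (f x).
pose B x := X x * G (f x).
pose D x := rho x * (X (f x) / rho (f x) * G (f x)).
have hGf : hol (fun x => G (f x)) := hG'.
have hA : hol A by exact: hol_mul.
have hB : hol B by exact: hol_mul.
have hcG : hol (fun x => X x / rho x * G x) by exact: hol_mul.
have hD : hol D.
  by apply: hol_mul => //; exact: (hol_lift eps_gt0 f_lift f_lip hcG).
rewrite /rho_mean (_ : (fun x => _) = fun x => (A x + B x) - D x); last first.
  by apply/funext => x; rewrite /A /B /D; field; rewrite !rho0.
rewrite cintB//; last exact: hol_add.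
have cLA := hol_continuous eps_gt0 (hol_mul eps_gt0 hLw hG).
have cLB := hol_continuous eps_gt0 (hol_mul eps_gt0 (hol_transfer hX) hG).
rewrite (cintD (hol_continuous eps_gt0 hA) (hol_continuous eps_gt0 hB)).
rewrite (transfer_dual_hol hw hG) (transfer_dual_hol hX hG) (transfer_dual_hol hrho hcG).
rewrite -(cintD cLA cLB).
apply/eqP; rewrite subr_eq0; apply/eqP; congr cint; apply/funext => x.
by rewrite LX L_rho; field.
Qed.

End invariant_state.

Theorem exists_mixing_density : exists rho, mixing_density eps f rho.
Proof.
have [rho [r [hrho r0 rho_ge int_rho L_rho]]] := invariant_density.
exists rho; split=> //; first by exists r.
- exact: rho_mean_invariant r0 rho_ge int_rho L_rho.
- by move=> g; exact: rho_mean_decorrelated.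
- by move=> g; exact: rho_mean_gordin r0 rho_ge L_rho _.
Qed.

End transfer.

(** * Inverse branches of an expanding circle map *)

Section primitives.
Variable R : realType.
Implicit Types (g P h : R -> R) (a : R).

Lemma exists_primitive g a : continuous g ->
  exists P, forall x : R, a < x -> is_derive x 1 P (g x).
Proof.
move=> cg; exists (fun x => \int[@lebesgue_measure R]_(t in `[a, x]) g t) => x ax.
have ig : (@lebesgue_measure R).-integrable `[a, (x + 1)] (EFin \o g).
  apply: continuous_compact_integrable; first exact: segment_compact.
  exact: continuous_subspaceT.
have xx : x < x + 1 by rewrite ltrDl.
have [dP PE] := continuous_FTC1_closed xx ig ax (cg x).
by split; [exact: dP|rewrite -derive1E; exact: PE].
Qed.

Lemma cint_primitive g P a : continuous g -> a < 0 ->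
  (forall x : R, a < x -> is_derive x 1 P (g x)) -> cint g = P 1 - P 0.
Proof.
move=> cg a0 DP.
have cP x : a < x -> {for x, continuous P}.
  by move=> ax; exact: is_derive_continuous (DP x ax).
rewrite /cint /Rintegral (@continuous_FTC2 _ g P)//.
- exact: continuous_subspaceT.
- split.
  + move=> x; rewrite in_itv/= => /andP[x0 _].
    by have [] := DP x (lt_trans a0 x0).
  + by apply: cvg_at_right_filter; apply: cP.
  + by apply: cvg_at_left_filter; apply: cP; rewrite (lt_trans a0).
- move=> x; rewrite in_itv/= => /andP[x0 _].
  by rewrite derive1E; have [_ ->] := DP x (lt_trans a0 x0).
Qed.

Lemma derive0_constant P a : (forall x : R, a < x -> is_derive x 1 P 0) ->
  forall x y, a < x -> a < y -> P x = P y.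
Proof.
move=> DP; suff H x y : a < x -> x <= y -> P x = P y.
  move=> x y ax ay; have [xy|/ltW yx] := leP x y; first exact: H.
  by apply/esym/H.
move=> ax xy; have at_ z : x <= z -> a < z by exact: lt_le_trans.
have [z||c _] := @MVT_segment _ P (fun=> 0) x y xy.
- by rewrite in_itv/= => /andP[xz _]; apply/DP/at_/ltW.
- apply: continuous_in_subspaceT => z; rewrite inE/= in_itv/= => /andP[xz _].
  exact: is_derive_continuous (DP z (at_ z xz)).
- by rewrite mul0r => /eqP; rewrite subr_eq0 => /eqP.
Qed.

Lemma is_derive_translate P (x r : R) (l : R) : is_derive (x + r) 1 P l ->
  is_derive x 1 (fun x => P (x + r)) l.
Proof.
move=> D; have D1 : is_derive x 1 (fun x : R => x + r) 1.
  by apply: is_derive_eq; rewrite addr0.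
by rewrite -[l]mulr1; exact: (@is_derive1_comp _ P (fun x => x + r) x l 1 D D1).
Qed.

Lemma derive_periodic (F D : R -> R) (d : R) :
    (forall x : R, is_derive x 1 F (D x)) -> (forall x, F (x + 1) = F x + d) ->
  periodic D 1.
Proof.
move=> DF Fd x; have D1 := is_derive_translate (DF (x + 1)).
have D2 : is_derive x 1 (fun x : R => F (x + 1)) (D x).
  have -> : (fun x => F (x + 1)) = F + cst d by apply/funext => z; rewrite Fd.
  by apply: (is_derive_eq (is_deriveD (DF x) (is_derive_cst _ _ _))); rewrite addr0.
by case: D1 => _ <-; case: D2 => _ <-.
Qed.

Lemma cint_reflect h : continuous h -> periodic h 1 ->
  cint (fun x => h (- x)) = cint h.
Proof.
move=> ch ph; rewrite /cint.
have := @Rintegration_by_substitution_onem R h 1.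
rewrite ler01 lexx => /(_ isT) ->; last exact: continuous_subspaceT.
rewrite /unstable.onem subrr; apply: eq_Rintegral => x _.
by rewrite addrC ph.
Qed.

End primitives.

Section increasing_lift.
Variables (R : realType) (F D : R -> R) (lam M : R).
Hypotheses (lam_gt1 : 1 < lam) (M_ge0 : 0 <= M).
Hypothesis F_derive : forall x : R, is_derive x 1 F (D x).
Hypothesis D_gt : forall x, lam < D x.
Hypothesis D_lip : forall x y, `|D x - D y| <= M * `|x - y|.
Hypothesis F_lift : circle_lift F.
Implicit Types (x y : R).

Lemma lift_continuous : continuous F.
Proof. by move=> x; exact: is_derive_continuous (F_derive x). Qed.

Lemma lift_expand x y : x <= y -> lam * (y - x) <= F y - F x.
Proof.
move=> xy; have [c _ ->] := MVT_between x y F_derive.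
by rewrite ler_wpM2r ?subr_ge0// ltW.
Qed.

Lemma lift_lt x y : x < y -> F x < F y.
Proof.
move=> xy; rewrite -subr_gt0; apply: lt_le_trans (lift_expand (ltW xy)).
by rewrite mulr_gt0 ?subr_gt0// (lt_trans ltr01).
Qed.

Lemma lift_inj : injective F.
Proof.
by move=> x y; case: (ltgtP x y) => // /lift_lt H E; move: H; rewrite E ltxx.
Qed.

Lemma lift_surj y : exists x, F x = y.
Proof.
have lam0 : 0 < lam by exact: lt_trans lam_gt1.
have [r [r0 r1 r2]] : exists r, [/\ 0 <= r, y - F 0 <= r & - (y - F 0) <= r].
  exists `|y - F 0|; split; [exact: normr_ge0|exact: ler_norm|].
  by rewrite -normrN ler_norm.
have h1 : F (- r) <= y.
  have := @lift_expand (- r) 0; rewrite oppr_le0 sub0r opprK => /(_ r0).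
  have : r <= lam * r by rewrite ler_peMl// ltW.
  by lra.
have h2 : y <= F r.
  have := @lift_expand 0 r r0; rewrite subr0.
  have : r <= lam * r by rewrite ler_peMl// ltW.
  by lra.
have rr : - r <= r by rewrite (le_trans _ r0)// oppr_le0.
have [] := @IVT R F (- r) r y rr.
- by apply: continuous_subspaceT; exact: lift_continuous.
- by rewrite ge_min le_max h1 h2 orbT.
by move=> c _ E; exists c.
Qed.

Definition lift_inv y : R := sval (cid (lift_surj y)).
Local Notation G := lift_inv.

Lemma lift_invK y : F (G y) = y. Proof. by rewrite /lift_inv; case: cid. Qed.

Lemma liftK x : G (F x) = x. Proof. by apply: lift_inj; rewrite lift_invK. Qed.

Lemma lift_inv_contract x y : `|G x - G y| <= lam^-1 * `|x - y|.
Proof.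
have lam0 : 0 < lam by exact: lt_trans lam_gt1.
rewrite ler_pdivlMl//; wlog yx : x y / G y <= G x.
  move=> H; have [/H//|/ltW /H] := leP (G y) (G x).
  by rewrite distrC [`|y - x|]distrC.
rewrite ger0_norm ?subr_ge0//; apply: le_trans (lift_expand yx) _.
by rewrite !lift_invK ler_norm.
Qed.

Lemma lift_inv_continuous : continuous G.
Proof.
move=> x; apply/cvgrPdist_le => e e0; near=> y.
apply: (le_trans (lift_inv_contract _ _)).
apply: (@le_trans _ _ `|x - y|).
  by rewrite ler_piMl// invf_le1 ?ltW// (lt_trans ltr01).
near: y; exact: (@cvgr_dist_le _ _ _ _ _ id x (@cvg_id _ (nbhs x)) _ e0).
Unshelve. all: by end_near. Qed.

Lemma derivative_gt0 x : 0 < D x.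
Proof. by apply: lt_trans (D_gt x); exact: lt_trans lam_gt1. Qed.

Lemma derivative_periodic : periodic D 1.
Proof. by case: F_lift => d Fd; exact: derive_periodic F_derive Fd. Qed.

Lemma derivative_continuous : continuous D.
Proof.
move=> x; apply/cvgrPdist_le => e e0.
have M1 : 0 < M + 1 by rewrite ltr_wpDl.
near=> y; apply: (le_trans (D_lip _ _)).
apply: (@le_trans _ _ ((M + 1) * (e / (M + 1)))); last first.
  by rewrite mulrCA divff ?mulr1// gt_eqF.
apply: ler_pM => //; first by rewrite lerDl.
near: y; apply: (@cvgr_dist_le _ _ _ _ _ id x (@cvg_id _ (nbhs x))).
by rewrite divr_gt0.
Unshelve. all: by end_near. Qed.

Lemma lift_degree : exists2 q : nat, (0 < q)%N & forall x, F (x + 1) = F x + q%:R.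
Proof.
case: F_lift => d Fd.
have d0 : (0 : R) < d%:~R.
  have := lift_lt (@ltr01 R); rewrite -[X in _ < F X -> _]add0r Fd => H.
  by move: H; rewrite ltrDl.
have d0' : 0 < d by move: d0; rewrite ltr0z.
by exists `|d|%N; [rewrite absz_gt0 gt_eqF|move=> x; rewrite natr_absz gtr0_norm].
Qed.

Variable q : nat.
Hypothesis F_degree : forall x, F (x + 1) = F x + q%:R.

Lemma lift_inv_degree x : G (x + q%:R) = G x + 1.
Proof. by apply: lift_inj; rewrite F_degree !lift_invK. Qed.

Definition branch (k : nat) x : R := G (x + k%:R).
Definition branch_jacobian (k : nat) x : R := (D (branch k x))^-1.

Lemma branch_contract k x y : `|branch k x - branch k y| <= lam^-1 * `|x - y|.
Proof.
rewrite /branch (le_trans (lift_inv_contract _ _))//.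
by rewrite opprD addrACA subrr addr0.
Qed.

Lemma branch_jacobian_gt0 k x : 0 < branch_jacobian k x.
Proof. by rewrite invr_gt0 derivative_gt0. Qed.

(** The branch contracts, and a distance at most 1 is at most its [eps]-th
    power; this turns the Lipschitz bound on [D] into the bound of the cone. *)
Lemma branch_distortion (eps : R) : 0 < eps < 1 -> forall k x y, `|x - y| <= 1 ->
  branch_jacobian k x <= expR (M * `|x - y| `^ eps) * branch_jacobian k y.
Proof.
move=> /andP[e0 e1] k x y xy; rewrite /branch_jacobian.
set u := branch k x; set v := branch k y.
have lam0 : 0 < lam by exact: lt_trans lam_gt1.
have uv : `|v - u| <= `|x - y|.
  rewrite distrC (le_trans (branch_contract _ _ _))//.
  by rewrite ler_piMl// invf_le1 ?ltW.
rewrite ler_pdivlMr ?derivative_gt0// mulrC ler_pdivrMr ?derivative_gt0//.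
apply: (@le_trans _ _ ((1 + M * `|x - y| `^ eps) * D u)); last first.
  by rewrite ler_wpM2r ?expR_ge1Dx// ltW// derivative_gt0.
rewrite mulrDl mul1r -lerBlDl (le_trans (ler_norm _))// (le_trans (D_lip _ _))//.
apply: (@le_trans _ _ (M * `|x - y| `^ eps)).
  rewrite ler_wpM2l// (le_trans uv)// powR_le1//.
  by rewrite xy andbT.
rewrite ler_peMr ?mulr_ge0 ?powR_ge0//.
by rewrite ltW// (lt_trans lam_gt1).
Qed.

Lemma sum_translates (W : R -> R) : (forall x, W (x + q%:R) = W x) ->
  periodic (fun x => \sum_(k < q) W (x + k%:R)) 1.
Proof.
move=> Wq x; apply: (@addIr _ (W x)).
transitivity (\sum_(k < q.+1) W (x + k%:R)).
  rewrite big_ord_recl/= addr0 addrC; congr (_ + _).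
  by apply: eq_bigr => k _; rewrite -addrA nat1r.
by rewrite big_ord_recr/= Wq.
Qed.

Let T (g : R -> R) x := \sum_(k < q) g (branch k x) * branch_jacobian k x.

Lemma increasing_transfer_periodic (g : R -> R) : periodic g 1 -> periodic (T g) 1.
Proof.
move=> pg; apply: (@sum_translates (fun x => g (G x) / D (G x))) => x.
by rewrite lift_inv_degree pg derivative_periodic.
Qed.

Lemma continuous_branch_term (g : R -> R) : continuous g ->
  continuous (fun x => g (G x) / D (G x)).
Proof.
move=> cg x; apply: cvgM.
  exact: (@continuous_comp _ _ _ G g x (lift_inv_continuous (x:=x)) (cg (G x))).
apply: cvgV; first by rewrite gt_eqF// derivative_gt0.
exact: (@continuous_comp _ _ _ G D x (lift_inv_continuous (x:=x))
  (derivative_continuous (x:=G x))).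
Qed.

(** Change of variables, read off a primitive [P] of the integrand on the
    image side: both integrals are increments of [P] over an interval of
    length [q], and these agree because [P'] is [q]-periodic. *)
Lemma increasing_transfer_dual (g h : R -> R) : continuous g -> continuous h ->
  periodic g 1 -> periodic h 1 ->
  cint (fun x => g x * h (F x)) = cint (fun x => T g x * h x).
Proof.
move=> cg ch pg ph.
pose W x := g (G x) / D (G x) * h x.
have cW : continuous W.
  by move=> x; apply: cvgM; [exact: continuous_branch_term|exact: ch].
have WqE x : W (x + q%:R) = W x.
  by rewrite /W lift_inv_degree pg derivative_periodic periodic_nat.
(* A primitive on []a, +oo[], which contains all the end points below with some
   room on the left. *)
pose a := Num.min (F (- 1)) (- 1).
have a1 : a <= F (- 1) by rewrite ge_min lexx.
have a2 : a <= - 1 by rewrite ge_min lexx orbT.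
have a0 : a < 0 by rewrite (le_lt_trans a2)// ltrN10.
have [P DP] := exists_primitive a cW.
have cF : continuous (fun x => g x * h (F x)).
  move=> x; apply: cvgM; first exact: cg.
  exact: (@continuous_comp _ _ _ F h x (lift_continuous (x:=x)) (ch (F x))).
have -> : cint (fun x => g x * h (F x)) = P (F 1) - P (F 0).
  apply: (@cint_primitive _ _ (P \o F) (- 1) cF (ltrN10 R)).
  move=> x x1; have aF : a < F x by apply: (le_lt_trans a1); exact: lift_lt.
  apply: (is_derive_eq (is_derive1_comp (DP _ aF) (F_derive x))).
  by rewrite /W liftK mulrAC divfK// gt_eqF// derivative_gt0.
have TE : (fun x => T g x * h x) = fun x => \sum_(k < q) W (x + k%:R).
  apply/funext => x; rewrite /T mulr_suml; apply: eq_bigr => k _.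
  by rewrite /W /branch_jacobian /branch (periodic_nat ph).
have cT : continuous (fun x => \sum_(k < q) W (x + k%:R)).
  move=> x; apply: cvg_big => [|k _]; first exact: add_continuous.
  apply: (@continuous_comp _ _ _ (fun x => x + k%:R) W x); last exact: cW.
  by apply: cvgD; [exact: cvg_id|exact: cvg_cst].
have -> : cint (fun x => T g x * h x) = P q%:R - P 0.
  have DT x : a < x -> is_derive x 1 (fun x => \sum_(k < q) P (x + k%:R))
      (\sum_(k < q) W (x + k%:R)).
    move=> ax.
    rewrite (_ : (fun x => \sum_(k < q) P (x + k%:R)) = \sum_(k < q) fun x => P (x + k%:R)).
      apply: is_derive_sum => k; apply: is_derive_translate; apply: DP.
      by rewrite (lt_le_trans ax)// lerDl.
    by apply/funext => z; rewrite fct_sumE.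
  rewrite TE (cint_primitive cT a0 DT).
  rewrite -sumrB -(big_mkord xpredT (fun k => P (1 + k%:R) - P (0 + k%:R))).
  under eq_bigr do rewrite add0r nat1r.
  by rewrite telescope_sumr.
have H : P (F 0 + q%:R) - P (F 0) = P (0 + q%:R) - P 0.
  apply: (@derive0_constant _ (fun x => P (x + q%:R) - P x) a) => // [x ax|].
    have aq : a < x + q%:R by rewrite (lt_le_trans ax)// lerDl.
    apply: (is_derive_eq (is_deriveB (is_derive_translate (DP _ aq)) (DP _ ax))).
    by rewrite WqE subrr.
  by rewrite (le_lt_trans a1)// lift_lt// ltrN10.
have -> : F 1 = F 0 + q%:R by rewrite -F_degree add0r.
by rewrite H add0r.
Qed.

End increasing_lift.

Section expanding_maps.
Variables (R : realType) (eps : R) (f D : R -> R) (lam M Lf : R).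
Hypotheses (eps_gt0 : 0 < eps) (eps_lt1 : eps < 1).
Hypotheses (lam_gt1 : 1 < lam) (M_ge0 : 0 <= M).
Hypothesis f_derive : forall x : R, is_derive x 1 f (D x).
Hypothesis D_gt : forall x, lam < `|D x|.
Hypothesis D_lip : forall x y, `|D x - D y| <= M * `|x - y|.
Hypothesis f_lip : forall x y, `|f x - f y| <= Lf * `|x - y|.
Hypothesis f_lift : circle_lift f.

Lemma derivative_sign : (forall x, lam < D x) \/ (forall x, lam < - D x).
Proof.
have cD : continuous D by exact: (derivative_continuous M_ge0 D_lip).
have Dn x : D x != 0.
  by rewrite -normr_gt0 (lt_trans _ (D_gt x))// (lt_trans _ lam_gt1)// ltr01.
have same x y : 0 < D x -> 0 < D y.
  move=> Dx; rewrite lt_neqAle eq_sym Dn/= leNgt; apply/negP => Dy.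
  have zero a b : a <= b -> Num.min (D a) (D b) <= 0 <= Num.max (D a) (D b) -> False.
    move=> ab H; have [|c _ Dc] := IVT ab _ H; first exact: continuous_subspaceT.
    by have := Dn c; rewrite Dc eqxx.
  have [xy|/ltW yx] := leP x y.
    by apply: (zero x y xy); rewrite ge_min le_max (ltW Dx) (ltW Dy) orbT.
  by apply: (zero y x yx); rewrite ge_min le_max (ltW Dx) (ltW Dy) orbT.
have [D0|D0] := ltP 0 (D 0); [left|right] => x.
  by have := D_gt x; rewrite gtr0_norm//; exact: same D0.
have Dx : D x <= 0 by rewrite leNgt; apply/negP => /(same x 0); rewrite ltNge D0.
by have := D_gt x; rewrite ler0_norm.
Qed.

(** The degree of [f] may be negative.  Then [- f] is increasing, and its
    inverse branches composed with [x |-> - x] are those of [f]. *)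
Theorem expanding_mixing_density : exists rho, mixing_density eps f rho.
Proof.
have lam0 : 0 < lam by exact: lt_trans lam_gt1.
have il0 : 0 < lam^-1 by rewrite invr_gt0.
have il1 : lam^-1 < 1 by rewrite invf_lt1.
have e01 : 0 < eps < 1 by rewrite eps_gt0.
have [Dp|Dm] := derivative_sign.
  have [q q0 fq] := lift_degree lam_gt1 f_derive Dp f_lift.
  pose b := branch lam_gt1 f_derive Dp; pose J := branch_jacobian lam_gt1 f_derive Dp.
  apply: (@exists_mixing_density R eps f Lf eps_gt0 eps_lt1 f_lift f_lip
    q b J lam^-1 M) => //.
  - by move=> k x y; exact: branch_contract.
  - by move=> k x; exact: branch_jacobian_gt0.
  - by move=> k x y; exact: branch_distortion.
  - by move=> g; exact: increasing_transfer_periodic.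
  - by move=> g h; exact: (increasing_transfer_dual lam_gt1 M_ge0 f_derive Dp D_lip f_lift fq).
pose F x := - f x.
have F_derive (x : R) : is_derive x 1 F (- D x) by exact: is_deriveN.
have F_lift : circle_lift F.
  by case: f_lift => d fd; exists (- d) => x; rewrite /F fd mulrNz opprD.
have ND_lip x y : `|- D x - - D y| <= M * `|x - y| by rewrite opprK addrC distrC.
have [q q0 Fq] := lift_degree lam_gt1 F_derive Dm F_lift.
pose b k x := branch lam_gt1 F_derive Dm k (- x).
pose J k x := branch_jacobian lam_gt1 F_derive Dm k (- x).
have dist (x y : R) : `|- x - - y| = `|x - y| by rewrite opprK addrC distrC.
have TE (g : R -> R) x : transfer q b J g x =
  transfer q (branch lam_gt1 F_derive Dm) (branch_jacobian lam_gt1 F_derive Dm) g (- x).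
  by [].
have cT (g : R -> R) : continuous g -> continuous
    (transfer q (branch lam_gt1 F_derive Dm) (branch_jacobian lam_gt1 F_derive Dm) g).
  move=> cg x; apply: cvg_big => [|k _]; first exact: add_continuous.
  have H := continuous_branch_term (D := fun x => - D x) (lam_gt1 := lam_gt1)
    (F_derive := F_derive) (D_gt := Dm) M_ge0 ND_lip cg.
  have ck : {for x, continuous (fun x : R => x + k%:R)}.
    by apply: cvgD; [exact: cvg_id|exact: cvg_cst].
  exact: (continuous_comp ck (H (x + k%:R))).
apply: (@exists_mixing_density R eps f Lf eps_gt0 eps_lt1 f_lift f_lip
    q b J lam^-1 M) => //.
- by move=> k x y; rewrite -(dist x y); exact: branch_contract.
- by move=> k x; exact: branch_jacobian_gt0.
- by move=> k x y; rewrite -(dist x y); exact: branch_distortion.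
- move=> g pg x; rewrite !TE.
  have := increasing_transfer_periodic lam_gt1 F_derive Dm F_lift Fq pg (- (x + 1)).
  by rewrite opprD subrK => /esym.
- move=> g h cg ch pg ph.
  have ch' : continuous (fun x => h (- x)).
    by move=> x; apply: (@continuous_comp _ _ _ -%R h); [exact: opp_continuous|exact: ch].
  have ph' : periodic (fun x => h (- x)) 1.
    by move=> x /=; rewrite opprD -(ph (- x - 1)) subrK.
  have := increasing_transfer_dual lam_gt1 M_ge0 F_derive Dm ND_lip F_lift Fq cg ch' pg ph'.
  under eq_fun do rewrite /F opprK.
  move=> ->; rewrite -[RHS]cint_reflect.
  + by congr cint; apply/funext => x; rewrite TE opprK.
  + move=> x; apply: cvgM; last exact: ch.
    apply: (@continuous_comp _ _ _ -%R (transfer q (branch lam_gt1 F_derive Dm)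
      (branch_jacobian lam_gt1 F_derive Dm) g)); [exact: opp_continuous|exact: cT].
  + move=> x; rewrite !TE ph; congr (_ * _).
    have := increasing_transfer_periodic lam_gt1 F_derive Dm F_lift Fq pg (- (x + 1)).
    by rewrite opprD subrK => /esym.
Qed.

End expanding_maps.

(** * The generalized Weierstrass function *)

Section weierstrass_function.
Variables (R : realType) (eps : R) (f v : R -> R).
Hypotheses (eps_gt0 : 0 < eps) (eps_lt1 : eps < 1).
Hypotheses (f_lift : circle_lift f) (f_C2 : C_holder 2 eps f).
Hypothesis f_expanding : expanding f.
Hypotheses (v_periodic : periodic v 1) (v_C1 : C_holder 1 eps v).
Implicit Types (x y h t : R).
Local Notation hol := (hol eps).
Local Notation D := (f^`()%classic).
Local Notation D2 := (f^`(2)%classic).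
Local Notation Dv := (v^`()%classic).

Lemma map_derive x : is_derive x 1 f (D x).
Proof.
case: f_C2 => /(_ 0%N x isT); rewrite derive1n0 => df _ _.
by split; [exact: df|rewrite derive1E].
Qed.

Lemma map_derive2 x : is_derive x 1 D (D2 x).
Proof.
case: f_C2 => /(_ 1%N x isT); rewrite derive1n1 => df _ _.
by split; [exact: df|rewrite derive1nS derive1n1 derive1E].
Qed.

Lemma obs_derive x : is_derive x 1 v (Dv x).
Proof.
case: v_C1 => /(_ 0%N x isT); rewrite derive1n0 => df _ _.
by split; [exact: df|rewrite derive1E].
Qed.

Lemma map_D_periodic : periodic D 1.
Proof. by case: f_lift => d fd; exact: derive_periodic map_derive fd. Qed.

Lemma hol_D2 : hol D2.
Proof.
split; last by case: f_C2.
apply: (derive_periodic (d := 0) map_derive2) => x.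
by rewrite addr0 map_D_periodic.
Qed.

Lemma hol_Dv : hol Dv.
Proof.
split; last by case: v_C1; rewrite derive1n1.
by apply: (derive_periodic (d := 0) obs_derive) => x; rewrite addr0 v_periodic.
Qed.

Lemma map_D_lip : exists2 M, 0 <= M & forall x y, `|D x - D y| <= M * `|x - y|.
Proof.
have [M M0 HM] := hol_bounded eps_gt0 hol_D2; exists M => // x y.
exact: derive_bound_lipschitz map_derive2 HM.
Qed.

Lemma hol_D : hol D.
Proof. by have [M _ HM] := map_D_lip; exact: (hol_lipschitz eps_gt0 eps_lt1 map_D_periodic HM). Qed.

Lemma hol_v : hol v.
Proof.
have [M M0 HM] := hol_bounded eps_gt0 hol_Dv.
apply: (@hol_lipschitz _ _ eps_gt0 eps_lt1 _ M v_periodic) => x y.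
exact: derive_bound_lipschitz obs_derive HM.
Qed.

Lemma map_lip : exists2 Lf, 1 < Lf & forall x y, `|f x - f y| <= Lf * `|x - y|.
Proof.
have [L _ HL] := hol_bounded eps_gt0 hol_D; have [lam lam1 Dlam] := f_expanding.
exists L; first by rewrite (lt_trans lam1)// (lt_le_trans (Dlam 0)).
by move=> x y; exact: derive_bound_lipschitz map_derive HL.
Qed.

Lemma map_expand lam x y : (forall x, lam < `|D x|) -> lam * `|x - y| <= `|f x - f y|.
Proof.
move=> Dlam; have [c _ ->] := MVT_between y x map_derive.
by rewrite normrM ler_wpM2r// ltW.
Qed.

Lemma map_D_gt1 x : 1 < `|D x|.
Proof. by have [lam lam1 Dlam] := f_expanding; exact: lt_trans (Dlam x). Qed.

Lemma map_D_neq0 x : D x != 0.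
Proof. by rewrite -normr_gt0 (lt_trans ltr01)// map_D_gt1. Qed.

Lemma hol_invD : hol (fun x => (D x)^-1).
Proof.
apply: (@hol_dominated _ _ D _ 1 hol_D) => x y.
have h1 := map_D_gt1 x; have h2 := map_D_gt1 y.
rewrite (_ : _ - _ = (D y - D x) / (D x * D y)); last first.
  by field; rewrite !map_D_neq0.
rewrite normrM distrC mul1r ler_piMr// normfV normrM invf_le1.
  by rewrite mulr_ege1// ltW.
by rewrite mulr_gt0// (lt_trans ltr01).
Qed.

(** The [n]-th term of the series; the recursion mirrors the twisted
    cohomological equation. *)
Fixpoint wterm n x : R := if n is m.+1 then wterm m (f x) / D x else v x / D x.

Lemma iter_derive n x : is_derive x 1 (iter n f) (\prod_(j < n) D (iter j f x)).
Proof.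
elim: n x => [|n IH] x; first by rewrite big_ord0; exact: is_derive_id.
rewrite big_ord_recr/= mulrC.
exact: (is_derive1_comp (map_derive (iter n f x)) (IH x)).
Qed.

Lemma wtermE n x : wterm n x = v (iter n f x) / (iter n.+1 f)^`()%classic x.
Proof.
rewrite derive1E; have [_ ->] := iter_derive n.+1 x.
elim: n x => [|n IH] x; first by rewrite /= big_ord1.
rewrite [LHS]/= IH [in RHS]big_ord_recl invfM [X in _ = _ * X]mulrC mulrA -iterSr.
by congr (_ / _ / _); apply: eq_bigr => j _; rewrite -iterSr.
Qed.

Lemma wterm_periodic n : periodic (wterm n) 1.
Proof.
elim: n => [|n IH] x /=; rewrite map_D_periodic ?v_periodic//.
by case: f_lift => d fd; rewrite fd periodic_int.
Qed.

Lemma wterm_bound : exists lam B, [/\ 1 < lam, 0 <= B & forall n x,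
  `|wterm n x| <= B * lam^-1 ^+ n].
Proof.
have [lam lam1 Dlam] := f_expanding; have [B B0 HB] := hol_bounded eps_gt0 hol_v.
have lam0 : 0 < lam by exact: lt_trans lam1.
exists lam, B; split=> //; elim=> [|n IH] x /=; rewrite normrM normfV.
  rewrite expr0 mulr1 ler_pdivrMr ?(lt_trans lam0)//.
  by rewrite (le_trans (HB x))// ler_peMr// ltW// map_D_gt1.
rewrite exprSr mulrA ler_pM ?invr_ge0// lef_pV2 ?posrE//; first exact: ltW.
exact: lt_trans (Dlam x).
Qed.

(** Each term is Lipschitz uniformly in [n], because the factor [Df^n] lost by
    differentiating along the orbit is the one in the denominator. *)
Lemma wterm_lipschitz : exists2 C, 0 <= C & forall n x y,
  `|wterm n x - wterm n y| <= C * `|x - y|.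
Proof.
have [lam [B [lam1 B0 HB]]] := wterm_bound.
have lam0 : 0 < lam by exact: lt_trans lam1.
have [M M0 HM] := hol_bounded eps_gt0 hol_D2.
have [V V0 HV] := hol_bounded eps_gt0 hol_Dv.
have [Bv Bv0 HBv] := hol_bounded eps_gt0 hol_v.
have DV x : is_derive x 1 (fun x => (D x)^-1) (- D2 x / D x ^+ 2).
  apply: (is_derive_eq (is_deriveV (map_D_neq0 x) (map_derive2 x))).
  by rewrite /GRing.scale/=; ring.
have DVb x : `|- D2 x / D x ^+ 2| <= M.
  rewrite normrM normrN -[leRHS]mulr1 ler_pM// normfV normrX invf_le1.
    by rewrite exprn_ege1// ltW// map_D_gt1.
  by rewrite exprn_gt0// (lt_trans ltr01) ?map_D_gt1.
have bound n : exists d, forall x, is_derive x 1 (wterm n) (d x) /\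
    `|d x| <= V + Bv * M + B * M * \sum_(0 <= k < n) lam^-1 ^+ k.
  elim: n => [|n [d Hd]].
    exists (fun x => v x * (- D2 x / D x ^+ 2) + (D x)^-1 * Dv x) => x; split.
      exact: (is_deriveM (obs_derive x) (DV x)).
    rewrite big_geq// mulr0 addr0 (le_trans (ler_normD _ _))// addrC lerD//.
      rewrite normrM normfV -[leRHS]mul1r ler_pM// ?invr_ge0// invf_le1.
        by rewrite ltW// map_D_gt1.
      by rewrite (lt_trans ltr01)// map_D_gt1.
    by rewrite normrM ler_pM.
  exists (fun x => wterm n (f x) * (- D2 x / D x ^+ 2) + (D x)^-1 * (d (f x) * D x)).
  move=> x; have [dn dnb] := Hd (f x); split.
    exact: (is_deriveM (is_derive1_comp dn (map_derive x)) (DV x)).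
  rewrite big_nat_recr// mulrDr addrA addrC (le_trans (ler_normD _ _))// lerD//.
    rewrite [leRHS]mulrAC normrM; apply: ler_pM => //; exact: DVb.
  by rewrite mulrCA mulVf ?mulr1 ?map_D_neq0.
exists (V + Bv * M + B * M * (1 - lam^-1)^-1).
  rewrite !addr_ge0// !mulr_ge0// invr_ge0 subr_ge0 invf_le1// ltW//.
move=> n x y; have [d Hd] := bound n.
apply: (@derive_bound_lipschitz _ _ d) => t; have [//] := Hd t.
move=> _ /le_trans; apply; rewrite lerD2l ler_wpM2l ?mulr_ge0//.
by apply: geometric_partial_sum; rewrite invr_ge0 ltW//= invf_lt1.
Qed.

(** The sup norm decays and the Lipschitz norm is bounded; by interpolation,
    [z = z `^ (1 - eps) * z `^ eps], the Hölder norm decays. *)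
Lemma wterm_decays : exists2 r, 0 <= r < 1 & hol_decays eps r wterm.
Proof.
have [lam [B [lam1 B0 HB]]] := wterm_bound; have [C C0 HC] := wterm_lipschitz.
have lam0 : 0 < lam by exact: lt_trans lam1.
have th0 : 0 < lam^-1 by rewrite invr_gt0.
have th1 : lam^-1 < 1 by rewrite invf_lt1.
have e1 : 0 < 1 - eps by rewrite subr_gt0.
pose r := lam^-1 `^ (1 - eps).
have r0 : 0 <= r := powR_ge0 _ _.
exists r.
  rewrite r0 /= -[ltRHS](powR1r (1 - eps)) gt0_ltr_powR ?nnegrE//.
  exact: ltW.
exists (B + (2 * B) `^ (1 - eps) * C `^ eps).
  by rewrite addr_ge0// mulr_ge0// powR_ge0.
have p0 : 0 <= (2 * B) `^ (1 - eps) * C `^ eps by rewrite mulr_ge0// powR_ge0.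
move=> n; split; first exact: wterm_periodic.
have rn : 0 <= r ^+ n by rewrite exprn_ge0.
move=> x y; split.
  apply: (le_trans (HB n x)); rewrite mulrDl.
  apply: (@le_trans _ _ (B * r ^+ n)); last by rewrite lerDl mulr_ge0.
  rewrite ler_wpM2l// lerXn2r ?nnegrE ?(ltW th0)//.
  have th01 : 0 < lam^-1 <= 1 by rewrite th0 ltW.
  by rewrite /r -[leLHS]powRr1 ?(ltW th0)//; apply: (ger_powR th01); rewrite gerBl ltW.
have z1 : `|wterm n x - wterm n y| <= 2 * B * lam^-1 ^+ n.
  by rewrite (le_trans (ler_normB _ _))// -mulrA mulr_natl mulr2n lerD.
have z2 := HC n x y; move: z1 z2; move: `|wterm n x - _| (normr_ge0 (wterm n x - wterm n y)).
move=> z z0 z1 z2.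
have -> : z = z `^ (1 - eps) * z `^ eps.
  by rewrite -powRD ?subrK ?powRr1// oner_eq0.
apply: (@le_trans _ _ ((2 * B * lam^-1 ^+ n) `^ (1 - eps) * (C * `|x - y|) `^ eps)).
  by rewrite ler_pM ?powR_ge0// ?powR_ler.
rewrite (powRM _ C0)// powRM ?mulr_ge0 ?exprn_ge0 ?(ltW th0)//.
have -> : (lam^-1 ^+ n) `^ (1 - eps) = r ^+ n.
  exact: powR_exprn (ltW th0).
rewrite [X in X <= _](_ : _ = (2 * B) `^ (1 - eps) * C `^ eps * r ^+ n * `|x - y| `^ eps);
  last by ring.
by rewrite ler_wpM2r ?powR_ge0// ler_wpM2r// lerDr.
Qed.

Local Notation alpha := (gen_weierstrass f v).

Lemma weierstrass_series : alpha = fun x => - fun_series wterm x.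
Proof.
apply/funext => x; rewrite /gen_weierstrass; congr (- _).
have [r r01 dec] := wterm_decays; have [_ /(_ x) cW] := hol_series r01 dec.
apply: cvg_lim => //; rewrite -cvg_shiftS.
apply: cvg_trans cW; apply: near_eq_cvg; apply: nearW => n /=.
by rewrite big_add1/=; apply: eq_bigr => k _; rewrite wtermE.
Qed.

Lemma hol_alpha : hol alpha.
Proof.
rewrite weierstrass_series; have [r r01 dec] := wterm_decays.
by have [hW _] := hol_series r01 dec; exact: hol_opp.
Qed.

Lemma weierstrass_equation x : v x = alpha (f x) - D x * alpha x.
Proof.
rewrite weierstrass_series; have [r r01 dec] := wterm_decays.
have [_ cW] := hol_series r01 dec.
have c1 : \sum_(0 <= k < n.+1) wterm k x @[n --> \oo] --> fun_series wterm x.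
  by have := cW x; rewrite -cvg_shiftS.
have c2 : v x / D x + (\sum_(0 <= k < n) wterm k (f x)) / D x @[n --> \oo] -->
    v x / D x + fun_series wterm (f x) / D x.
  apply: cvgD; first exact: cvg_cst.
  by apply: cvgM; [exact: cW|exact: cvg_cst].
have E : (fun n => \sum_(0 <= k < n.+1) wterm k x) =
    (fun n => v x / D x + (\sum_(0 <= k < n) wterm k (f x)) / D x).
  by apply/funext => n; rewrite big_nat_recl//= mulr_suml.
move: c1; rewrite E => c1; have := cvg_unique _ c1 c2 => /= ->//.
by field; exact: map_D_neq0.
Qed.

Lemma hol_phi : hol (phi f v).
Proof.
have h := hol_add hol_Dv (hol_mul eps_gt0 hol_alpha hol_D2).
exact: (hol_opp eps_gt0 eps_lt1 (hol_mul eps_gt0 h hol_invD)).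
Qed.

(** The functional equation at two points [h] apart, subtracted and divided by
    [h * d].  Here [a], [p], [v], [d] are the values of [alpha], [alpha \o f],
    [v], [Df], the image points are [h'] apart, and [dv], [c2] are the slopes of
    [v], [Df] between the points; the right-hand side collects the errors of
    replacing [h' / h], [dv] and [c2] by derivatives at the first point. *)
Lemma quotient_identity (F : fieldType) (a0 a1 p0 p1 v0 v1 d d' dv0 dv c2 d2 h h' : F) :
    h != 0 -> h' != 0 -> d != 0 ->
    v0 = p0 - d * a0 -> v1 = p1 - d' * a1 -> v1 - v0 = dv * h -> d' - d = c2 * h ->
  (a1 - a0) / h - (p1 - p0) / h' - - ((dv0 + a0 * d2) / d) =
  (p1 - p0) / h' * ((h' - d * h) / (h * d)) - (dv - dv0) / d
  - ((c2 - d2) * a1 + d2 * (a1 - a0)) / d.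
Proof.
move=> h0 h'0 d0 E0 E1 Ev Ed.
have -> : a1 = a0 + (p1 - p0 - dv * h - c2 * h * a1) / d.
  by rewrite -Ev -Ed E0 E1; field.
have -> : p1 - p0 = d * (a1 - a0) + (dv + c2 * a1) * h.
  rewrite mulrDl -Ev mulrAC -Ed E0 E1; ring.
by field; rewrite h0 h'0 d0.
Qed.

(** The difference quotient satisfies, along the orbit, the equation formally
    satisfied by the derivative, [alpha' = phi + alpha' \o f]. *)
Lemma quotient_step : exists2 C, 0 <= C & forall x h, h != 0 -> `|h| <= 1 ->
  forall h', h' = f (x + h) - f x ->
  `|(alpha (x + h) - alpha x) / h - (alpha (f (x + h)) - alpha (f x)) / h'
    - phi f v x| <= C * `|h| `^ eps.
Proof.
have [M M0 DM] := map_D_lip; have [L L1 fL] := map_lip.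
have L0 : 0 <= L by rewrite ltW// (lt_trans ltr01).
have [A A0 HA] := holP hol_alpha; have [Ba Ba0 HBa] := hol_bounded eps_gt0 hol_alpha.
have [V V0 HV] := holP hol_Dv.
have [E E0 HE] := holP hol_D2; have [Be Be0 HBe] := hol_bounded eps_gt0 hol_D2.
exists (A * L `^ eps * M + V + (E * Ba + Be * A)).
  by rewrite !addr_ge0// !mulr_ge0// powR_ge0.
move=> x h h0 h1 h' h'E; set t := `|h| `^ eps.
have t0 : 0 <= t := powR_ge0 _ _.
have hn : 0 < `|h| by rewrite normr_gt0.
have D0 := map_D_neq0 x; have D1 := map_D_gt1 x.
have iD : `|(D x)^-1| <= 1.
  by rewrite normfV invf_le1 ?(ltW D1)// (lt_trans ltr01).
have hh : `|h| <= `|h'|.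
  have := @map_expand 1 (x + h) x map_D_gt1.
  by rewrite mul1r [x + h - x]addrC addKr -h'E.
have h'0 : h' != 0 by rewrite -normr_gt0 (lt_le_trans hn).
have [c1 c1h Ev] := MVT_between x (x + h) obs_derive.
have [c2 c2h ED] := MVT_between x (x + h) map_derive2.
move: c1h c2h Ev ED; rewrite [x + h - x]addrC addKr => c1h c2h Ev ED.
have near z : `|z - x| <= `|h| -> `|z - x| `^ eps <= t by move=> zx; exact: powR_ler.
have eqx := weierstrass_equation x; have eqh := weierstrass_equation (x + h).
pose T1 := (alpha (f (x + h)) - alpha (f x)) / h' * ((h' - D x * h) / (h * D x)).
pose T2 := (Dv c1 - Dv x) / D x.
pose T3 := ((D2 c2 - D2 x) * alpha (x + h) + D2 x * (alpha (x + h) - alpha x)) / D x.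
have decomp : (alpha (x + h) - alpha x) / h - (alpha (f (x + h)) - alpha (f x)) / h'
    - phi f v x = T1 - T2 - T3.
  exact: quotient_identity eqx eqh Ev ED.
have xh : `|x + h - x| = `|h| by rewrite [x + h - x]addrC addKr.
have ax : `|alpha (x + h) - alpha x| <= A * t by have := HA (x + h) x; rewrite xh.
have b1 : `|T1| <= A * L `^ eps * M * t.
  have q1 : `|alpha (f (x + h)) - alpha (f x)| <= A * (L `^ eps * t).
    apply: (le_trans (HA _ _)); rewrite ler_wpM2l// /t -powRM//.
    by rewrite powR_ler// (le_trans (fL _ _))// xh.
  have q2 : `|h' - D x * h| <= M * `|h| ^+ 2.
    by rewrite real_normK ?num_real// h'E; exact: taylor2 map_derive DM.
  rewrite /T1 !normrM !normfV !normrM.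
  have q3 : `|h' - D x * h| / (`|h| * `|D x|) <= M * `|h|.
    rewrite ler_pdivrMr ?mulr_gt0 ?(lt_trans ltr01 D1)//.
    apply: (le_trans q2); rewrite expr2 -mulrA ler_wpM2l//.
    by rewrite ler_wpM2l// ler_peMr// ltW.
  have q4 : `|h| / `|h'| <= 1 by rewrite ler_pdivrMr ?mul1r// (lt_le_trans hn).
  apply: (@le_trans _ _ (A * (L `^ eps * t) / `|h'| * (M * `|h|))).
    by rewrite ler_pM ?divr_ge0 ?mulr_ge0// ler_wpM2r// invr_ge0.
  rewrite (_ : _ / _ * _ = A * L `^ eps * M * t * (`|h| / `|h'|)); last by ring.
  by rewrite ler_piMr// !mulr_ge0// powR_ge0.
have b2 : `|T2| <= V * t.
  rewrite /T2 normrM -[leRHS]mulr1 ler_pM// (le_trans (HV _ _))//.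
  by rewrite ler_wpM2l// near.
have b3 : `|T3| <= (E * Ba + Be * A) * t.
  rewrite /T3 normrM -[leRHS]mulr1 ler_pM// (le_trans (ler_normD _ _))//.
  rewrite !normrM mulrDl lerD//.
    by rewrite mulrAC ler_pM// (le_trans (HE _ _))// ler_wpM2l// near.
  by rewrite -mulrA ler_pM.
rewrite decomp; apply: (le_trans (ler_normB _ _)); rewrite mulrDl lerD//.
by apply: (le_trans (ler_normB _ _)); rewrite mulrDl lerD.
Qed.

Definition log_derivative x : R := ln `|D x|.

Lemma ln_lipschitz (a b : R) : 1 < a -> 1 < b -> `|ln a - ln b| <= `|a - b|.
Proof.
wlog ba : a b / b <= a.
  move=> H a1 b1; have [/H ->//|/ltW /H] := leP b a.
  by rewrite distrC [`|b - a|]distrC; exact.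
move=> a1 b1; have b0 := lt_trans ltr01 b1; have a0 := lt_trans ltr01 a1.
rewrite !ger0_norm ?subr_ge0// ?ler_ln ?posrE// -ln_div ?posrE//.
have -> : a / b = 1 + (a - b) / b by field; rewrite gt_eqF.
have ab : 0 <= (a - b) / b by rewrite divr_ge0 ?subr_ge0 ?(ltW b0).
apply: (@le_trans _ _ ((a - b) / b)).
  by apply: le_ln1Dx; rewrite (lt_le_trans _ ab)// ltrN10.
by rewrite ler_pdivrMr// ler_peMr ?subr_ge0// ltW.
Qed.

Lemma log_derivative_gt0 : exists2 k, 0 < k & forall x, k <= log_derivative x.
Proof.
have [lam lam1 Dlam] := f_expanding; exists (ln lam); first exact: ln_gt0.
move=> x; rewrite ler_ln ?posrE ?ltW//; first exact: lt_trans lam1.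
exact: lt_trans (map_D_gt1 x).
Qed.

Lemma hol_log_derivative : hol log_derivative.
Proof.
apply: (@hol_dominated _ _ D _ 1 hol_D) => x y; rewrite mul1r.
apply: (le_trans (ln_lipschitz (map_D_gt1 x) (map_D_gt1 y))).
exact: ler_dist_dist.
Qed.

Lemma log_step : exists2 C, 0 <= C & forall x h, h != 0 -> `|h| <= 1 ->
  `|ln `|f (x + h) - f x| - ln `|h| - log_derivative x| <= C * `|h| `^ eps.
Proof.
have [M M0 DM] := map_D_lip; exists M => // x h h0 h1.
have [c cx E] := MVT_between x (x + h) map_derive.
move: cx E; rewrite [x + h - x]addrC addKr => cx ->.
have hn : 0 < `|h| by rewrite normr_gt0.
have Dn z : 0 < `|D z| by exact: lt_trans (map_D_gt1 z).
rewrite normrM lnM ?posrE// addrK.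
apply: (le_trans (ln_lipschitz (map_D_gt1 c) (map_D_gt1 x))).
apply: (le_trans (ler_dist_dist _ _)); apply: (le_trans (DM _ _)).
rewrite ler_wpM2l// (le_trans cx)// powR_le1//.
by rewrite h1 normr_ge0.
Qed.

Local Notation S := (birkhoff f).
Local Notation gap x h j := (iter j f (x + h) - iter j f x).

Lemma birkhoffSr (g : R -> R) n x : S g n.+1 x = S g n x + g (iter n f x).
Proof. by rewrite /birkhoff big_nat_recr. Qed.

Lemma gap_expand lam x h j : (forall x, lam < `|D x|) ->
  lam * `|gap x h j| <= `|gap x h j.+1|.
Proof. by move=> Dlam; exact: map_expand. Qed.

Lemma gap_neq0 x h j : h != 0 -> gap x h j != 0.
Proof.
move=> h0; elim: j => [|j IH]; first by rewrite /= [x + h - x]addrC addKr.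
rewrite -normr_gt0; apply: lt_le_trans (gap_expand x h j map_D_gt1).
by rewrite mul1r normr_gt0.
Qed.

Lemma error_split (V : comPzRingType) (a b c s p : V) :
  a - c - (s + p) = (a - b - s) + (b - c - p).
Proof. by ring. Qed.

Lemma error_splitr (V : comPzRingType) (a b c s p : V) :
  c - a - (s + p) = (b - a - s) + (c - b - p).
Proof. by ring. Qed.

Lemma error_drop (V : comPzRingType) (a q s : V) : a - s = (a - q - s) + q.
Proof. by ring. Qed.

Lemma subn_succK j n : (j < n)%N -> (n - j.+1 + j = n.-1)%N.
Proof. by lia. Qed.

(** Iterating the two one-step estimates.  Since the gap between the orbits
    expands, the sum of the errors is comparable to its last term. *)
Lemma orbit_sums : exists2 C, 0 <= C & forall x h n, h != 0 ->
  (forall j, (j < n)%N -> `|gap x h j| <= 1) ->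
  `|(alpha (x + h) - alpha x) / h
    - (alpha (iter n f (x + h)) - alpha (iter n f x)) / gap x h n
    - S (phi f v) n x| <= C * \sum_(0 <= j < n) `|gap x h j| `^ eps /\
  `|ln `|gap x h n| - ln `|h| - S log_derivative n x|
    <= C * \sum_(0 <= j < n) `|gap x h j| `^ eps.
Proof.
have [C1 C10 H1] := quotient_step; have [C2 C20 H2] := log_step.
exists (C1 + C2) => [|x h n h0]; first exact: addr_ge0.
elim: n => [|n IH] gap1.
  rewrite !birkhoff0 big_geq//= mulr0 !subr0 [x + h - x]addrC addKr !subrr.
  by rewrite normr0.
have [IH1 IH2] := IH (fun j jn => gap1 j (ltnW jn)).
have g0 := gap_neq0 x n h0; have g1 := gap1 n (ltnSn n).
have E : iter n f x + gap x h n = iter n f (x + h) by rewrite addrC subrK.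
have p0 : 0 <= `|gap x h n| `^ eps := powR_ge0 _ _.
rewrite big_nat_recr//= mulrDr !birkhoffSr; split.
  have := H1 (iter n f x) _ g0 g1 _ erefl; rewrite E => step.
  rewrite (error_split _ ((alpha (iter n f (x + h)) - alpha (iter n f x)) / gap x h n)).
  rewrite (le_trans (ler_normD _ _))// lerD//.
  by rewrite (le_trans step)// ler_wpM2r// lerDl.
have := H2 (iter n f x) _ g0 g1; rewrite E => step.
rewrite (error_splitr _ (ln `|gap x h n|)).
rewrite (le_trans (ler_normD _ _))// lerD//.
by rewrite (le_trans step)// ler_wpM2r// lerDr.
Qed.

(** At the first time [n] at which the orbits of [x] and [x + h] are more than
    1 apart, the difference quotient of [alpha] is a Birkhoff sum of [phi] over
    [n] steps, and [n] is read off the Birkhoff sum of [ln |Df|]. *)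
Lemma quotient_birkhoff : exists C, forall x h, h != 0 -> `|h| <= 1 -> exists n,
  `|(alpha (x + h) - alpha x) / h - S (phi f v) n x| <= C /\
  `|S log_derivative n x + ln `|h| | <= C.
Proof.
have [C C0 H] := orbit_sums; have [lam lam1 Dlam] := f_expanding.
have [L L1 fL] := map_lip; have [B B0 HB] := hol_bounded eps_gt0 hol_alpha.
have lam0 : 0 < lam by exact: lt_trans lam1.
pose th := lam^-1 `^ eps.
have th1 : 0 <= th < 1.
  rewrite powR_ge0/= -[ltRHS](powR1r eps) gt0_ltr_powR ?nnegrE ?invr_ge0 ?ltW//.
  by rewrite invf_lt1.
pose K := C * (1 - th)^-1.
exists (K + B + B + ln L) => x h h0 h1.
have grow j : lam ^+ j * `|h| <= `|gap x h j|.
  elim: j => [|j IH]; first by rewrite expr0 mul1r /= [x + h - x]addrC addKr.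
  apply: le_trans (gap_expand x h j Dlam).
  by rewrite exprS -mulrA ler_pM2l.
have hn : 0 < `|h| by rewrite normr_gt0.
have [m hm] : exists m, 1 < `|gap x h m|.
  have : lam^-1 ^+ j @[j --> \oo] --> (0 : R).
    by apply: cvg_expr; rewrite ger0_norm ?invr_ge0 ?ltW// invf_lt1.
  move=> /(cvgr_lt 0) /(_ _ hn) [m _ Hm]; exists m; apply: lt_le_trans (grow m).
  have := Hm m (leqnn m); rewrite exprVn => /= lt.
  by rewrite -ltr_pdivrMl ?exprn_gt0// mulr1.
have ex : exists m, 1 < `|gap x h m| by exists m.
case: (ex_minnP ex) => n gn min_n {m hm ex}.
have gap1 j : (j < n)%N -> `|gap x h j| <= 1.
  by move=> jn; rewrite leNgt; apply/negP => /min_n; rewrite leqNgt jn.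
have n0 : (0 < n)%N.
  rewrite lt0n; apply/eqP => n0; move: gn; rewrite n0 /= [x + h - x]addrC addKr.
  by rewrite ltNge h1.
(* Read backwards from time [n.-1], when it is at most 1, the gap decays at least
   geometrically. *)
have sum_le : \sum_(0 <= j < n) `|gap x h j| `^ eps <= (1 - th)^-1.
  apply: le_trans (geometric_partial_sum n th1).
  rewrite big_nat_rev/= add0n; rewrite [leLHS]big_nat_cond [leRHS]big_nat_cond.
  apply: ler_sum => j; rewrite andbT => /andP[_ jn].
  rewrite /th -powR_exprn ?invr_ge0 ?(ltW lam0)// powR_ler//.
  have nj1 := subn_succK jn.
  have back i k : lam ^+ k * `|gap x h i| <= `|gap x h (i + k)|.
    elim: k => [|k IH]; first by rewrite expr0 mul1r addn0.
    rewrite addnS; apply: le_trans (gap_expand x h (i + k) Dlam).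
    by rewrite exprS -mulrA ler_pM2l.
  have := back (n - j.+1)%N j; rewrite nj1 => /le_trans /(_ (gap1 _ _)).
  rewrite prednK// => /(_ (leqnn n)).
  by rewrite exprVn -[_^-1]mulr1 ler_pdivlMl ?exprn_gt0.
have [q1 q2] := H x h n h0 gap1.
have CK : C * \sum_(0 <= j < n) `|gap x h j| `^ eps <= K by rewrite ler_wpM2l.
have gnL : `|gap x h n| <= L.
  rewrite -(prednK n0) /= (le_trans (fL _ _))// ler_piMr ?(ltW (lt_trans ltr01 L1))//.
  by apply: gap1; rewrite prednK.
have gp : 0 < `|gap x h n| by exact: lt_trans gn.
have lnL : 0 <= ln `|gap x h n| <= ln L.
  by rewrite ln_ge0 ?(ltW gn)//= ler_ln// posrE// (lt_trans ltr01).
exists n; split.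
  pose q := (alpha (iter n f (x + h)) - alpha (iter n f x)) / gap x h n.
  have qB : `|q| <= B + B.
    rewrite /q normrM normfV ler_pdivrMr// (le_trans (ler_normB _ _))//.
    rewrite (@le_trans _ _ (B + B)) ?lerD// ler_peMr ?addr_ge0//.
    exact: ltW.
  rewrite (error_drop _ q) (le_trans (ler_normD _ _))//.
  have lnL0 : 0 <= ln L by rewrite ln_ge0// ltW.
  by rewrite (le_trans (lerD (le_trans q1 CK) qB))// addrA lerDl.
move: q2 lnL; rewrite !ler_norml => /andP[q3 q4] /andP[l1 l2].
by apply/andP; split; lra.
Qed.

End weierstrass_function.

(** * The given measure is the one with the mixing density *)

Section measure_estimates.
Variables (R : realType) (mu : probability (measurableTypeR R) R).
Implicit Types (g : R -> R) (A : set (measurableTypeR R)).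

Definition mu_mean g : R := \int[mu]_x g x.

Lemma continuous_mfun g : continuous g ->
  measurable_fun setT (g : measurableTypeR R -> R).
Proof. by move=> cg; exact: continuous_measurable_fun. Qed.

Lemma mu_integrable g B : continuous g -> (forall x, `|g x| <= B) ->
  mu.-integrable setT (EFin \o g).
Proof.
move=> cg gB; apply: measurable_bounded_integrable; first exact: measurableT.
- by apply: (le_lt_trans (probability_le1 _ _)) => //; rewrite ltry.
- exact: continuous_mfun.
- exists B; split; first exact: num_real.
  by move=> M BM x _ /=; rewrite (le_trans (gB x))// ltW.
Qed.

Lemma indicator_integrable a b A : measurable A ->
  mu.-integrable setT (EFin \o (fun x => a + b * \1_A x)).
Proof.
move=> mA; apply: measurable_bounded_integrable; first exact: measurableT.
- by apply: (le_lt_trans (probability_le1 _ _)) => //; rewrite ltry.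
- apply: measurable_funD; first exact: measurable_cst.
  apply: measurable_funM; first exact: measurable_cst.
  exact: measurable_indic.
- exists (`|a| + `|b|); split; first exact: num_real.
  move=> M BM x _ /=; rewrite (le_trans _ (ltW BM))// (le_trans (ler_normD _ _))// lerD2l.
  by rewrite normrM ler_piMr// indicE; case: (_ \in _); rewrite ?normr1 ?normr0.
Qed.

Lemma mu_mean_indicator a b A : measurable A ->
  mu_mean (fun x => a + b * \1_A x) = a + b * fine (mu A).
Proof.
move=> mA; rewrite /mu_mean.
have i1 : mu.-integrable setT (EFin \o (fun x => \1_A x)).
  have := indicator_integrable 0 1 mA; apply: eq_integrable => // x _ /=.
  by rewrite add0r mul1r.
rewrite RintegralD//; last 2 first.
- by apply: (@mu_integrable (fun=> a) `|a|) => // ?; exact: cvg_cst.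
- have := indicator_integrable 0 b mA; apply: eq_integrable => // x _ /=.
  by rewrite add0r.
rewrite RintegralZl// Rintegral_cst//.
have -> : fine (mu setT) = 1 by rewrite probability_setT.
by rewrite mulr1 /Rintegral integral_indic// setIT.
Qed.

Lemma mu_mean_le_indicator g B a b A : continuous g -> (forall x, `|g x| <= B) ->
  measurable A -> (forall x, g x <= a + b * \1_A x) ->
  mu_mean g <= a + b * fine (mu A).
Proof.
move=> cg gB mA gA; rewrite -mu_mean_indicator//.
have ig := mu_integrable cg gB; have ii := indicator_integrable a b mA.
by apply: le_Rintegral ig ii _ => // x _; exact: gA.
Qed.

Lemma mu_mean_ge_indicator g B a b A : continuous g -> (forall x, `|g x| <= B) ->
  measurable A -> (forall x, a + b * \1_A x <= g x) ->
  a + b * fine (mu A) <= mu_mean g.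
Proof.
move=> cg gB mA gA; rewrite -mu_mean_indicator//.
have ig := mu_integrable cg gB; have ii := indicator_integrable a b mA.
by apply: le_Rintegral ii ig _ => // x _; exact: gA.
Qed.

Lemma measurable_superlevel g a : continuous g ->
  measurable ([set x | a <= g x] : set (measurableTypeR R)).
Proof.
move=> cg; have := continuous_mfun cg measurableT (measurable_itv `[a, +oo[%R).
rewrite setTI; congr (measurable _); apply/seteqP.
by split => x /=; rewrite in_itv/= andbT.
Qed.

Lemma measurable_sublevel g a : continuous g ->
  measurable ([set x | g x <= a] : set (measurableTypeR R)).
Proof.
move=> cg; have := continuous_mfun cg measurableT (measurable_itv `]-oo, a]%R).
by rewrite setTI.
Qed.

(** Absolute continuity in its epsilon-delta form. *)
Lemma absolutely_continuous_small : mu `<< @lebesgue_measure R ->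
  forall e : R, 0 < e -> exists2 d : R, 0 < d &
  (forall A, measurable A -> (@lebesgue_measure R A < d%:E)%E -> fine (mu A) < e).
Proof.
move=> mu_ac e e0.
pose nu := charge_of_finite_measure mu.
have [P [N PN]] := Hahn_decomposition nu.
have nu_ac : nu `<< @lebesgue_measure R by [].
have [d [d0 Hd]] := charge_variation_continuous PN nu_ac e0.
exists d => // A mA Ad; rewrite -lte_fin fineK ?fin_num_measure//.
apply: le_lt_trans (Hd A mA Ad).
by have := abse_charge_variation PN mA; rewrite /nu /charge_of_finite_measure/= gee0_abs.
Qed.

(** Both sides are the mean of the identity under the push-forward of [mu] to
    the line, by [g] and by [g \o f]; only periodic sets are compared. *)
Lemma mu_mean_invariant (f g : R -> R) B : circle_invariant f mu -> continuous f ->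
    continuous g -> periodic g 1 -> (forall x, `|g x| <= B) ->
  mu_mean (g \o f) = mu_mean g.
Proof.
move=> inv cf cg pg gB.
have cgf : continuous (g \o f) by move=> x; exact: continuous_comp (cf x) (cg (f x)).
have mg := continuous_mfun cg; have mgf := continuous_mfun cgf.
have i1 := mu_integrable cg gB.
have i2 : mu.-integrable setT (EFin \o (g \o f)).
  by apply: (mu_integrable cgf) => x; exact: gB.
rewrite /mu_mean /Rintegral; congr fine.
have mE : measurable_fun setT (EFin : R -> \bar R) by exact: EFin_measurable.
have := integral_pushforward mgf mE i2 measurableT; rewrite preimage_setT => <-.
have := integral_pushforward mg mE i1 measurableT; rewrite preimage_setT => <-.
apply: eq_measure_integral => A mA _ /=; rewrite /pushforward.
rewrite comp_preimage; apply: inv.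
  by rewrite -[X in measurable X]setTI; exact: mg.
by move=> x; rewrite /preimage/= pg.
Qed.

Lemma lebesgue_chebyshev (g : R -> R) a : continuous g -> 0 < a ->
  (@lebesgue_measure R (`[0%R, 1%R] `&` [set x | (a <= `|g x|)%R]) <=
    (a ^- 2 * cint (fun x => g x ^+ 2))%:E)%E.
Proof.
move=> cg a0; have a2 : 0 < a ^+ 2 by rewrite exprn_gt0.
have cg2 : continuous (fun x => g x ^+ 2).
  by move=> x; exact: (cvgM (cg x) (cg x)).
have m01 : measurable (`[0%R, 1%R]%classic : set (measurableTypeR R)).
  exact: measurable_itv.
have mg2 : measurable_fun (`[0%R, 1%R]%classic : set (measurableTypeR R))
    (fun x => (g x ^+ 2)%:E).
  by apply/measurable_EFinP; apply: measurable_funTS; exact: continuous_mfun.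
have := le_integral_abse (@lebesgue_measure R) m01 mg2 a2.
have -> : (\int[@lebesgue_measure R]_(x in `[0%R, 1%R]) `|(g x ^+ 2)%:E| =
    (cint (fun x => g x ^+ 2)%R)%:E)%E.
  rewrite /cint /Rintegral fineK.
    by apply: eq_integral => x _; rewrite /= ger0_norm ?sqr_ge0.
  exact/integrable_fin_num/continuous_integrable.
move=> H; rewrite EFinM lee_pdivlMl//; apply: le_trans H; rewrite lee_pmul2l//.
apply: le_measure; rewrite ?inE.
- apply: measurableI => //; apply: measurable_superlevel => x.
  by apply: cvg_norm; exact: cg.
- apply: measurableI => //; rewrite (_ : [set x | _] = [set x | a ^+ 2 <= g x ^+ 2]).
    exact: measurable_superlevel.
  by apply/seteqP; split => x /=; rewrite lee_fin ger0_norm ?sqr_ge0.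
move=> x [? /=] ag; split=> //=; rewrite lee_fin ger0_norm ?sqr_ge0//.
by rewrite -[g x ^+ 2](real_normK (num_real _)) lerXn2r ?nnegrE// ltW.
Qed.

End measure_estimates.

Section identification.
Variables (R : realType) (eps : R) (f : R -> R) (Lf : R) (rho : R -> R).
Variable mu : probability (measurableTypeR R) R.
Hypotheses (eps_gt0 : 0 < eps) (eps_lt1 : eps < 1).
Hypotheses (f_lift : circle_lift f).
Hypothesis f_lip : forall x y, `|f x - f y| <= Lf * `|x - y|.
Hypothesis f_cont : continuous f.
Hypothesis rho_mixing : mixing_density eps f rho.
Hypotheses (mu_circle : circle_probability mu) (mu_inv : circle_invariant f mu).
Hypothesis mu_ac : mu `<< @lebesgue_measure R.

Local Notation hol := (hol eps).
Local Notation S := (birkhoff f).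
Local Notation E := (rho_mean rho).

Lemma mu_circle_le (A : set (measurableTypeR R)) : measurable A ->
  (mu A <= mu (`[0%R, 1%R] `&` A))%E.
Proof.
move=> mA; have m01 : measurable (`[0%R, 1%R]%classic : set (measurableTypeR R)).
  exact: measurable_itv.
have m01' : measurable (`[0%R, 1%R[%classic : set (measurableTypeR R)).
  exact: measurable_itv.
have mC : measurable (~` `[0%R, 1%R[%classic : set (measurableTypeR R)).
  exact: measurableC.
have muC : mu (~` `[0%R, 1%R[%classic) = 0%E.
  by rewrite probability_setC// mu_circle subee.
apply: (@le_trans _ _ (mu ((`[0%R, 1%R] `&` A) `|` ~` `[0%R, 1%R[%classic))).
  apply: le_measure; rewrite ?inE//.
    by apply: measurableU => //; exact: measurableI.
  move=> x Ax; have [x01|x01] := boolP (x \in `[0%R, 1%R[%R).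
    left; split=> //=; move: x01; rewrite !in_itv/= => /andP[-> x1].
    exact: ltW.
  by right => /=; apply/negP.
have mI : measurable (`[0%R, 1%R] `&` A) by exact: measurableI.
by apply: (le_trans (measureU2 mu mI mC)); rewrite /= muC adde0.
Qed.

Lemma centered_variance g : hol g -> E g = 0 ->
  exists2 K, 0 <= K & forall n, E (fun x => S g n x ^+ 2) <= K * n.+1%:R.
Proof.
move=> hg g0; have hE := md_mean rho_mixing.
have [chi [hchi mart]] := md_gordin rho_mixing hg g0.
set psi := (fun x => _) in mart.
have hchif : hol (fun x => chi (f x)) := hol_lift eps_gt0 f_lift f_lip hchi.
have hpsi : hol psi by apply: hol_add => //; exact: hol_sub.
have cob x : g x = psi x - (chi x - chi (f x)) by rewrite /psi addrK.
have [K K0 HK] := mean_sqr_coboundary eps_gt0 eps_lt1 f_lift f_lip hE hg hchi hpsi mart cob.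
have v0 : 0 <= E (fun x => psi x ^+ 2).
  rewrite -(mean_cst eps_gt0 eps_lt1 hE 0); apply: (mean_le hE).
  - exact: hol_cst.
  - exact: hol_sqr.
  - by move=> x; exact: sqr_ge0.
exists (2 * E (fun x => psi x ^+ 2) + 2 * K) => [|n].
  by rewrite addr_ge0// mulr_ge0.
have := HK n 1 ltr01; rewrite ler_norml => /andP[_].
rewrite invr1 mul1r; move: (E (fun x => psi x ^+ 2)) v0 => v v0.
move: (E (fun x => S g n x ^+ 2)) => w.
have : 0 <= n%:R :> R by []; rewrite -(@natr1 R n); move: (n%:R) => m m0.
by have := mulr_ge0 m0 v0; have := mulr_ge0 m0 K0; nra.
Qed.

(** The Birkhoff sum has mean [n * mu_mean mu g] by invariance.  It exceeds
    [a * n] only on a set of small Lebesgue measure, by Chebyshev's inequality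
    and the variance bound, hence of small [mu]-measure by absolute
    continuity. *)
Lemma mu_mean_zero g : hol g -> E g = 0 -> mu_mean mu g = 0.
Proof.
move=> hg g0; have [K K0 HK] := centered_variance hg g0.
have [B B0 gB] := hol_bounded eps_gt0 hg.
have [r r0 rho_r] := md_gt0 rho_mixing.
have hS n : hol (S g n) by exact: hol_birkhoff.
have cS n : continuous (S g n) by exact: hol_continuous (hS n).
have cg := hol_continuous eps_gt0 hg.
have mean_S n : mu_mean mu (S g n) = n%:R * mu_mean mu g.
  elim: n => [|n IH].
    rewrite mul0r (_ : S g 0 = fun=> 0).
      by rewrite /mu_mean Rintegral_cst//= mul0r.
    by apply/funext => x; rewrite birkhoff0.
  rewrite (_ : S g n.+1 = fun x => g x + S g n (f x)); last first.
    by apply/funext => x; rewrite birkhoffSl.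
  have Sb x : `|S g n (f x)| <= n%:R * B by exact: birkhoff_bound.
  have cSf : continuous (fun x => S g n (f x)).
    by move=> x; exact: continuous_comp (f_cont (x:=x)) (cS n (f x)).
  rewrite /mu_mean RintegralD//; [|exact: mu_integrable gB|exact: mu_integrable Sb].
  have := mu_mean_invariant mu_inv f_cont (cS n) (hol_periodic (hS n))
    (fun x => birkhoff_bound f n x gB).
  rewrite /mu_mean/= => ->; move: IH; rewrite /mu_mean => ->.
  by rewrite -nat1r mulrDl mul1r.
apply/eqP; rewrite -normr_le0; apply/ler_addgt0Pl => e e0; rewrite addr0.
pose a := e / 2; have a0 : 0 < a by rewrite divr_gt0.
have [d d0 Hd] := absolutely_continuous_small mu_ac (divr_gt0 a0 (ltr_wpDl B0 (@ltr01 R))).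
have [n [n0 Hn]] : exists n : nat, (0 < n)%N /\
    (a * n%:R) ^- 2 * (r^-1 * (K * n.+1%:R)) < d.
  have [n nd] : exists n : nat, a ^- 2 * (r^-1 * (2 * K)) / d < n%:R.
    by exists (Num.truncn (a ^- 2 * (r^-1 * (2 * K)) / d)).+1; exact: truncnS_gt.
  have n0 : 0 < n%:R :> R.
    apply: le_lt_trans nd; rewrite !mulr_ge0// ?invr_ge0 ?sqr_ge0// ltW//.
  exists n; split; first by move: n0; rewrite ltr0n.
  apply: (@le_lt_trans _ _ (a ^- 2 * (r^-1 * (2 * K)) / n%:R)).
    rewrite exprMn invfM [leRHS](_ : _ = a ^- 2 * n%:R ^- 2 * (r^-1 * (K * (2 * n%:R)))).
      have q0 : 0 <= a ^- 2 * n%:R ^- 2 by rewrite mulr_ge0// invr_ge0 sqr_ge0.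
      rewrite ler_wpM2l// ler_wpM2l ?invr_ge0 ?(ltW r0)// ler_wpM2l//.
      by rewrite -natrM ler_nat mul2n -addnn -addn1 leq_add2l -(ltr0n R).
    by field; rewrite !gt_eqF.
  by move: nd; rewrite !ltr_pdivrMr// [n%:R * d]mulrC.
have n0' : 0 < n%:R :> R by rewrite ltr0n.
pose A : set (measurableTypeR R) := [set x | a * n%:R <= `|S g n x|].
have mA : measurable A.
  by apply: measurable_superlevel => x; apply: cvg_norm; exact: cS.
have m01 : measurable (`[0%R, 1%R]%classic : set (measurableTypeR R)).
  exact: measurable_itv.
have mI : measurable (`[0%R, 1%R] `&` A) by exact: measurableI.
have muA : fine (mu A) < a / (B + 1).
  apply: (@le_lt_trans _ _ (fine (mu (`[0%R, 1%R] `&` A)))).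
    by apply: fine_le; rewrite ?fin_num_measure//; exact: mu_circle_le.
  apply: Hd => //.
  apply: (le_lt_trans (lebesgue_chebyshev (cS n) (mulr_gt0 a0 n0'))).
  rewrite lte_fin; apply: le_lt_trans Hn; rewrite ler_wpM2l ?invr_ge0 ?sqr_ge0//.
  have hS2 := hol_sqr eps_gt0 (hS n); have cS2 := hol_continuous eps_gt0 hS2.
  have hSr := hol_mul eps_gt0 hS2 (md_hol rho_mixing).
  rewrite ler_pdivlMl// (le_trans _ (HK n))// -(cintZ _ cS2) /rho_mean.
  apply: cint_le => [||x]; last by rewrite mulrC ler_wpM2l ?sqr_ge0.
  - by apply: hol_continuous (hol_scale eps_gt0 eps_lt1 _ hS2).
  - exact: hol_continuous hSr.
have Sb x : `|S g n x| <= n%:R * B by exact: birkhoff_bound.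
have nS x : `|S g n x| <= a * n%:R + (n%:R * B) * \1_A x.
  rewrite indicE; case: (boolP (x \in A)) => [|/negP].
    by rewrite mulr1 => _; rewrite (le_trans (Sb x))// lerDr mulr_ge0// ltW.
  by rewrite inE /A/= mulr0 addr0 => /negP; rewrite -ltNge => /ltW.
have main : n%:R * `|mu_mean mu g| <= a * n%:R + n%:R * B * fine (mu A).
  rewrite -[X in X * `|_|](ger0_norm (ltW n0')) -normrM -mean_S ler_norml.
  apply/andP; split.
    have := @mu_mean_ge_indicator _ mu (S g n) (n%:R * B) (- (a * n%:R)) (- (n%:R * B)) A
      (cS n) Sb mA.
    rewrite mulNr opprD; apply => x; have := nS x; rewrite ler_norml => /andP[+ _].
    by rewrite opprD mulNr.
  apply: (mu_mean_le_indicator mu (cS n) Sb mA) => x.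
  by apply: le_trans (ler_norm _) (nS x).
rewrite -(ler_pM2l n0') (le_trans main)// [e]splitr mulrDr mulrC lerD// -mulrA.
rewrite ler_pM2l//.
have h1 : B * fine (mu A) <= B * (a / (B + 1)) by rewrite ler_wpM2l// ltW.
rewrite (le_trans h1)// mulrCA ler_piMr// ?(ltW a0)// ler_pdivrMr ?mul1r ?lerDl//.
by rewrite ltr_wpDl.
Qed.

Lemma mu_meanE g : hol g -> mu_mean mu g = E g.
Proof.
move=> hg; have hE := md_mean rho_mixing; pose m := E g.
have hc := hol_cst eps_gt0 eps_lt1 m.
have h0 : hol (fun x => g x - m) by exact: hol_sub.
have g0 : E (fun x => g x - m) = 0.
  by rewrite (meanB eps_gt0 eps_lt1 hE hg hc) (mean_cst eps_gt0 eps_lt1 hE) subrr.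
have := mu_mean_zero h0 g0; rewrite /mu_mean.
have [B B0 gB] := hol_bounded eps_gt0 hg.
have ig := mu_integrable mu (hol_continuous eps_gt0 hg) gB.
have ic : mu.-integrable setT (EFin \o (fun=> m)).
  apply: (@mu_integrable _ mu (fun=> m) `|m|) => //.
  exact: cst_continuous.
rewrite (RintegralB measurableT ig ic) Rintegral_cst//.
have -> : fine (mu setT) = 1 by rewrite probability_setT.
by rewrite mulr1 => /eqP; rewrite subr_eq0 => /eqP.
Qed.

End identification.

(** * Birkhoff sums at a random time *)

Section random_time.
Variables (R : realType) (eps : R) (f : R -> R) (Lf : R) (rho : R -> R).
Hypotheses (eps_gt0 : 0 < eps) (eps_lt1 : eps < 1).
Hypotheses (f_lift : circle_lift f).
Hypothesis f_lip : forall x y, `|f x - f y| <= Lf * `|x - y|.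
Hypothesis rho_mixing : mixing_density eps f rho.
Local Notation hol := (hol eps).
Local Notation S := (birkhoff f).
Local Notation E := (rho_mean rho).
Let hE := md_mean rho_mixing.

Lemma increment_variance g : hol g -> E g = 0 ->
  exists2 K, 0 <= K & forall a b D, (a <= b + D)%N -> (b <= a + D)%N ->
    E (fun x => (S g a x - S g b x) ^+ 2) <= K * D.+1%:R.
Proof.
move=> hg g0.
have [K K0 HK] := centered_variance eps_gt0 eps_lt1 f_lift f_lip rho_mixing hg g0.
exists K => // a b D.
wlog ab : a b / (a <= b)%N.
  move=> H aD bD; have [/H|/ltnW /H] := leqP a b; first exact.
  move=> /(_ bD aD); congr (E _ <= _); apply/funext => x.
  by rewrite -sqrrN opprB.
move=> _; rewrite -(subnKC ab); move: (b - a)%N => m; rewrite leq_add2l => mD.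
have -> : (fun x => (S g a x - S g (a + m) x) ^+ 2) =
    (fun x => S g m (iter a f x) ^+ 2).
  by apply/funext => x; rewrite birkhoffD opprD addNKr sqrrN.
have hS : hol (fun x => S g m x ^+ 2) by apply: hol_sqr => //; exact: hol_birkhoff.
have := mean_iter eps_gt0 f_lift f_lip hE a hS => /= ->.
by rewrite (le_trans (HK m))// ler_wpM2l// ler_nat ltnS.
Qed.

(** Birkhoff sums of a function bounded below by a positive [k] grow at least linearly,
    so that the value of the sum determines the time. *)
Lemma birkhoff_gap g k n m x : (forall x, k <= g x) -> 0 <= k ->
  k * `|m%:R - n%:R| <= `|S g m x - S g n x|.
Proof.
move=> kg k0; wlog nm : n m / (n <= m)%N.
  move=> H; have [/H //|/ltnW /H] := leqP n m.
  by rewrite distrC [X in _ -> _ <= X]distrC.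
rewrite -(subnKC nm) birkhoffD natrD [_ + _%:R]addrC addrK.
rewrite [_ + S g _ _]addrC addrK ger0_norm// (le_trans _ (ler_norm _))//.
move: (m - n)%N (iter n f x) => j y; rewrite mulrC.
elim: j y => [|j IH] y; first by rewrite birkhoff0 mul0r.
by rewrite birkhoffSl -nat1r mulrDl mul1r lerD.
Qed.

Lemma sum_sqr_lt1 (I : finType) (F : I -> R) (i : I) :
  \sum_i F i ^+ 2 < 1 -> `|F i| < 1.
Proof.
move=> H; have : F i ^+ 2 < 1.
  apply: le_lt_trans H; rewrite (bigD1 i)//= lerDl sumr_ge0// => j _.
  exact: sqr_ge0.
rewrite -(real_normK (num_real (F i))) => h; rewrite ltNge; apply/negP => h'.
by move: h; rewrite ltNge exprn_ege1.
Qed.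

Lemma mean_sum (I : finType) (F : I -> R -> R) : (forall i, hol (F i)) ->
  E (fun x => \sum_i F i x) = \sum_i E (F i).
Proof.
move=> hF; rewrite /index_enum; elim: (locked_with _ _) => [|i r IH].
  rewrite big_nil -[RHS](mean_cst eps_gt0 eps_lt1 hE 0).
  by congr E; apply/funext => x; rewrite big_nil.
rewrite big_cons -IH -(meanD hE) ?hF//; last by apply: hol_sum => //.
by congr E; apply/funext => x; rewrite big_cons.
Qed.

Lemma mulf_divrA (F : fieldType) (m q d r : F) : m * ((d * r)^-1 * q) = m * q / d / r.
Proof. by rewrite invfM; ring. Qed.

Lemma grid_lower n I p i : (n <= n - I * p + i * p + I.*2 * p)%N.
Proof.
rewrite -addnn mulnDl; move: (I * p)%N (i * p)%N => u v.
by lia.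
Qed.

Lemma grid_window n N I p : (N <= n + I * p)%N -> (n <= N + I * p)%N ->
  (n - I * p <= N)%N /\ (N - (n - I * p) <= I.*2 * p)%N.
Proof. by rewrite -addnn mulnDl; move: (I * p)%N => u; lia. Qed.

(** Anscombe's theorem.  A time [N] at which the Birkhoff sum of [xi] is within
    [c1] of its mean at time [n] differs from [n] by [O(sqrt n)], with
    probability close to 1.  Such a window contains a bounded number of points
    of a grid of mesh a small multiple of [sqrt n]: within one mesh the sum of
    [phi] moves little because [phi] is bounded, and at the grid points
    Chebyshev's inequality applies.  [F] is the sum of the squares that have to
    be small. *)
Lemma random_time phi xi L k c1 eta e :
    hol phi -> E phi = 0 -> hol xi -> E xi = L -> 0 < k -> (forall x, k <= xi x) ->
    0 <= c1 -> 0 < eta -> 0 < e ->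
  exists n0, forall n, (n0 <= n)%N -> exists F, [/\ hol F, forall x, 0 <= F x,
    E F <= e & forall x, F x < 1 -> `|S phi n x| <= eta * n%:R /\
      forall N, `|S xi N x - n%:R * L| <= c1 ->
        `|S phi N x - S phi n x| <= eta * Num.sqrt n%:R].
Proof.
move=> hphi phi0 hxi xiL k0 kxi c10 eta0 e0.
have hxi0 : hol (fun x => xi x - L) by apply: hol_sub => //; exact: hol_cst.
have xi0 : E (fun x => xi x - L) = 0.
  rewrite (meanB eps_gt0 eps_lt1 hE)//; last exact: hol_cst.
  by rewrite (mean_cst eps_gt0 eps_lt1 hE) xiL subrr.
have [K1 K10 HK1] := centered_variance eps_gt0 eps_lt1 f_lift f_lip rho_mixing hxi0 xi0.
have [K2 K20 HK2] := increment_variance hphi phi0.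
have [B B0 phiB] := hol_bounded eps_gt0 hphi.
(* In units of [sqrt n]: [a] bounds the fluctuation of the sum of [xi], [w] the
   half-width of the window of times, [c0] is the mesh of the grid.  The grid has
   [2 * I + 1] points, and [Z] collects the lower bounds required of [sqrt n]. *)
pose a := 6 * K1 / e + 1; pose w := (c1 + a) / k; pose c0 := eta / (4 * (B + 1)).
have a1 : 1 <= a by rewrite lerDr divr_ge0 ?mulr_ge0 ?(ltW e0).
have B1 : 0 < B + 1 by rewrite ltr_wpDl.
have c00 : 0 < c0 by rewrite divr_gt0// mulr_gt0.
pose I := (Num.truncn (w / c0)).+1.
have wI : w / c0 < I%:R by exact: truncnS_gt.
pose Z := 4 * B / eta + (I.*2.+1)%:R * (K2 * (2 * I%:R * (c0 + 1) + 1)) / (eta / 2) ^+ 2 * 3 / e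
  + K2 * 2 / eta ^+ 2 * 3 / e + 1.
exists (Num.truncn (Z ^+ 2)).+1 => n nZ.
have Zn : Z ^+ 2 < n%:R by apply: lt_le_trans (truncnS_gt _) _; rewrite ler_nat.
have I0 : 0 <= I%:R :> R by [].
have z1 : 0 <= 4 * B / eta by rewrite divr_ge0 ?mulr_ge0 ?(ltW eta0).
have z2 : 0 <= (I.*2.+1)%:R * (K2 * (2 * I%:R * (c0 + 1) + 1)) / (eta / 2) ^+ 2 * 3 / e.
  rewrite divr_ge0 ?(ltW e0)// mulr_ge0// divr_ge0 ?sqr_ge0// mulr_ge0//.
  by rewrite mulr_ge0// addr_ge0// mulr_ge0// addr_ge0// ltW.
have z3 : 0 <= K2 * 2 / eta ^+ 2 * 3 / e.
  by rewrite divr_ge0 ?(ltW e0)// mulr_ge0// divr_ge0 ?sqr_ge0// mulr_ge0.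
have Z1 : 1 <= Z by rewrite /Z; lra.
have n0 : (0 < n)%N by exact: leq_trans nZ.
set rt := Num.sqrt n%:R.
have rt2 : rt ^+ 2 = n%:R by rewrite sqr_sqrtr.
have Zrt : Z <= rt.
  rewrite -(@ler_pXn2r _ 2) ?nnegrE ?sqrtr_ge0// ?rt2 ?ltW//.
  exact: lt_le_trans ltr01 Z1.
have rt1 : 1 <= rt := le_trans Z1 Zrt.
have rt0 : 0 < rt := lt_le_trans ltr01 rt1.
pose p := (Num.truncn (c0 * rt)).+1.
have p1 : c0 * rt < p%:R by exact: truncnS_gt.
have p2 : p%:R <= c0 * rt + 1.
  by rewrite /p -natr1 lerD2r truncn_le// mulr_ge0 ?(ltW c00) ?(ltW rt0).
pose b0 := (n - I * p)%N.
pose G (i : 'I_(I.*2.+1)) x := (S phi (b0 + i * p) x - S phi n x) / (eta / 2 * rt).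
pose G1 x := S (fun x => xi x - L) n x / (a * rt).
pose G2 x := S phi n x / (eta * n%:R).
pose F x := \sum_i G i x ^+ 2 + (G1 x ^+ 2 + G2 x ^+ 2).
have hS j g : hol g -> hol (S g j) by exact: hol_birkhoff.
have hdiv g c : hol g -> hol (fun x => g x / c).
  by move=> hg; apply: hol_mul => //; exact: hol_cst.
have hdiff i : hol (fun x => S phi (b0 + nat_of_ord i * p) x - S phi n x).
  by apply: hol_sub => //; exact: hS.
have hG i : hol (fun x => G i x ^+ 2) by apply: hol_sqr => //; exact: hdiv.
have hG1 : hol (fun x => G1 x ^+ 2) by apply: hol_sqr => //; apply: hdiv; exact: hS.
have hG2 : hol (fun x => G2 x ^+ 2) by apply: hol_sqr => //; apply: hdiv; exact: hS.
have hsG : hol (fun x => \sum_i G i x ^+ 2) by apply: hol_sum.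
have h12 : hol (fun x => G1 x ^+ 2 + G2 x ^+ 2) by exact: hol_add.
have E_div g c : hol g -> E (fun x => (g x / c) ^+ 2) = c ^- 2 * E (fun x => g x ^+ 2).
  move=> hg; rewrite -(meanZ hE _ (hol_sqr eps_gt0 hg)); congr E.
  by apply/funext => x; rewrite exprMn exprVn mulrC.
have nlb : 1 <= n%:R :> R by rewrite ler1n.
have eta0' := ltW eta0.
exists F; split.
- exact: hol_add.
- move=> x; rewrite /F addr_ge0 ?addr_ge0 ?sqr_ge0// sumr_ge0// => i _.
  exact: sqr_ge0.
- rewrite /F (meanD hE)// (meanD hE)// mean_sum//.
  have eG : \sum_i E (fun x => G i x ^+ 2) <= e / 3.
    apply: (@le_trans _ _ (\sum_(i < I.*2.+1)
        ((eta / 2) ^+ 2 * rt)^-1 * (K2 * (2 * I%:R * (c0 + 1) + 1)))).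
      apply: ler_sum => i _; rewrite E_div//.
      have iI : (i <= I.*2)%N by rewrite -ltnS.
      have d1 : (b0 + i * p <= n + I.*2 * p)%N.
        by rewrite leq_add ?leq_subr// leq_mul.
      have d2 : (n <= b0 + i * p + I.*2 * p)%N.
        exact: grid_lower.
      rewrite (_ : (eta / 2 * rt) ^- 2 = ((eta / 2) ^+ 2 * rt)^-1 * rt^-1); last first.
        by rewrite -invfM; congr (_^-1); ring.
      have q0 : 0 <= ((eta / 2) ^+ 2 * rt)^-1.
        by rewrite invr_ge0 mulr_ge0 ?sqr_ge0// ltW.
      rewrite -[X in X <= _]mulrA; apply: (ler_wpM2l q0).
      rewrite ler_pdivrMl// (le_trans (HK2 _ _ _ d1 d2))// mulrCA ler_wpM2l//.
      rewrite -natr1 natrM -muln2 natrM.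
      apply: (@le_trans _ _ (I%:R * 2 * (c0 * rt + 1) + 1)).
        by rewrite lerD2r ler_wpM2l// mulr_ge0.
      have : I%:R * 1 <= I%:R * rt by rewrite ler_wpM2l.
      by move: rt1; move: (I%:R * rt) => q; nra.
    rewrite sumr_const card_ord -[X in X <= _]mulr_natl.
    rewrite mulf_divrA.
    rewrite ler_pdivrMr// [_ * rt]mulrAC ler_pdivlMr// mulrC -ler_pdivrMl// mulrC.
    by apply: le_trans Zrt; rewrite /Z; move: z1 z2 z3; lra.
  have eG1 : E (fun x => G1 x ^+ 2) <= e / 3.
    rewrite E_div; last exact: hS.
    have a0 : 0 < a := lt_le_trans ltr01 a1.
    rewrite ler_pdivrMl ?exprn_gt0 ?mulr_gt0// (le_trans (HK1 n))// exprMn rt2.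
    have A1 : 6 * K1 <= a * e.
      have -> : a * e = 6 * K1 + e by rewrite /a; field; rewrite gt_eqF.
      by rewrite lerDl ltW.
    have A2 : a * e <= a ^+ 2 * e by rewrite ler_pM2r// expr2 ler_peMr// ltW.
    rewrite -(@natr1 R n).
    apply: (@le_trans _ _ (K1 * (2 * n%:R))); first by rewrite ler_wpM2l//; lra.
    rewrite (_ : _ * (e / 3) = (a ^+ 2 * e / 3) * n%:R); last by ring.
    by rewrite mulrA ler_wpM2r//; lra.
  have eG2 : E (fun x => G2 x ^+ 2) <= e / 3.
    rewrite E_div; last exact: hS.
    have hn : E (fun x => S phi n x ^+ 2) <= K2 * n.+1%:R.
      have := HK2 n 0%N n; rewrite add0n => /(_ (leqnn n) (leq0n _)).
      by under eq_fun do rewrite birkhoff0 subr0.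
    rewrite ler_pdivrMl ?exprn_gt0 ?mulr_gt0 ?ltr0n// (le_trans hn)//.
    have zr : K2 * 2 / eta ^+ 2 * 3 / e <= n%:R.
      apply: (@le_trans _ _ rt); last by rewrite -rt2 expr2 ler_peMr// ltW.
      by apply: le_trans Zrt; rewrite /Z; move: z1 z2 z3; lra.
    have zr2 : K2 * 2 * 3 <= n%:R * e * eta ^+ 2.
      rewrite -ler_pdivrMr ?exprn_gt0// -ler_pdivrMr//.
      by apply: le_trans zr; rewrite le_eqVlt; apply/orP; left; apply/eqP; ring.
    rewrite -(@natr1 R n) exprMn.
    apply: (@le_trans _ _ (K2 * (2 * n%:R))); first by rewrite ler_wpM2l//; lra.
    rewrite (_ : _ * (e / 3) = (n%:R * e * eta ^+ 2 / 3) * n%:R); last by ring.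
    by rewrite mulrA ler_wpM2r//; lra.
  by move: eG eG1 eG2; lra.
move=> x F1.
have sG0 : 0 <= \sum_i G i x ^+ 2 by rewrite sumr_ge0// => i _; exact: sqr_ge0.
have s1 := sqr_ge0 (G1 x); have s2 := sqr_ge0 (G2 x).
have sG1 : \sum_i G i x ^+ 2 < 1 by move: F1; rewrite /F; lra.
have unit_sqr (y : R) : y ^+ 2 < 1 -> `|y| < 1.
  move=> y1; rewrite ltNge; apply/negP => h'; move: y1.
  by rewrite -(real_normK (num_real y)) ltNge exprn_ege1.
split.
  have : `|G2 x| < 1 by apply: unit_sqr; move: F1; rewrite /F; lra.
  rewrite /G2 normrM normfV ltr_pdivrMr ?normr_gt0 ?mulf_neq0 ?gt_eqF// ?ltr0n//.
  by rewrite mul1r => /ltW; rewrite [X in _ <= X]ger0_norm// mulr_ge0.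
move=> N HN.
have xin : `|S (fun x => xi x - L) n x| <= a * rt.
  have : `|G1 x| < 1 by apply: unit_sqr; move: F1; rewrite /F; lra.
  have art : 0 < a * rt by rewrite mulr_gt0// (lt_le_trans ltr01 a1).
  by rewrite /G1 normrM normfV (gtr0_norm art) ltr_pdivrMr// mul1r => /ltW.
have SxiE : S (fun x => xi x - L) n x = S xi n x - n%:R * L.
  rewrite -(birkhoff_cst f L n x) -[X in _ = _ + X]mulN1r -birkhoff_linear.
  apply: eq_bigr => i _.
  by rewrite mulN1r.
have Nn : `|N%:R - n%:R| <= w * rt.
  have := birkhoff_gap n N x kxi (ltW k0).
  have H3 : `|S xi N x - S xi n x| <= c1 + a * rt.
    rewrite (_ : _ - _ = (S xi N x - n%:R * L) - (S xi n x - n%:R * L)); last by ring.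
    by rewrite (le_trans (ler_normB _ _))// -SxiE lerD.
  move=> /le_trans /(_ H3); rewrite mulrC -ler_pdivlMr// => /le_trans; apply.
  rewrite /w [X in _ <= X](_ : _ = (c1 * rt + a * rt) / k); last by ring.
  by rewrite ler_pM2r ?invr_gt0// lerD2r ler_peMr.
have wIp : w * rt <= (I * p)%:R.
  rewrite natrM; apply: (@le_trans _ _ (I%:R * (c0 * rt))).
    by rewrite mulrA ler_wpM2r ?(ltW rt0)// -ler_pdivrMr// ltW.
  by rewrite ler_wpM2l// ltW.
have Nup : (N <= n + I * p)%N.
  rewrite -(ler_nat R) natrD -lerBlDl (le_trans (ler_norm _))//.
  exact: le_trans Nn wIp.
have Nlo : (n <= N + I * p)%N.
  rewrite -(ler_nat R) natrD -lerBlDl (le_trans (ler_norm _))// distrC.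
  exact: le_trans Nn wIp.
have [b0N Nb0] : (b0 <= N)%N /\ (N - b0 <= I.*2 * p)%N.
  exact: grid_window.
have p0 : (0 < p)%N by [].
pose i := ((N - b0) %/ p)%N; pose r := ((N - b0) %% p)%N.
have iI : (i < I.*2.+1)%N.
  by rewrite /i ltn_divLR// mulSn (leq_ltn_trans Nb0)// -[X in (X < _)%N]add0n ltn_add2r.
have rp : (r <= p)%N by rewrite ltnW// /r ltn_pmod.
have NE : N = (b0 + i * p + r)%N by rewrite -addnA -divn_eq subnKC.
have grid : `|S phi (b0 + i * p) x - S phi n x| <= eta / 2 * rt.
  have := @sum_sqr_lt1 _ (G^~ x) (Ordinal iI) sG1.
  have ert : 0 < eta / 2 * rt by rewrite mulr_gt0// divr_gt0.
  by rewrite /G normrM normfV (gtr0_norm ert) ltr_pdivrMr// mul1r => /ltW.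
have mesh : `|S phi N x - S phi (b0 + i * p) x| <= eta / 2 * rt.
  rewrite [in S phi N x]NE birkhoffD [X in `|X|]addrC addKr.
  rewrite (le_trans (birkhoff_bound _ _ _ phiB))//.
  have rB : r%:R * B <= (c0 * rt + 1) * B.
    by rewrite ler_wpM2r// (le_trans _ p2)// ler_nat.
  apply: (le_trans rB).
  have h1 : c0 * B <= eta / 4.
    rewrite /c0 mulrAC ler_pdivrMr ?mulr_gt0//.
    rewrite (_ : eta / 4 * (4 * (B + 1)) = eta * (B + 1)); last by field.
    by rewrite ler_pM2l// lerDl.
  have h2 : B <= eta / 4 * rt.
    have : 4 * B / eta <= rt by apply: le_trans Zrt; rewrite /Z; move: z1 z2 z3; lra.
    by rewrite ler_pdivrMr// => h; move: h; lra.
  have h3 : c0 * B * rt <= eta / 4 * rt by rewrite ler_wpM2r// ltW.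
  by rewrite mulrDl mul1r mulrAC; move: h2 h3; lra.
rewrite (_ : _ - _ = (S phi N x - S phi (b0 + i * p) x)
  + (S phi (b0 + i * p) x - S phi n x)); last by ring.
rewrite (le_trans (ler_normD _ _))// (le_trans (lerD mesh grid))//.
by rewrite -mulrDl -splitr.
Qed.

End random_time.

(** * The asymptotic variance *)

Section asymptotic_variance.
Variables (R : realType) (eps : R) (f : R -> R) (Lf : R) (rho : R -> R).
Variable mu : probability (measurableTypeR R) R.
Hypotheses (eps_gt0 : 0 < eps) (eps_lt1 : eps < 1).
Hypotheses (f_lift : circle_lift f).
Hypothesis f_lip : forall x y, `|f x - f y| <= Lf * `|x - y|.
Hypothesis f_cont : continuous f.
Hypothesis rho_mixing : mixing_density eps f rho.
Hypotheses (mu_circle : circle_probability mu) (mu_inv : circle_invariant f mu).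
Hypothesis mu_ac : mu `<< @lebesgue_measure R.
Local Notation hol := (hol eps).
Local Notation S := (birkhoff f).
Local Notation E := (rho_mean rho).
Let hE := md_mean rho_mixing.

Let variance_seq (g : R -> R) (n : nat) : R :=
  \int[mu]_x (((\sum_(0 <= j < n.+1) g (iter j f x)) / Num.sqrt n%:R) ^+ 2).

Let variance_seqE g n : hol g ->
  variance_seq g n = n%:R^-1 * E (fun x => S g n.+1 x ^+ 2).
Proof.
move=> hg; have hS : hol (S g n.+1) by exact: hol_birkhoff.
have hS2 := hol_sqr eps_gt0 hS.
have hSn : hol (fun x => (S g n.+1 x / Num.sqrt n%:R) ^+ 2).
  by apply: hol_sqr => //; apply: hol_mul => //; exact: hol_cst.
have := mu_meanE eps_gt0 eps_lt1 f_lift f_lip f_cont rho_mixing mu_circle mu_inv mu_ac hSn.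
rewrite /mu_mean /variance_seq => ->; rewrite -(meanZ hE _ hS2).
by congr E; apply/funext => x; rewrite exprMn exprVn sqr_sqrtr// mulrC.
Qed.

(** A nonzero mean makes the variance sequence diverge linearly. *)
Let variance_seq_lower g n : hol g -> n%:R * E g ^+ 2 <= variance_seq g n.
Proof.
move=> hg; rewrite variance_seqE//; set m := E g.
have hS : hol (S g n.+1) by exact: hol_birkhoff.
have hS2 := hol_sqr eps_gt0 hS.
have mean_S k : E (S g k) = k%:R * m.
  elim: k => [|k IH].
    rewrite mul0r -[RHS](mean_cst eps_gt0 eps_lt1 hE 0).
    by congr E; apply/funext => x; rewrite birkhoff0.
  have hk : hol (S g k) by exact: hol_birkhoff.
  have hkf : hol (fun x => S g k (f x)) := hol_lift eps_gt0 f_lift f_lip hk.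
  rewrite -nat1r mulrDl mul1r -IH -(mean_inv hE hk) -(meanD hE hg hkf).
  by congr E; apply/funext => x; rewrite birkhoffSl.
pose c := n.+1%:R * m.
have jensen : c ^+ 2 <= E (fun x => S g n.+1 x ^+ 2).
  have h1 : hol (fun x => 2 * c * S g n.+1 x - c ^+ 2).
    by apply: hol_sub => //; [exact: hol_scale|exact: hol_cst].
  have -> : c ^+ 2 = E (fun x => 2 * c * S g n.+1 x - c ^+ 2).
    rewrite (meanB eps_gt0 eps_lt1 hE)//; [|exact: hol_scale|exact: hol_cst].
    rewrite (meanZ hE _ hS) mean_S -/c (mean_cst eps_gt0 eps_lt1 hE); ring.
  apply: (mean_le hE) => // x; rewrite -subr_ge0.
  rewrite (_ : _ - _ = (S g n.+1 x - c) ^+ 2) ?sqr_ge0//; ring.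
case: n @c hS hS2 jensen => [|n] c hS hS2 jensen.
  by rewrite mul0r invr0 mul0r.
have n0 : 0 < n.+1%:R :> R by rewrite ltr0n.
rewrite ler_pdivlMl// (le_trans _ jensen)// /c exprMn mulrA ler_wpM2r ?sqr_ge0//.
by rewrite -expr2 lerXn2r ?nnegrE// ler_nat.
Qed.

(** As [sigma] is read off a limit whose default value is [0], being nonzero
    means that the limit exists and is positive.  Its finiteness forces the mean
    of [g] to vanish, and then the coboundary in Gordin's decomposition does not
    contribute to it. *)
Lemma sigma_gordin g : hol g -> sigma mu f g != 0 -> E g = 0 /\
  exists psi chi, [/\ hol psi /\ hol chi, reverse_martingale eps f E psi,
    forall x, g x = psi x - (chi x - chi (f x)), 0 < sigma mu f g &
    E (fun x => psi x ^+ 2) = sigma mu f g ^+ 2].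
Proof.
move=> hg; rewrite /sigma -/(variance_seq g).
set s := limn _ => s0.
have s_gt0 : 0 < s by rewrite -sqrtr_gt0 lt_neqAle eq_sym s0 sqrtr_ge0.
have cvg_s : cvgn (variance_seq g).
  apply: contrapT => /dvgP lim0; move: s_gt0.
  by rewrite /s lim0 ltxx.
have cs : variance_seq g @ \oo --> s := cvg_s.
have g0 : E g = 0.
  apply/eqP/negPn/negP => m0.
  have m2 : 0 < E g ^+ 2 by rewrite exprn_even_gt0.
  have [n [n1 n2]] : exists n : nat, variance_seq g n <= s + 1 /\
      (s + 1) / E g ^+ 2 < n%:R.
    near \oo => n; exists n; split.
      by near: n; apply: (cvgr_le _ cs); rewrite ltrDl.
    apply: (lt_le_trans (truncnS_gt _)); rewrite ler_nat.
    by near: n; exact: nbhs_infty_ge.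
  have := le_trans (variance_seq_lower n hg) n1.
  by rewrite leNgt -ltr_pdivrMr// n2.
split=> //; have [chi [hchi mart]] := md_gordin rho_mixing hg g0.
set psi := (fun x => _) in mart.
have hchif : hol (fun x => chi (f x)) := hol_lift eps_gt0 f_lift f_lip hchi.
have hpsi : hol psi by apply: hol_add => //; exact: hol_sub.
have cob x : g x = psi x - (chi x - chi (f x)) by rewrite /psi addrK.
exists psi, chi; split=> //; first by rewrite lt_neqAle eq_sym s0 sqrtr_ge0.
have [K K0 HK] := mean_sqr_coboundary eps_gt0 eps_lt1 f_lift f_lip hE hg hchi hpsi mart cob.
rewrite sqr_sqrtr ?ltW//; set v := E (fun x => psi x ^+ 2) in HK *.
have v0 : 0 <= v.
  rewrite -(mean_cst eps_gt0 eps_lt1 hE 0); apply: (mean_le hE).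
  - exact: hol_cst.
  - exact: hol_sqr.
  - by move=> x; exact: sqr_ge0.
suff cv : variance_seq g @ \oo --> v by exact: cvg_unique cv cs.
apply/cvgrPdist_le => e e0.
pose d := e / (4 * (v + 1)).
have v1 : 0 < v + 1 by rewrite ltr_wpDl.
have d0 : 0 < d by rewrite divr_gt0// mulr_gt0.
near=> n.
have n0 : (0 < n)%N by near: n; exact: nbhs_infty_gt.
have n0' : 0 < n%:R :> R by rewrite ltr0n.
have nb : 2 * ((1 + d^-1) * K + v) / e <= n%:R by near: n; exact: nbhs_infty_ger.
rewrite variance_seqE// distrC; have := HK n.+1 d d0.
move: (E (fun x => S g n.+1 x ^+ 2)) => w Hw.
have -> : n%:R^-1 * w - v = n%:R^-1 * ((w - n.+1%:R * v) + v).
  by rewrite -(@natr1 R n); field; rewrite gt_eqF.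
rewrite normrM ger0_norm ?invr_ge0// ler_pdivrMl//.
rewrite (le_trans (ler_normD _ _))// (ger0_norm v0).
apply: (le_trans (lerD Hw (lexx v))).
have n1 : n.+1%:R <= 2 * n%:R :> R.
  by rewrite -natrM ler_nat mul2n -addnn -addn1 leq_add2l.
have dv : d * (n.+1%:R * v) <= e / 2 * n%:R.
  apply: (@le_trans _ _ (d * (2 * n%:R * v))).
    by apply: (ler_wpM2l (ltW d0)); rewrite ler_wpM2r.
  rewrite (_ : d * _ = (2 * d * v) * n%:R); last by ring.
  rewrite ler_wpM2r// /d.
  rewrite (_ : _ * _ * v = e / 2 * (v / (v + 1))); last by field; rewrite gt_eqF.
  by rewrite ler_piMr ?divr_ge0 ?(ltW e0)// ler_pdivrMr// mul1r lerDl.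
have rest : (1 + d^-1) * K + v <= e / 2 * n%:R.
  move: nb; rewrite ler_pdivrMr// => nb.
  by move: nb; move: ((1 + d^-1) * K + v) => q; rewrite [n%:R * e]mulrC; lra.
move: dv rest; move: (d * _) ((1 + d^-1) * K) => p q; lra.
Unshelve. all: by end_near. Qed.

End asymptotic_variance.

(** * The central limit theorem for the difference quotient *)

Lemma inverse_sqrt_gap (R : realType) (u : R) (n : nat) : (0 < n)%N ->
    n%:R <= u ^+ 2 -> u ^+ 2 <= n.+1%:R -> 0 < u ->
  `|u^-1 - (Num.sqrt n%:R)^-1| <= n%:R^-1.
Proof.
move=> n0 nu un u0.
have n1 : 1 <= n%:R :> R by rewrite ler1n.
have r2 : Num.sqrt n%:R ^+ 2 = n%:R :> R by rewrite sqr_sqrtr.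
have r1 : 1 <= Num.sqrt n%:R :> R by rewrite -[leLHS]sqrtr1 ler_wsqrtr.
move: (Num.sqrt n%:R) r2 r1 => r r2 r1; have r0 := lt_le_trans ltr01 r1.
have ru : r <= u by rewrite -(@ler_pXn2r _ 2) ?nnegrE ?(ltW r0) ?(ltW u0)// r2.
rewrite distrC ger0_norm; last by rewrite subr_ge0 lef_pV2 ?posrE.
have -> : r^-1 - u^-1 = (u - r) / (r * u) by field; rewrite !gt_eqF.
rewrite ler_pdivrMr ?mulr_gt0// ler_pdivlMl ?ltr0n//.
have h1 : u - r <= 1.
  have : (u - r) * (u + r) <= 1.
    rewrite (_ : _ * _ = u ^+ 2 - r ^+ 2); last by ring.
    by rewrite r2 lerBlDr nat1r.
  by apply: le_trans; rewrite ler_peMr ?subr_ge0//; lra.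
apply: (@le_trans _ _ (n%:R * 1)); first by rewrite ler_wpM2l.
by rewrite mulr1 -r2 expr2 ler_pM2l.
Qed.

Section difference_quotient.
Variables (R : realType) (eps : R) (f v : R -> R).
Variable mu : probability (measurableTypeR R) R.
Hypotheses (eps_gt0 : 0 < eps) (eps_lt1 : eps < 1).
Hypotheses (f_lift : circle_lift f) (f_C2 : C_holder 2 eps f).
Hypothesis f_expanding : expanding f.
Hypotheses (v_periodic : periodic v 1) (v_C1 : C_holder 1 eps v).
Hypotheses (mu_circle : circle_probability mu) (mu_inv : circle_invariant f mu).
Hypothesis mu_ac : mu `<< @lebesgue_measure R.
Hypothesis sigma_neq0 : sigma mu f (phi f v) != 0.

Local Notation hol := (hol eps).
Local Notation S := (birkhoff f).
Local Notation alpha := (gen_weierstrass f v).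
Local Notation sg := (sigma mu f (phi f v)).
Local Notation Lam := (lyapunov mu f).

Definition normalized_quotient h x : R :=
  (alpha (x + h) - alpha x) / (sg * ell mu f * h * Num.sqrt (- ln `|h|)).
Local Notation Q := normalized_quotient.

Lemma hol_quotient h : hol (Q h).
Proof.
have ha := hol_alpha eps_gt0 eps_lt1 f_lift f_C2 f_expanding v_periodic v_C1.
rewrite /Q; move: (gen_weierstrass f v) ha => g hg.
move: (_ * _ * _ * _) => c.
have hgh : hol (fun x => g (x + h)).
  split; first by move=> x /=; rewrite addrAC (hol_periodic hg).
  have [C C0 HC] := holP hg; exists C => x y.
  by apply: (le_trans (HC _ _)); rewrite opprD addrACA subrr addr0.
exact: (hol_mul eps_gt0 (hol_sub eps_gt0 eps_lt1 hgh hg) (hol_cst eps_gt0 eps_lt1 _)).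
Qed.

Section with_density.
Variables (rho : R -> R) (Lf : R).
Hypothesis rho_mixing : mixing_density eps f rho.
Hypothesis f_lip : forall x y, `|f x - f y| <= Lf * `|x - y|.
Local Notation E := (rho_mean rho).
Let hE := md_mean rho_mixing.

Let f_cont : continuous f.
Proof. by move=> x; exact: is_derive_continuous (map_derive f_C2 x). Qed.

Let muE g : hol g -> mu_mean mu g = E g.
Proof.
exact: (mu_meanE eps_gt0 eps_lt1 f_lift f_lip f_cont rho_mixing mu_circle mu_inv mu_ac).
Qed.

Let hphi : hol (phi f v).
Proof. exact: hol_phi. Qed.

Let hxi : hol (log_derivative f).
Proof. exact: (hol_log_derivative eps_gt0 eps_lt1 f_lift f_C2 f_expanding). Qed.

Lemma lyapunovE : E (log_derivative f) = Lam.
Proof. by rewrite -muE. Qed.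

Lemma lyapunov_gt0 : 0 < Lam.
Proof.
have [k k0 kxi] := log_derivative_gt0 f_expanding.
apply: (lt_le_trans k0); rewrite -lyapunovE -(mean_cst eps_gt0 eps_lt1 hE k).
by apply: (mean_le hE) => //; exact: hol_cst.
Qed.

(** The difference quotient is within a constant of the Birkhoff sum of
    [phi f v] at the time at which the sum of [log_derivative f] reaches
    [T = - ln `|h|].  That time is close to the integer part [n] of [T / Lam], and
    the normalization [sqrt (T / Lam)] is close to [sqrt n].  The set [F >= 1],
    of small measure, is where the random time fails to be close to [n]. *)
Lemma quotient_close psi chi (n1 : nat) (eta e : R) :
    hol psi -> hol chi -> (forall x, phi f v x = psi x - (chi x - chi (f x))) ->
    0 < sg -> E (phi f v) = 0 -> 0 < eta -> 0 < e ->
  \forall h \near (0 : R)^', exists n F, [/\ (n1 <= n)%N, hol F,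
    forall x, 0 <= F x, E F <= e &
    forall x, F x < 1 -> `|Q h x - S psi n x / sg / Num.sqrt n%:R| <= eta].
Proof.
move=> hpsi hchi cob sg0 phi0 eta0 e0.
have [C HC] := quotient_birkhoff eps_gt0 eps_lt1 f_lift f_C2 f_expanding v_periodic v_C1.
have C0 : 0 <= C.
  have h1 : `|1 : R| <= 1 by rewrite normr1.
  by have [n [+ _]] := HC 0 1 (oner_neq0 R) h1; exact: le_trans.
have [k k0 kxi] := log_derivative_gt0 f_expanding.
have Lam0 := lyapunov_gt0.
have [B B0 chiB] := hol_bounded eps_gt0 hchi.
pose eta' := eta * sg / 4.
have eta'0 : 0 < eta' by rewrite divr_gt0// mulr_gt0.
have c10 : 0 <= C + Lam by rewrite addr_ge0// ltW.
have [n0 Hn0] := random_time eps_gt0 eps_lt1 f_lift f_lip rho_mixing hphi phi0 hxi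
  lyapunovE k0 kxi c10 eta'0 e0.
(* Once [sqrt n] exceeds [Z], the errors bounded independently of [n] fill at
   most half of [eta * sg]; the fluctuation [eta'] enters twice. *)
pose Z := 2 * (C + 4 * B) / (eta * sg) + 1.
have Z1 : 1 <= Z.
  rewrite /Z lerDr divr_ge0// mulr_ge0//; last exact: ltW.
    by rewrite addr_ge0// mulr_ge0.
  exact: ltW.
pose n2 := maxn (maxn n0 n1) (Num.truncn (Z ^+ 2)).+1.
have lim_small : \forall h \near (0 : R)^', `|h| < expR (- (n2.+1%:R * Lam)).
  apply: dnbhs0_lt; exact: expR_gt0.
near=> h.
have h0 : h != 0 by near: h; exact: nbhs_dnbhs_neq.
have hn : 0 < `|h| by rewrite normr_gt0.
have hsmall : `|h| < expR (- (n2.+1%:R * Lam)) by near: h.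
set T := - ln `|h|.
have TL : n2.+1%:R * Lam <= T.
  by rewrite /T lerNr -(expRK (- _)) ler_ln ?posrE ?expR_gt0// ltW.
have h1 : `|h| <= 1.
  apply: (le_trans (ltW hsmall)); rewrite -expR0 ler_expR oppr_le0.
  by rewrite mulr_ge0// ltW.
have T0 : 0 < T by apply: lt_le_trans TL; rewrite mulr_gt0.
have TL' : n2.+1%:R <= T / Lam by rewrite ler_pdivlMr.
pose n := Num.truncn (T / Lam).
have n2n : (n2 <= n)%N.
  by rewrite -ltnS -(ltr_nat R) (lt_le_trans _ (ltW (truncnS_gt _)))// (lt_le_trans _ TL')// ltr_nat.
have nT : n%:R <= T / Lam by rewrite truncn_le divr_ge0 ?ltW.
have Tn : T / Lam <= n.+1%:R by rewrite ltW// truncnS_gt.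
have [n0n n1n Zn] : [/\ (n0 <= n)%N, (n1 <= n)%N & Z ^+ 2 <= n%:R].
  move: n2n; rewrite /n2 !geq_max => /andP[/andP[-> ->] tn]; split=> //.
  by rewrite (le_trans (ltW (truncnS_gt _)))// ler_nat.
have [F [hF F0 EF HF]] := Hn0 n n0n.
exists n, F; split=> // x Fx; have [phin HN] := HF x Fx.
have [N [HN1 HN2]] := HC x h h0 h1.
have n_gt0 : (0 < n)%N.
  by rewrite -(ltr0n R) (lt_le_trans _ Zn)// exprn_gt0// (lt_le_trans ltr01).
have nlb : 1 <= n%:R :> R by rewrite ler1n.
have timeN : `|S (log_derivative f) N x - n%:R * Lam| <= C + Lam.
  rewrite (_ : _ - _ = (S (log_derivative f) N x - T) + (T - n%:R * Lam)); last by ring.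
  rewrite (le_trans (ler_normD _ _))// lerD//; first by rewrite /T opprK.
  move: nT Tn; rewrite ler_pdivlMr// ler_pdivrMr// -(@natr1 R n) mulrDl mul1r => a1 a2.
  by rewrite ger0_norm ?subr_ge0// lerBlDl.
have SN := HN N timeN.
have Spsi : `|S (phi f v) n x - S psi n x| <= 2 * B.
  have -> : S (phi f v) n x = S psi n x - (chi x - chi (iter n f x)).
    rewrite -birkhoff_coboundary -mulN1r -birkhoff_linear.
    by apply: eq_bigr => i _; rewrite cob mulN1r.
  rewrite [X in `|X|](_ : _ = chi (iter n f x) - chi x); last by ring.
  by rewrite (le_trans (ler_normB _ _))// mulr_natl mulr2n lerD.
have r0 : 0 < Num.sqrt n%:R :> R by rewrite sqrtr_gt0 ltr0n.
have r2 : Num.sqrt n%:R ^+ 2 = n%:R :> R by rewrite sqr_sqrtr.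
have Zr : Z <= Num.sqrt n%:R.
  rewrite -(@ler_pXn2r _ 2) ?nnegrE ?sqrtr_ge0 ?r2//.
  exact: le_trans ler01 Z1.
pose u := Num.sqrt (T / Lam).
have u2 : u ^+ 2 = T / Lam by rewrite sqr_sqrtr// divr_ge0 ?ltW.
have u0 : 0 < u by rewrite sqrtr_gt0 divr_gt0.
have ru : Num.sqrt n%:R <= u by rewrite ler_wsqrtr.
have gap : `|u^-1 - (Num.sqrt n%:R)^-1| <= n%:R^-1.
  by apply: inverse_sqrt_gap => //; rewrite u2.
have QE : Q h x = (alpha (x + h) - alpha x) / h / sg / u.
  rewrite /Q /ell -/T /u sqrtrM ?(ltW T0)// sqrtrV ?(ltW Lam0)//.
  have sL0 : Num.sqrt Lam != 0 by rewrite gt_eqF// sqrtr_gt0.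
  have sT0 : Num.sqrt T != 0 by rewrite gt_eqF// sqrtr_gt0.
  have s0 : sg != 0 by rewrite gt_eqF.
  move: (Num.sqrt Lam) (Num.sqrt T) (sigma _ _ _) (_ - _) sL0 sT0 s0 => l t s d l0 t0 s0.
  by field; rewrite h0 l0 t0 s0.
rewrite QE.
set q := (alpha (x + h) - alpha x) / h in HN1 *.
have q1 : `|q - S psi n x| <= C + eta' * Num.sqrt n%:R + 2 * B.
  rewrite (_ : _ - _ = (q - S (phi f v) N x) + (S (phi f v) N x - S (phi f v) n x)
    + (S (phi f v) n x - S psi n x)); last by ring.
  by rewrite (le_trans (ler_normD _ _))// lerD// (le_trans (ler_normD _ _))// lerD.
have q2 : `|S psi n x| <= eta' * n%:R + 2 * B.
  rewrite -[S psi n x](subrK (S (phi f v) n x)) addrC.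
  by rewrite (le_trans (ler_normD _ _))// lerD// distrC.
move: (S psi n x) q1 q2 => w q1 q2.
have -> : q / sg / u - w / sg / Num.sqrt n%:R =
    ((q - w) / u + w * (u^-1 - (Num.sqrt n%:R)^-1)) / sg.
  by field; rewrite !gt_eqF.
rewrite normrM normfV (gtr0_norm sg0) ler_pdivrMr// (le_trans (ler_normD _ _))//.
have t1 : `|(q - w) / u| <= (C + 2 * B) / Num.sqrt n%:R + eta'.
  rewrite normrM normfV (gtr0_norm u0) ler_pdivrMr//.
  apply: (le_trans q1).
  apply: (@le_trans _ _ (((C + 2 * B) / Num.sqrt n%:R + eta') * Num.sqrt n%:R)).
    by rewrite le_eqVlt; apply/orP; left; apply/eqP; field; rewrite gt_eqF.
  rewrite ler_wpM2l// addr_ge0 ?(ltW eta'0)// divr_ge0 ?(ltW r0)//.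
  by rewrite addr_ge0// mulr_ge0.
have t2 : `|w * (u^-1 - (Num.sqrt n%:R)^-1)| <= eta' + 2 * B / Num.sqrt n%:R.
  rewrite normrM (le_trans (ler_pM _ _ q2 gap))//.
  rewrite mulrDl (mulfK (lt0r_neq0 (lt_le_trans ltr01 nlb))) lerD2l.
  rewrite ler_wpM2l ?mulr_ge0// lef_pV2 ?posrE ?ltr0n//.
  by rewrite -{2}r2 expr2 ler_peMr ?(ltW r0)// (le_trans Z1).
apply: (le_trans (lerD t1 t2)).
have t3 : (C + 4 * B) / Num.sqrt n%:R <= eta * sg / 2.
  rewrite ler_pdivrMr// -ler_pdivrMl ?divr_gt0 ?mulr_gt0//.
  apply: le_trans Zr; rewrite /Z (_ : _^-1 * _ = 2 * (C + 4 * B) / (eta * sg)).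
    by rewrite lerDl.
  by field; rewrite !gt_eqF.
have -> : (C + 2 * B) / Num.sqrt n%:R + eta' + (eta' + 2 * B / Num.sqrt n%:R) =
  (C + 4 * B) / Num.sqrt n%:R + eta * sg / 2 by rewrite /eta'; field; rewrite gt_eqF.
by rewrite [leRHS]splitr lerD2r.
Unshelve. all: by end_near. Qed.

(** The central limit theorem passes from the Birkhoff sums of the normalized
    martingale part to the difference quotients: both are tested against the
    same bounded Lipschitz function, so only their distance outside a set of
    small measure matters. *)
Lemma quotient_heat y c : 0 < c ->
  E (fun x => heat y c (Q h x)) @[h --> (0 : R)^'] --> heat y (c + 1) 0.
Proof.
move=> c0.
have [phi0 [psi [chi [[hpsi hchi] mpsi cob sg0 psi2]]]] :=
  sigma_gordin eps_gt0 eps_lt1 f_lift f_lip f_cont rho_mixing mu_circle mu_inv mu_ac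
    hphi sigma_neq0.
move: sg0 psi2 => sg0 psi2.
pose w x := psi x / sg.
have hw : hol w := hol_mul eps_gt0 hpsi (hol_cst eps_gt0 eps_lt1 _).
have mw : reverse_martingale eps f E w.
  move=> G hG; rewrite -(mulr0 sg^-1) -(mpsi G hG).
  have hG' : hol (fun x => psi x * G (f x)).
    exact: hol_mul hpsi (hol_lift eps_gt0 f_lift f_lip hG).
  by rewrite -(meanZ hE _ hG'); congr E; apply/funext => x; rewrite /w mulrAC mulrC.
have hw2 := hol_sqr eps_gt0 hw.
have h1 := hol_cst eps_gt0 eps_lt1 (1 : R).
have w2 : E (fun x => w x ^+ 2 - 1) = 0.
  rewrite (meanB eps_gt0 eps_lt1 hE hw2 h1) (mean1 hE).
  rewrite (_ : (fun x => w x ^+ 2) = fun x => sg ^- 2 * psi x ^+ 2); last first.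
    by apply/funext => x; rewrite /w exprMn exprVn mulrC.
  rewrite (meanZ hE _ (hol_sqr eps_gt0 hpsi)) psi2 mulVf ?subrr//.
  by rewrite expf_neq0// gt_eqF.
have mix := md_decorrelated rho_mixing (hol_sub eps_gt0 eps_lt1 hw2 h1) w2.
have clt := martingale_clt eps_gt0 eps_lt1 f_lift f_lip hE (y := y) hw mw mix c0.
have [M M0 heatM] := heat_step y c0.
have [[_ lipM _ _ _] _] := heatM c (lexx c).
have heat01 z : 0 <= heat y c z <= 1 by rewrite /heat Phi_ge0 Phi_le1.
apply/cvgrPdist_le => e e0.
have [n1 _ Hn1] : \forall n \near \oo,
    `|heat y (c + 1) 0 - E (fun x => heat y c (S w n x / Num.sqrt n%:R))| <= e / 2.
  by move/cvgrPdist_le: clt; apply; rewrite divr_gt0.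
have e4 : 0 < e / 4 by rewrite divr_gt0.
have M1 : 0 < M + 1 by rewrite ltr_wpDl.
have eta0 : 0 < e / 4 / (M + 1) by rewrite divr_gt0.
near=> h.
have [n [F [n1n hF F0 EF HF]]] : exists n F, [/\ (n1 <= n)%N, hol F,
    forall x, 0 <= F x, E F <= e / 4 &
    forall x, F x < 1 -> `|Q h x - S psi n x / sg / Num.sqrt n%:R| <= e / 4 / (M + 1)].
  by near: h; exact: (quotient_close n1 hpsi hchi cob sg0 phi0 eta0 e4).
have SwE x : S psi n x / sg / Num.sqrt n%:R = S w n x / Num.sqrt n%:R.
  by congr (_ / _); rewrite /birkhoff mulr_suml.
pose W x := heat y c (S w n x / Num.sqrt n%:R).
pose V x := heat y c (Q h x).
have hW : hol W.
  apply: (hol_lip_comp lipM (g := fun x => S w n x / Num.sqrt n%:R)).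
  apply: (hol_mul eps_gt0 _ (hol_cst eps_gt0 eps_lt1 _)).
  exact: hol_birkhoff.
have hV : hol V by exact: (hol_lip_comp lipM (hol_quotient h)).
have VW x : `|V x - W x| <= e / 4 + F x.
  have [F1|F1] := ltP (F x) 1.
    have d := HF x F1; rewrite SwE in d.
    rewrite (le_trans (lipM _ _))// -[leLHS]addr0 lerD ?F0//.
    rewrite (le_trans (ler_wpM2l M0 d))// mulrC mulrAC ler_pdivrMr//.
    by rewrite ler_pM2l// lerDl.
  apply: (@le_trans _ _ 1); last by rewrite -[leLHS]add0r lerD// ltW.
  have := heat01 (S w n x / Num.sqrt n%:R); have := heat01 (Q h x).
  rewrite -/(V x) -/(W x); move: (V x) (W x) => p q /andP[p0 p1] /andP[q0 q1].
  by rewrite ler_norml; lra.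
have hb : hol (fun x => e / 4 + F x) := hol_add (hol_cst eps_gt0 eps_lt1 _) hF.
have Eb : E (fun x => e / 4 + F x) <= e / 2.
  rewrite (meanD hE (hol_cst eps_gt0 eps_lt1 _) hF) (mean_cst eps_gt0 eps_lt1 hE).
  by move: EF; move: (E F) => q; lra.
apply: (le_trans (ler_distD (E W) _ _)).
apply: (le_trans (lerD (Hn1 n n1n) _) (_ : e / 2 + e / 2 <= e)); last by rewrite -splitr.
apply: le_trans Eb; apply: (mean_dist_le hE hW hV hb) => x; rewrite distrC; exact: VW.
Unshelve. all: by end_near. Qed.

End with_density.

End difference_quotient.

(** * From smooth test functions to distribution functions *)

Section smoothing.
Variables (R : realType) (mu : probability (measurableTypeR R) R) (eps : R).
Hypothesis eps_gt0 : 0 < eps.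
Local Notation hol := (hol eps).

Lemma Phi_lipschitz (x y : R) : `|Phi x - Phi y| <= `|x - y|.
Proof.
have H := @derive_bound_lipschitz R (@Phi R) (@gauss R) 1 y x (@Phi_derive R).
rewrite -[leRHS]mul1r; apply: H => t.
have [g1 _ _ _] := gauss_moments t.
by rewrite ger0_norm// ltW// gauss_gt0.
Qed.

Lemma heat_sqr (y s x : R) : 0 < s -> heat y (s ^+ 2) x = Phi ((y - x) / s).
Proof. by move=> s0; rewrite /heat sqrtr_sqr gtr0_norm. Qed.

Lemma hol_smoothed_step g (y s : R) : 0 < s -> hol g -> hol (fun x => heat y (s ^+ 2) (g x)).
Proof.
move=> s0 hg.
have L a b : `|heat y (s ^+ 2) a - heat y (s ^+ 2) b| <= s^-1 * `|a - b|.
  rewrite !heat_sqr// (le_trans (Phi_lipschitz _ _))//.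
  rewrite -mulrBl normrM normfV (gtr0_norm s0) mulrC.
  by rewrite opprB [X in `|X|]addrC addrA subrK distrC.
exact: (hol_lip_comp L hg).
Qed.

(** A bounded smooth step lies between two indicators up to [e], once its
    centre is moved by [A * s], where the normal law charges [[-A, A]] with
    all but [2 * e] of its mass. *)
Lemma distribution_sandwich (g : R -> R) (y s A e : R) :
    hol g -> 0 < s -> 1 - e <= Phi A -> Phi (- A) <= e ->
  let p := fine (mu [set x | g x <= y]) in
  (1 - e) * p <= mu_mean mu (fun x => heat (y + A * s) (s ^+ 2) (g x)) /\
  mu_mean mu (fun x => heat (y - A * s) (s ^+ 2) (g x)) <= e + p.
Proof.
move=> hg s0 PA PA'.
have mA := measurable_sublevel y (hol_continuous eps_gt0 hg).
have c1 := hol_continuous eps_gt0 (hol_smoothed_step (y + A * s) s0 hg).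
have c2 := hol_continuous eps_gt0 (hol_smoothed_step (y - A * s) s0 hg).
have b z x : `|heat z (s ^+ 2) (g x)| <= 1 by rewrite ger0_norm ?Phi_ge0 ?Phi_le1.
split.
- have := @mu_mean_ge_indicator R mu _ 1 0 (1 - e) _ c1 (b (y + A * s)) mA.
  rewrite add0r; apply=> x; rewrite add0r indicE heat_sqr//.
  case: (boolP (x \in _)); last by rewrite mulr0 Phi_ge0.
  rewrite inE/= mulr1 => gy; apply: (le_trans PA); apply: Phi_homo.
  by rewrite ler_pdivlMr//; lra.
- have := @mu_mean_le_indicator R mu _ 1 e 1 _ c2 (b (y - A * s)) mA.
  rewrite mul1r; apply=> x; rewrite mul1r indicE heat_sqr//.
  case: (boolP (x \in _)) => [_|].
    by rewrite (le_trans (Phi_le1 _))// lerDr (le_trans (Phi_ge0 _) PA').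
  rewrite notin_setE/= addr0 => /negP; rewrite -ltNge => gy.
  by apply: le_trans PA'; apply: Phi_homo; rewrite ler_pdivrMr//; lra.
Qed.

(** The Gaussian limit law, smoothed at scale [s], is a Gaussian of variance
    [s ^+ 2 + 1]; moving the centre by [a * s] and widening the law are both
    negligible when [s] is small. *)
Lemma rescaled_centre (y B e : R) : 0 < e -> exists2 s, 0 < s &
  forall a, `|a| <= B -> `|(y + a * s) / Num.sqrt (s ^+ 2 + 1) - y| <= e.
Proof.
move=> e0; have d0 : 0 < `|B| + `|y| + 1 by rewrite ltr_wpDl// addr_ge0.
pose s := e / (`|B| + `|y| + 1).
have s0 : 0 < s by rewrite divr_gt0.
have sE : s * (`|B| + `|y| + 1) = e by rewrite divfK// gt_eqF.
move: s s0 sE => s s0 sE; exists s => // a aB.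
have r2 : Num.sqrt (s ^+ 2 + 1) ^+ 2 = s ^+ 2 + 1.
  by rewrite sqr_sqrtr// addr_ge0// sqr_ge0.
have r0 := sqrtr_ge0 (s ^+ 2 + 1).
move: (Num.sqrt _) r2 r0 => r r2 r0.
have r1 : 1 <= r.
  by rewrite -(@ler_pXn2r _ 2) ?nnegrE// r2 expr1n lerDr sqr_ge0.
have rs : r - 1 <= s.
  have : r <= s + 1.
    rewrite -(@ler_pXn2r _ 2) ?nnegrE ?addr_ge0 ?(ltW s0)// r2; nra.
  by lra.
have rp : 0 < r by exact: lt_le_trans r1.
rewrite (_ : _ - y = (a * s - y * (r - 1)) / r); last by field; rewrite gt_eqF.
rewrite normrM normfV (gtr0_norm rp) ler_pdivrMr//.
apply: (@le_trans _ _ (e * 1)); last by rewrite ler_wpM2l// ltW.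
rewrite mulr1 (le_trans (ler_normB _ _))// !normrM (gtr0_norm s0).
have h1 : `|a| * s <= `|B| * s.
  by rewrite ler_wpM2r ?(ltW s0)// (le_trans aB)// ler_norm.
have h2 : `|y| * `|r - 1| <= `|y| * s.
  by rewrite ler_wpM2l// ger0_norm// subr_ge0.
by rewrite -sE; move: h1 h2 s0; move: (`|a| * s) (`|y| * _) => p q; lra.
Qed.

Lemma distribution_cvg (Q : R -> R -> R) (y : R) :
    (forall h, hol (Q h)) ->
    (forall z c, 0 < c ->
      mu_mean mu (fun x => heat z c (Q h x)) @[h --> (0 : R)^'] --> heat z (c + 1) 0) ->
  mu [set x | Q h x <= y] @[h --> (0 : R)^'] --> (Phi y)%:E.
Proof.
move=> hQ QE.
have mA h := measurable_sublevel y (hol_continuous eps_gt0 (hQ h)).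
apply: cvg_EFin; first by near=> h; exact: fin_num_measure.
apply/cvgrPdist_le => e e0.
pose e1 := e / 4; have e10 : 0 < e1 by rewrite divr_gt0.
have [A A0 [PA PA']] := Phi_near1 e10.
have [s s0 Hs] := rescaled_centre y A e10.
have s20 : 0 < s ^+ 2 by rewrite exprn_gt0.
have target a : `|a| <= A -> `|heat (y + a * s) (s ^+ 2 + 1) 0 - Phi y| <= e1.
  by move=> aA; rewrite /heat subr0 (le_trans (Phi_lipschitz _ _))// Hs.
have t1 := target A _; have t2 := target (- A) _.
rewrite normrN mulNr ger0_norm ?(ltW A0)// in t1 t2.
have {t1} t1 := t1 (lexx _); have {t2} t2 := t2 (lexx _).
have /cvgrPdist_le/(_ e1 e10) n1 := QE (y + A * s) _ s20.
have /cvgrPdist_le/(_ e1 e10) n2 := QE (y - A * s) _ s20.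
apply: filterS2 n1 n2 => h m1 m2.
have [l1 l2] := distribution_sandwich y (hQ h) s0 PA PA'.
have p1 : fine (mu [set x | Q h x <= y]) <= 1.
  rewrite -lee_fin fineK ?fin_num_measure//.
  exact: probability_le1.
rewrite /=; move: l1 l2 p1 m1 m2 t1 t2.
move: (fine _) (mu_mean _ _) (mu_mean _ _) (heat _ _ _) (heat _ _ _) (Phi y).
move=> p q1 q2 h1 h2 P l1 l2 p1; rewrite !ler_norml.
have : e1 * p <= e1 * 1 by rewrite ler_pM2l.
by rewrite mulr1 mulrBl mul1r in l1 *; move: l1 l2 p1; move: (e1 * p) => q; rewrite /e1; lra.
Unshelve. all: by end_near. Qed.

End smoothing.

Theorem theorem1p6 (R : realType) (eps : R) (f v : R -> R)
    (mu : probability (measurableTypeR R) R)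
    (eps_gt0 : 0 < eps) (eps_lt1 : eps < 1)
    (f_lift : circle_lift f) (f_C2 : C_holder 2 eps f)
    (f_expanding : expanding f)
    (v_periodic : periodic v 1) (v_C1 : C_holder 1 eps v)
    (mu_circle : circle_probability mu)
    (mu_ac : mu `<< @lebesgue_measure R)
    (mu_inv : circle_invariant f mu)
    (sigma_neq0 : sigma mu f (phi f v) != 0) :
  forall y : R,
    mu [set x : R | (gen_weierstrass f v (x + h) - gen_weierstrass f v x)
                    / (sigma mu f (phi f v) * ell mu f * h
                       * Num.sqrt (- ln `|h|)) <= y]
      @[h --> (0 : R)^'] -->
    ((Num.sqrt (2 * pi))^-1
      * \int[@lebesgue_measure R]_(t in `]-oo, y]) expR (- (t ^+ 2 / 2)))%:E.
Proof.
move=> y.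
have hQ := hol_quotient mu eps_gt0 eps_lt1 f_lift f_C2 f_expanding v_periodic v_C1.
apply: (distribution_cvg eps_gt0 hQ) => z c c0.
have [lam lam1 D_gt] := f_expanding.
have [M M0 D_lip] := map_D_lip eps_gt0 f_lift f_C2.
have [Lf _ f_lip] := map_lip eps_gt0 eps_lt1 f_lift f_C2 f_expanding.
have [rho rho_mixing] := expanding_mixing_density eps_gt0 eps_lt1 lam1 M0
  (map_derive f_C2) D_gt D_lip f_lip f_lift.
have f_cont : continuous f.
  by move=> x; exact: is_derive_continuous (map_derive f_C2 x).
have [K _] := heat_step z c0 => /(_ c (lexx c)) [[_ lipK _ _ _] _].
rewrite (_ : (fun h => _) = fun h =>
    rho_mean rho (fun x => heat z c (normalized_quotient f v mu h x))); last first.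
  apply/funext => h; apply: (mu_meanE eps_gt0 eps_lt1 f_lift f_lip f_cont
    rho_mixing mu_circle mu_inv mu_ac).
  exact: (hol_lip_comp lipK (hQ h)).
exact: (quotient_heat eps_gt0 eps_lt1 f_lift f_C2 f_expanding v_periodic v_C1
  mu_circle mu_inv mu_ac sigma_neq0 rho_mixing f_lip).
Qed.
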